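(* Let $\mathcal W:\mathbb R^{dr}\to[0,1]$ be measurable, and let $\mathcal F$ be a class of measurable functions $f=(f_j)_{j=1,\dots,d}:\mathbb R^{dr}\to\mathbb R^d$ with $\sup_{f\in\mathcal F}\sup_{j\in\{1,\dots,d\}}\sup_{x\in\mathrm{supp}(\mathcal W)}|f_j(x)|\le F$ for some constant $F>0$. Assume that there is $C_\varepsilon>0$ with $\mathbb E[|\varepsilon_{1j}|^k]^{1/k}\le C_\varepsilon\sqrt k$ for all $k\in\mathbb N$, $j\in\{1,\dots,d\}$, and that $(X_i)$ and $\phi$ satisfy the compatibility assumption of the context, with associated function $\Lambda^{mix}$. Let $\hat f\in\arg\min_{f\in\mathcal F}\hat R_n(f)$. Then for any $\delta\in(0,1)$ and $\eta>0$ there exists a constant $\mathbb C=\mathbb C(\eta,c_0,r,C_{\beta^{mix}},C_\varepsilon,F)$, depending only on the indicated quantities, such that $$\mathbb E D(\hat f)\le(1+\eta)^2\inf_{f\in\mathcal F}D(f)+\mathbb C\cdot\Big\{\Lambda^{mix}\Big(\frac{H(\delta)}{n}\Big)+\delta\Big\}.$$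
   Context: Model: $d,r\in\mathbb N$. $(X_i)_{i\in\mathbb Z}$ is a stationary $\mathbb R^d$-valued process with $X_i=f_0(\mathbb X_{i-1})+\varepsilon_i$, where $\mathbb X_{i-1}:=(X_{i-1},\dots,X_{i-r})\in\mathbb R^{dr}$, $f_0:\mathbb R^{dr}\to\mathbb R^d$ is measurable, and $\varepsilon_i=(\varepsilon_{i1},\dots,\varepsilon_{id})$ are i.i.d. with $\mathbb E\varepsilon_i=0$, $\varepsilon_i$ independent of $(X_j)_{j<i}$. One observes $X_1,\dots,X_n$, $n>r$. $|\cdot|_2$ is the Euclidean norm. For deterministic measurable $f:\mathbb R^{dr}\to\mathbb R^d$, $D(f):=\frac1d\mathbb E[|f(\mathbb X_r)-f_0(\mathbb X_r)|_2^2\,\mathcal W(\mathbb X_r)]$; for a random (data-dependent) $\hat f$, $D(\hat f)$ is $D(f)$ evaluated at $f=\hat f$. Further, $\hat R_n(f):=\frac1n\sum_{i=r+1}^n\frac1d|X_i-f(\mathbb X_{i-1})|_2^2\,\mathcal W(\mathbb X_{i-1})$. Entropy: $N(\delta,\mathcal F,\|\cdot\|_\infty)$ is the smallest number of $\delta$-brackets with respect to $\|f\|_\infty:=\sup_{j}\sup_{x}|f_j(x)|$ needed to cover $\mathcal F$ (a $\delta$-bracket is $\{f: l_j\le f_j\le u_j\ \forall j\}$ with $\|u-l\|_\infty\le\delta$), and $H(\delta):=\log N(\delta,\mathcal F,\|\cdot\|_\infty)$. Mixing: for $\sigma$-fields $\mathcal U,\mathcal V$, $2\beta^{mix}(\mathcal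 U,\mathcal V):=\sup\sum_{(i,j)}|\mathbb P(U_i\cap V_j)-\mathbb P(U_i)\mathbb P(V_j)|$ over all finite partitions $(U_i)\subset\mathcal U$, $(V_j)\subset\mathcal V$ of the probability space; $\beta^{mix}(k):=\beta^{mix}(\sigma(X_i:i\le0),\sigma(X_i:i\ge k))$, $k\in\mathbb N_0$. Compatibility assumption: there is $C_{\beta,sub}>0$ with $\beta^{mix}(q_1q_2)\le C_{\beta,sub}\beta^{mix}(q_1)\beta^{mix}(q_2)$ for all $q_1,q_2\in\mathbb N$; and $\phi:[0,\infty)\to[0,\infty)$ satisfies: $\phi(0)=0$, $\phi$ is convex and differentiable with $c_0:=\sup_{y>0}\frac{\phi'(y)y}{\phi(y)}<\infty$; $y\mapsto y/\phi(y)$ maps $(0,\infty)$ to $(0,\infty)$ and is convex and decreasing; $\sum_{k=0}^\infty(\phi^*(k+1)-\phi^*(k))\beta^{mix}(k)<\infty$, where $\phi^*(x):=\sup_{y>0}\{xy-\phi(y)\}$. Then $\psi(x):=\phi^*(x)x$ and $\Lambda^{mix}(x):=\lceil\psi^{-1}(x^{-1})\rceil x$ for $x>0$, with $\Lambda^{mix}(0):=0$. $C_{\beta^{mix}}$ stands for the constants describing the mixing coefficients, namely $C_{\beta,sub}$ and $C_\beta:=(1+\int_0^1\phi^*(\beta^{-1}(u))\,du)^{1/2}$, where $\beta(t):=\beta^{mix}(\lfloor t\rfloor)$ for $t\ge1$, $\beta(t):=1$ for $0\le t<1$, and $\beta^{-1}(u):=\inf\{t\ge 0:\beta(t)\le u\}$.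 *)

(* Defs.v *)
From HB Require Import structures.
From mathcomp Require Import all_boot all_order all_algebra.
From mathcomp Require Import all_classical all_reals all_analysis.
(* Not re-exported above: provides the measurableType structure of \bar R. *)
From mathcomp Require Import measurable_realfun.

Set Implicit Arguments.
Unset Strict Implicit.
Unset Printing Implicit Defensive.

Import Order.TTheory GRing.Theory Num.Theory.
Import numFieldNormedType.Exports.

Local Open Scope classical_set_scope.
Local Open Scope ring_scope.

(* R^d is 'rV[R]_d and R^(dr) is 'M[R]_(r, d), one row per lag.  Matrix spaces
   carry the sigma-algebra generated by the coordinates, i.e. the Borel one. *)
Definition mx_display : measure_display -> measure_display.
Proof. exact. Qed.

Section matrix_measurable.
Context {R : realType} {m n : nat}.

Definition mx_coord_sets : set (set 'M[R]_(m, n)) :=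
  \bigcup_(ij in [set: 'I_m * 'I_n])
    preimage_set_system setT (fun A : 'M[R]_(m, n) => A ij.1 ij.2)
      (measurable : set (set R)).

HB.instance Definition _ := @isMeasurable.Build (mx_display default_measure_display)
  'M[R]_(m, n) <<s mx_coord_sets >>
  (@sigma_algebra0 _ setT mx_coord_sets)
  (@sigma_algebraC _ mx_coord_sets)
  (@sigma_algebra_bigcup _ setT mx_coord_sets).
End matrix_measurable.

Definition norm2 {R : realType} {d : nat} (v : 'rV[R]_d) : R :=
  Num.sqrt (\sum_(j < d) v 0 j ^+ 2).

Definition supp {R : realType} {m n : nat} (W : 'M[R]_(m, n) -> R) :
  set 'M[R]_(m, n) := closure [set x | W x != 0].

Section process.
Context {R : realType} {dT : measure_display} {T : measurableType dT}.
Variable P : probability T R.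
Context {dE : measure_display} {E : measurableType dE}.
Implicit Types Y : int -> {RV P >-> E}.

Definition mutually_independent Y : Prop :=
  forall (s : seq int) (A : int -> set E), uniq s ->
    (forall i, measurable (A i)) ->
    P (\bigcap_(i in [set` s]) (Y i @^-1` A i)) =
    (\prod_(i <- s) P (Y i @^-1` A i))%E.

Definition identically_distributed Y : Prop :=
  forall (i i' : int) (A : set E), measurable A ->
    P (Y i @^-1` A) = P (Y i' @^-1` A).

Definition stationary Y : Prop :=
  forall (m : nat) (t : m.-tuple int) (h : int) (B : set (m.-tuple E)),
    measurable B ->
    P [set w | B [tuple Y (tnth t k + h) w | k < m]] =
    P [set w | B [tuple Y (tnth t k) w | k < m]].

Definition sigma_field Y (I : set int) : set (set T) :=
  <<s \bigcup_(i in I) preimage_set_system setT (Y i) measurable >>.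

Definition independent_sigma (U V : set (set T)) : Prop :=
  forall A B, U A -> V B -> P (A `&` B) = (P A * P B)%E.

(* The supremum is over a nonempty set of reals bounded by 2. *)
Definition beta_mix (U V : set (set T)) : R :=
  2^-1 * sup [set z | exists (p q : nat) (A : 'I_p -> set T) (B : 'I_q -> set T),
    [/\ (forall i, U (A i)) /\ partition setT A setT,
        (forall j, V (B j)) /\ partition setT B setT &
        z = \sum_(i < p) \sum_(j < q)
              `|fine (P (A i `&` B j)) - fine (P (A i)) * fine (P (B j))|]].

Definition beta_coef Y (k : nat) : R :=
  beta_mix (sigma_field Y [set i | i <= 0]) (sigma_field Y [set i | k%:Z <= i]).
End process.

Section compatibility.
Context {R : realType}.
Implicit Types (phi : R -> R) (beta : nat -> R).

Definition phi_star phi (x : R) : \bar R :=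
  ereal_sup [set (x * y - phi y)%:E | y in [set y | 0 < y]].

Definition phi_c0 phi : \bar R :=
  ereal_sup [set (derive1 phi y * y / phi y)%:E | y in [set y | 0 < y]].

(* Only the values of phi on [0, +oo[ matter.  The one-sided derivative at 0
   exists by convexity.  The differences phi*(k+1) - phi*(k) are meaningful
   only if phi* is finite on nat; in \bar R, +oo - +oo would be -oo. *)
Record compatible beta phi (c0 Cbsub : R) : Prop := Compatible {
  compat_sub : forall q1 q2, (0 < q1)%N -> (0 < q2)%N ->
    beta (q1 * q2)%N <= Cbsub * beta q1 * beta q2;
  compat_ge0 : forall y : R, 0 <= y -> 0 <= phi y;
  compat_phi0 : phi 0 = 0;
  compat_convex : convex_function (`[0, +oo[ : set R^o) (phi : R^o -> R^o);
  compat_derivable : forall y : R, 0 < y -> derivable phi y 1;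
  compat_c0 : phi_c0 phi = c0%:E;
  compat_gt0 : forall y : R, 0 < y -> 0 < y / phi y;
  compat_ratio_convex :
    convex_function (`]0, +oo[ : set R^o) ((fun y => y / phi y) : R^o -> R^o);
  compat_ratio_decr : forall x y : R, 0 < x -> x <= y -> y / phi y <= x / phi x;
  compat_star_fin : forall k : nat, phi_star phi k%:R \is a fin_num;
  compat_sum : (\sum_(0 <= k <oo)
      (phi_star phi k.+1%:R - phi_star phi k%:R) * (beta k)%:E < +oo)%E }.

Definition psi phi (x : R) : \bar R := (phi_star phi x * x%:E)%E.

(* For z > 0 there is exactly one x >= 0 with psi x = z, although psi may
   vanish on an interval. *)
Definition psi_inv phi (z : R) : R :=
  xget 0 [set x | 0 <= x /\ psi phi x = z%:E].

Definition Lambda_mix phi (x : R) : R :=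
  if x == 0 then 0 else (Num.ceil (psi_inv phi x^-1))%:~R * x.

Definition beta_fun beta (t : R) : R :=
  if t < 1 then 1 else beta (Num.truncn t).

Definition beta_inv beta (u : R) : R :=
  inf [set t | 0 <= t /\ beta_fun beta t <= u].

(* The open interval avoids u = 0, where beta_inv may be the infimum of the
   empty set. *)
Definition C_beta beta phi : \bar R :=
  ((1 + \int[lebesgue_measure]_(u in `]0%R, 1%R[) phi_star phi (beta_inv beta u))
     `^ (2^-1))%E.
End compatibility.

Section entropy.
Context {R : realType} {E : Type} {d : nat}.
Implicit Types (f l u : E -> 'rV[R]_d) (F : set (E -> 'rV[R]_d)).

Definition sup_norm f : \bar R :=
  ereal_sup [set `|f xj.1 0 xj.2|%:E | xj in [set: E * 'I_d]].

Definition bracket l u : set (E -> 'rV[R]_d) :=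
  [set f | forall j x, l x 0 j <= f x 0 j <= u x 0 j].

(* Equal to +oo if no finite family of brackets covers F. *)
Definition bracket_number (delta : R) F : \bar R :=
  ereal_inf [set m%:R%:E | m in [set m : nat |
    exists l u : 'I_m -> E -> 'rV[R]_d,
      (forall k, (sup_norm (fun x => u k x - l k x)%R <= delta%:E)%E) /\
      F `<=` \bigcup_(k in [set: 'I_m]) bracket (l k) (u k)]].

Definition entropy (delta : R) F : \bar R := lne (bracket_number delta F).
End entropy.

Section model.
Context {R : realType} {dT : measure_display} {T : measurableType dT}.
Variable P : probability T R.
Variables d r : nat.
Implicit Types (X eps : int -> {RV P >-> 'rV[R]_d}).
Implicit Types (f : 'M[R]_(r, d) -> 'rV[R]_d) (W : 'M[R]_(r, d) -> R).

(* Row k of lag X i is X_(i - k), so that lag X i = (X_i, ..., X_(i-r+1)). *)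
Definition lag X (i : int) (w : T) : 'M[R]_(r, d) :=
  \matrix_(k < r, j < d) X (i - k%:Z) w 0 j.

Record autoregressive X eps (f0 : 'M[R]_(r, d) -> 'rV[R]_d) : Prop := Autoregressive {
  ar_stationary : stationary X;
  ar_measurable : measurable_fun setT f0;
  ar_eq : forall i w, X i w = f0 (lag X (i - 1) w) + eps i w;
  ar_indep : mutually_independent eps;
  ar_ident : identically_distributed eps;
  ar_mean : forall i (j : 'I_d), ('E_P[fun w => eps i w 0%R j] = 0)%E;
  ar_innov : forall i, independent_sigma P
    (sigma_field eps [set i]) (sigma_field X [set k | k < i]) }.

Definition pred_error X (f0 : 'M[R]_(r, d) -> 'rV[R]_d) W f : \bar R :=
  ((d%:R^-1)%:E *
   'E_P[fun w => (norm2 (f (lag X r%:Z w) - f0 (lag X r%:Z w)) ^+ 2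
                 * W (lag X r%:Z w))%R])%E.

Definition emp_risk X W (n : nat) f (w : T) : R :=
  n%:R^-1 * \sum_(r.+1 <= i < n.+1)
    (d%:R^-1 * norm2 (X i%:Z w - f (lag X (i%:Z - 1) w)) ^+ 2
     * W (lag X (i%:Z - 1) w)).

(* The second condition makes the expectation of D(fhat) meaningful. *)
Record empirical_minimizer X (f0 : 'M[R]_(r, d) -> 'rV[R]_d) W (n : nat) (F : set ('M[R]_(r, d) -> 'rV[R]_d))
    (fhat : T -> 'M[R]_(r, d) -> 'rV[R]_d) : Prop := EmpiricalMinimizer {
  em_in : forall w, F (fhat w);
  em_measurable : measurable_fun setT (fun w => pred_error X f0 W (fhat w));
  em_min : forall w f, F f -> emp_risk X W n (fhat w) w <= emp_risk X W n f w }.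
End model.

(* Main.v *)
(* No coupling is constructed, and f0 may be unbounded.

   Mixing.  Cover F by N elements g_k at uniform distance delta and put
   q = ceil (psi^-1 (n / H)), so that q H / n is Lambda^mix (H / n) and
   beta (q) <= C_beta^2 / phi^* (q) <= C_beta^2 q H / n.  Split the time indices
   into residue classes modulo L = q + r - 1.  Along one class the exponential
   weights exp (lam * sum_j ((1 - a) E l_k - l_k (X_j))) of the losses l_k >= 0
   satisfy, after rounding l_k to finitely many values,
     ln (sum of weights at j + 1) - ln (sum of weights at j) <= D (past, X_j),
   where D is bounded by 1, and has nonpositive mean when X_j is replaced by an
   independent copy; the replacement costs 2 beta (q) by the very definition of
   the mixing coefficient.  Hence E max_k ((1 - a) E l_k - P_n l_k) is at most a
   constant times L H / n + beta (q).

   Noise.  exp (lam * sum_i (<eps_i, W (g_k - f)> - c lam |W (g_k - f)|^2)) is a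
   supermartingale, so the noise in the basic inequality costs H / n plus a small
   multiple of the empirical losses of g_k and f.

   Truncation.  Where |f0| is large compared with F / a all losses of the class
   agree up to a factor 1 + a, so this part is compared pointwise; elsewhere the
   losses are bounded. *)

Require Import Defs.
From HB Require Import structures.
From mathcomp Require Import all_boot all_order all_algebra.
From mathcomp Require Import all_classical all_reals all_analysis.
From mathcomp Require Import measurable_realfun.
From mathcomp Require Import lra ring zify.

Set Implicit Arguments.
Unset Strict Implicit.
Unset Printing Implicit Defensive.

Import Order.TTheory GRing.Theory Num.Theory.
Import numFieldNormedType.Exports.

Local Open Scope classical_set_scope.
Local Open Scope ring_scope.

(** The logarithm makes the mixing cost additive. In an exponential moment each replacement by an
    independent copy would cost in proportion to the current weights; the logarithm of the total
    weight grows by at most a weighted average of quantities in [-1, 1], so every time index pays a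
    total variation distance once, whatever the weights. Division by [lam * n] leaves a multiple of
    [beta q]. The factor [1 - a] absorbs the quadratic term of the exponential, hence [H / n]
    without a square root.

    The [g k] close to [fhat w] depends on [w] without a measurable choice. So the maxima over [k]
    are dominated by measurable functions [G] and [Q], and the inequality is proved outcome by
    outcome before it is integrated.

    Remainders of order [1 / n] have to fit under [Lambda_mix (H / n)]. For [N >= 2] they do, since
    [ln N >= 1 / 2]. For [N = 1] the entropy is 0 and only [delta] is available; but then one
    bracket contains the class, and two deterministic comparisons give [(1 + eta) ^ 2]. Coordinates
    are averaged by Jensen's inequality, so no constant depends on [d]. *)

Section real_inequalities.
Context {R : realType}.
Implicit Types x y : R.

(** Reciprocal of [1 + x <= expR x], because [(1 + x) * (1 - x + x ^+ 2) = 1 + x ^+ 3 >= 1]. *)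
Lemma expRN_le_quadratic x : 0 <= x -> expR (- x) <= 1 - x + x ^+ 2.
Proof.
move=> x0; rewrite expRN -lef_pV2 ?posrE ?invr_gt0 ?expR_gt0//; last nra.
rewrite invrK (le_trans _ (expR_ge1Dx x))//.
rewrite -[leLHS]mul1r ler_pdivrMr; nra.
Qed.

(** For [y >= 0], multiply [(1 - y) * expR y <= 1] by [1 + y]; for [y < 0] the previous bound is
    already stronger. *)
Lemma expR_le_quadratic y : expR y <= 1 + y + y ^+ 2 * expR `|y|.
Proof.
have [y0|y0] := leP 0 y; last first.
  rewrite ltr0_norm// -{1}[y]opprK.
  apply: (le_trans (expRN_le_quadratic _)); first lra.
  rewrite opprK sqrrN lerD2l ler_peMr ?sqr_ge0//.
  by rewrite -expR0 ler_expR; lra.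
rewrite ger0_norm//.
have h : (1 - y) * expR y <= 1.
  have := expR_ge1Dx (- y); rewrite expRN => h.
  by rewrite -ler_pdivlMr ?expR_gt0// div1r.
have : 0 <= (1 + y) * (1 - (1 - y) * expR y) by rewrite mulr_ge0; lra.
lra.
Qed.

(** The tangent of [ln] at [N]. It replaces Jensen's inequality for the logarithm of a sum of [N]
    exponentials by a pointwise bound that is linear in the sum. *)
Lemma ln_le_affine (y N : R) : 0 < y -> 0 < N -> ln y <= y / N + ln N.
Proof.
move=> y0 N0; rewrite -lerBlDr -ln_div//.
have h : 0 < y / N by rewrite divr_gt0.
have := @le_ln1Dx R (y / N - 1); rewrite subrKC => H.
by apply: (le_trans (H _)); lra.
Qed.

Lemma half_le_ln2 : 2^-1 <= ln 2 :> R.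
Proof.
have h : ln (2^-1 : R) <= - 2^-1.
  have := @le_ln1Dx R (2^-1 - 1); rewrite subrKC => H.
  by apply: (le_trans (H _)); lra.
move: h; rewrite lnV ?posrE//; lra.
Qed.

(** Keeps the entropy away from 0 as soon as there are two brackets, so that terms of order [1 / n]
    are absorbed by [H / n]. *)
Lemma half_le_ln (N : nat) : (1 < N)%N -> 2^-1 <= ln N%:R :> R.
Proof.
move=> N1; apply: (le_trans half_le_ln2).
by rewrite ler_ln ?posrE ?ler_nat ?ltr0n//; lia.
Qed.

Lemma lnS_le (N : nat) : (1 < N)%N -> ln (1 + N%:R) <= 2 * ln N%:R :> R.
Proof.
move=> N1; have N0 : 0 < N%:R :> R by rewrite ltr0n; lia.
rewrite mulr2n mulrDl mul1r -lnM ?posrE//.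
have N2 : 2 <= N%:R :> R by rewrite (ler_nat _ 2).
have h : 0 < 1 + N%:R :> R by lra.
by rewrite ler_ln ?posrE ?mulr_gt0//; nra.
Qed.

End real_inequalities.

(** * Conjugate functions and the mixing rate *)

Section integral_monotone.
Context d (T : measurableType d) (R : realType).
Variable mu : {measure set T -> \bar R}.
Local Open Scope ereal_scope.

Import HBNNSimple.

(* Unlike [ge0_le_integral], no measurability is needed: both sides are
   suprema over the simple functions below the integrand. *)
Lemma ge0_le_integral_sub (A B : set T) (f g : T -> \bar R) :
  A `<=` B -> (forall x, A x -> 0 <= f x) -> (forall x, B x -> 0 <= g x) ->
  (forall x, A x -> f x <= g x) ->
  \int[mu]_(x in A) f x <= \int[mu]_(x in B) g x.
Proof.
move=> AB f0 g0 fg; rewrite !ge0_integralE//.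
apply: ereal_sup_le => _ [h hf <-]; exists h => // x; apply: (le_trans (hf x)).
rewrite /patch; case: ifPn => [|_]; first by rewrite inE => /[dup] /AB/mem_set -> /fg.
by case: ifPn => //; rewrite inE => /g0.
Qed.

Lemma ge0_le_integralT (f g : T -> \bar R) :
  (forall x, 0 <= f x) -> (forall x, f x <= g x) ->
  \int[mu]_x f x <= \int[mu]_x g x.
Proof.
move=> f0 fg; apply: ge0_le_integral_sub => // x _.
exact: le_trans (fg x).
Qed.

End integral_monotone.

Section conjugate.
Context {R : realType}.
Variables (beta : nat -> R) (phi : R -> R) (c0 Cbsub : R).
Hypothesis cphi : compatible beta phi c0 Cbsub.
Implicit Types x y : R.

Local Notation star := (phi_star phi).
Local Notation s x := (fine (phi_star phi x)).

Lemma phi_star_ge x y : 0 < y -> ((x * y - phi y)%:E <= star x)%E.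
Proof. by move=> y0; apply: ereal_sup_ubound; exists y. Qed.

Lemma phi_star_le x z :
  (forall y, 0 < y -> ((x * y - phi y)%:E <= z)%E) ->
  (star x <= z)%E.
Proof. by move=> h; apply: ge_ereal_sup => _ [y y0 <-]; exact: h. Qed.

(** The supremum runs over [y > 0], so [y = 0] is approached: convexity and [phi 0 = 0] give
    [phi y <= y * phi 1], which is at most [e] for small [y]. *)
Lemma phi_star_ge0 x : 0 <= x -> (0 <= star x)%E.
Proof.
move=> x0; apply/lee_addgt0Pr => e e0.
pose M := phi 1 + 1.
have p1 : 0 <= phi 1 by apply: (compat_ge0 cphi).
have M0 : 0 < M by rewrite /M; lra.
pose y := Num.min 1 (e / M).
have y0 : 0 < y by rewrite lt_min ltr01 divr_gt0.
have y1 : y <= 1 by rewrite ge_min lexx.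
have yM : y * M <= e by rewrite -ler_pdivlMr// ge_min lexx orbT.
have : phi y <= y * phi 1.
  have y01 : 0 <= y <= 1 by rewrite (ltW y0).
  have := compat_convex cphi (Itv01 (ltW y0) y1) (x := 1) (y := 0).
  rewrite !inE /= !in_itv/= !andbT => /(_ ler01 (lexx _)).
  rewrite !convRE /= (compat_phi0 cphi) mulr0 addr0.
  set c := conv _ _ _; suff -> : c = y by [].
  by apply: etrans (convRE (1 : R^o) 0 (Itv01 (ltW y0) y1)) _; rewrite /= mulr1 mulr0 addr0.
move=> py; rewrite addeC -leeBlDl// sub0e.
apply: le_trans (phi_star_ge x y0).
rewrite -EFinN lee_fin.
have : 0 <= x * y by rewrite mulr_ge0// ltW.
have : 0 <= y by exact: ltW.
by move: yM; rewrite /M mulrDr mulr1; lra.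
Qed.

Lemma phi_star_homo x y : x <= y -> (star x <= star y)%E.
Proof.
move=> xy; apply: phi_star_le => t t0.
apply: le_trans (phi_star_ge y t0).
by rewrite lee_fin lerB// ler_pM2r.
Qed.

Lemma phi_star_fin x : 0 <= x -> star x \is a fin_num.
Proof.
move=> x0; rewrite ge0_fin_numE ?phi_star_ge0//.
have h : x <= (Num.truncn x).+1%:R by exact/ltW/truncnS_gt.
apply: (le_lt_trans (phi_star_homo h)).
by rewrite -ge0_fin_numE ?phi_star_ge0//; exact: (compat_star_fin cphi).
Qed.

Lemma fine_phi_star_ge x y : 0 <= x -> 0 < y -> x * y - phi y <= s x.
Proof. by move=> x0 y0; rewrite -lee_fin fineK ?phi_star_fin// phi_star_ge. Qed.

Lemma fine_phi_star_le x z : 0 <= x ->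
  (forall y, 0 < y -> x * y - phi y <= z) -> s x <= z.
Proof.
move=> x0 h; rewrite -lee_fin fineK ?phi_star_fin//.
by apply: phi_star_le => y y0; rewrite lee_fin h.
Qed.

Lemma fine_phi_star_ge0 x : 0 <= x -> 0 <= s x.
Proof. by move=> x0; rewrite fine_ge0// phi_star_ge0. Qed.

Lemma fine_phi_star_homo x y : 0 <= x -> x <= y -> s x <= s y.
Proof.
by move=> x0 xy; rewrite fine_le ?phi_star_fin ?phi_star_homo ?(le_trans x0).
Qed.

(** A supremum of affine functions is convex, so its slope on [[x, y]] is controlled by its values
    up to [y + 1]. A locally bounded constant is enough for the continuity of [psi]. *)
Lemma fine_phi_star_increment x y : 0 <= x -> x <= y ->
  s y - s x <= (y - x) * s (y + 1).
Proof.
move=> x0 xy; have y0 := le_trans x0 xy.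
have y10 : 0 <= y + 1 by lra.
rewrite lerBlDr; apply: fine_phi_star_le => // t t0.
have h1 := fine_phi_star_ge x0 t0.
have h2 := fine_phi_star_ge y10 t0.
have h3 := fine_phi_star_ge0 x0.
have h4 := fine_phi_star_ge0 y10.
(* [y] is the convex combination of [x] and [y + 1] with weight [l] *)
pose l := (y - x) / (y + 1 - x).
have d0 : 0 < y + 1 - x by lra.
have l0 : 0 <= l by rewrite divr_ge0//; lra.
have ly : l <= y - x by rewrite ler_pdivrMr//; nra.
have l1 : l <= 1 by rewrite ler_pdivrMr//; lra.
have lE : l * (y + 1 - x) = y - x by rewrite divfK// gt_eqF.
have -> : y * t - phi t = (1 - l) * (x * t - phi t) + l * ((y + 1) * t - phi t).
  by have := congr1 ( *%R t) lE; lra.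
have : (1 - l) * (x * t - phi t) <= (1 - l) * s x by rewrite ler_wpM2l//; lra.
have : l * ((y + 1) * t - phi t) <= l * s (y + 1) by rewrite ler_wpM2l.
have : l * s (y + 1) <= (y - x) * s (y + 1) by rewrite ler_wpM2r.
have : 0 <= l * s x by rewrite mulr_ge0.
lra.
Qed.

Lemma fine_psi_increment x y m : 0 <= x -> x <= y -> y <= m ->
  0 <= s y * y - s x * x <= (y - x) * (s m + m * s (m + 1)).
Proof.
move=> x0 xy ym; have y0 := le_trans x0 xy; have m0 := le_trans y0 ym.
have h1 := fine_phi_star_increment x0 xy.
have h2 := fine_phi_star_homo x0 xy.
have h3 := fine_phi_star_homo y0 ym.
have h4 : s (y + 1) <= s (m + 1) by apply: fine_phi_star_homo; lra.
have h5 := fine_phi_star_ge0 x0.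
have h6 : 0 <= s (y + 1) by apply: fine_phi_star_ge0; lra.
apply/andP; split; first by rewrite subr_ge0 ler_pM.
have -> : s y * y - s x * x = s y * (y - x) + (s y - s x) * x by ring.
rewrite [leRHS]mulrDr; apply: lerD; first by rewrite mulrC ler_wpM2l// subr_ge0.
apply: (@le_trans _ _ ((y - x) * s (y + 1) * x)); first by rewrite ler_wpM2r.
rewrite -mulrA ler_wpM2l ?subr_ge0// mulrC ler_pM//.
exact: le_trans ym.
Qed.

(** The function is extended by the constant 0 to negative arguments, where finiteness of the
    conjugate has not been established; it is then continuous on the whole line and the intermediate
    value theorem applies. *)
Lemma psi_continuous :
  continuous (fun x : R => s (Num.max x 0) * Num.max x 0).
Proof.
move=> x; apply/cvgrPdist_le => e e0.
pose m := `|x| + 1; pose K := s m + m * s (m + 1).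
have m0 : 0 <= m by rewrite /m; have := normr_ge0 x; lra.
have K0 : 0 <= K.
  by rewrite addr_ge0 ?mulr_ge0 ?fine_phi_star_ge0//; lra.
have eK0 : 0 < Num.min 1 (e / (K + 1)) by rewrite lt_min ltr01 divr_gt0//; lra.
apply/nbhs_ballP; exists (Num.min 1 (e / (K + 1))) => //= t.
rewrite /ball/= lt_min => /andP[xt1]; rewrite ltr_pdivlMr; last lra.
move=> xtK; set u := Num.max x 0; set v := Num.max t 0.
have u0 : 0 <= u by rewrite le_max lexx orbT.
have v0 : 0 <= v by rewrite le_max lexx orbT.
have um : u <= m.
  by rewrite ge_max m0 andbT /m; have := ler_norm x; lra.
have vm : v <= m.
  rewrite ge_max m0 andbT /m; move: xt1; rewrite ltr_norml => /andP[h _].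
  by have := ler_norm x; lra.
have uv : `|u - v| <= `|x - t|.
  rewrite /u /v; have := ler_norm (x - t); have := lerNnormlW (lexx `|x - t|).
  rewrite ler_norml; case: (leP x 0); case: (leP t 0) => h1 h2 h3 h4;
    by have := normr_ge0 (x - t); lra.
apply: (@le_trans _ _ (`|u - v| * K)); last first.
  by apply: le_trans (ltW xtK); rewrite ler_pM//; lra.
have [vu|uv'] := leP v u.
  by have /andP[h1 h2] := fine_psi_increment v0 vu um; rewrite !ger0_norm// subr_ge0.
have /andP[h1 h2] := fine_psi_increment u0 (ltW uv') vm.
by rewrite distrC [`|u - v|]distrC !ger0_norm// subr_ge0 ltW.
Qed.

Lemma psi_invP z : 0 < z ->
  0 <= psi_inv phi z /\ s (psi_inv phi z) * psi_inv phi z = z.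
Proof.
move=> z0.
suff [x [x0 xz]] : exists x, 0 <= x /\ psi phi x = z%:E.
  rewrite /psi_inv; case: xgetP => [y -> [y0]|/(_ x)]; last by case.
  by rewrite /psi -(fineK (phi_star_fin y0)) -EFinM => -[].
pose f := fun x : R => s (Num.max x 0) * Num.max x 0.
have p1 : 0 <= phi 1 by apply: (compat_ge0 cphi).
(* Testing the conjugate at [y = 1] gives [s M >= M - phi 1 = z + 1]; as [M >= 1], [psi] exceeds [z]
   at [M]. *)
pose M := phi 1 + z + 1.
have M0 : 0 <= M by rewrite /M; lra.
have fE x : 0 <= x -> f x = s x * x by move=> x0; rewrite /f max_l.
have fM : z <= f M.
  rewrite fE// -[leLHS]mulr1 ler_pM//; [lra| |rewrite /M; lra].
  by have := fine_phi_star_ge M0 ltr01; rewrite /M; lra.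
have f0 : f 0 = 0 by rewrite fE ?mulr0.
have [|x + fx] := @IVT R f 0 M z M0 (continuous_subspaceT psi_continuous).
  by rewrite f0 min_l ?max_r ?(ltW z0)//= (le_trans (ltW z0)).
rewrite in_itv/= => /andP[x0 xM]; exists x; split => //.
by rewrite /psi -(fineK (phi_star_fin x0)) -EFinM -fx fE.
Qed.

Hypothesis beta_ge0 : forall k, 0 <= beta k.
Hypothesis beta_nincr : forall k l, (k <= l)%N -> beta l <= beta k.

(** Otherwise the convergent series in [compat_sum] would dominate the telescoping sums
    [(s n - s 0) * u], which are unbounded because [s n >= n - phi 1]. This makes the set in
    [beta_inv] nonempty, so that its infimum is not a default value. *)
Lemma beta_to0 u : 0 < u -> exists k, beta k <= u.
Proof.
move=> u0; apply/not_existsP => /= H.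
have b k : u < beta k by rewrite ltNge; apply/negP/H.
have sum := compat_sum cphi.
set S := (X in (X < _)%E) in sum.
have S0 n : (((s n%:R - s 0%:R) * u)%:E <= S)%E.
  have t0 k : (0 <= (star k.+1%:R - star k%:R) * (beta k)%:E)%E.
    rewrite -(fineK (phi_star_fin (ler0n _ k))) -(fineK (phi_star_fin (ler0n _ k.+1))).
    rewrite -EFinB -EFinM lee_fin mulr_ge0// subr_ge0.
    by rewrite fine_phi_star_homo// ler_nat.
  apply: le_trans (nneseries_lim_ge n _) => //.
  elim: n => [|n IHn]; first by rewrite big_geq// subrr mul0r.
  rewrite big_nat_recr//=; apply: le_trans (leeD IHn (lexx _)).
  rewrite -(fineK (phi_star_fin (ler0n _ n))) -(fineK (phi_star_fin (ler0n _ n.+1))) /=.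
  rewrite -EFinB -EFinM -EFinD lee_fin.
  have : (s n.+1%:R - s n%:R) * u <= (s n.+1%:R - s n%:R) * beta n.
    rewrite ler_wpM2l ?(ltW (b n))// subr_ge0.
    by rewrite fine_phi_star_homo// ler_nat.
  lra.
have S00 : (0 <= S)%E by apply: le_trans (S0 0); rewrite subrr mul0r.
move: S00 sum S0; case: S => [S| |]// _ _ S0.
pose n := (Num.truncn (phi 1 + s 0%:R + `|S / u|)).+1.
have := S0 n; rewrite lee_fin -ler_pdivlMr//.
have := @fine_phi_star_ge n%:R 1 (ler0n _ _) ltr01.
have : phi 1 + s 0%:R + `|S / u| < n%:R by exact: truncnS_gt.
by have := ler_norm (S / u); lra.
Qed.

Lemma beta_inv_ge k u : (0 < k)%N -> 0 < u -> u < 1 -> u < beta k ->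
  k%:R <= beta_inv beta u.
Proof.
move=> k0 u0 u1 uk; apply: lb_le_inf.
  have [l bl] := beta_to0 u0; exists l.+1%:R => /=; split; first exact: ler0n.
  rewrite /Defs.beta_fun. rewrite ltNge ler1n/= natrK.
  exact: le_trans (beta_nincr (leqnSn l)) bl.
move=> t [t0]; rewrite /Defs.beta_fun; case: ltP => t1; first by rewrite leNgt u1.
move=> bt; rewrite leNgt; apply/negP => tk.
have : beta k <= beta (Num.truncn t).
  by apply: beta_nincr; apply/ltnW; rewrite truncn_lt_nat.
by rewrite leNgt (le_lt_trans bt).
Qed.

(** Chebyshev's inequality for the integral in [C_beta]: on the interval from 0 to [beta k] one has
    [beta_inv beta u >= k], so the integrand is at least [s k] there. *)
Lemma phi_star_beta Cb k : C_beta beta phi = Cb%:E -> (0 < k)%N -> beta k <= 1 ->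
  s k%:R * beta k <= Cb ^+ 2.
Proof.
move=> hC k0 b1; have := beta_ge0 k; rewrite le_eqVlt => /orP[/eqP <-|bk0].
  by rewrite mulr0 sqr_ge0.
have inv_ge0 u : 0 <= beta_inv beta u.
  rewrite /beta_inv; have [->|/set0P S0] := eqVneq [set t | 0 <= t /\ Defs.beta_fun beta t <= u] set0.
    by rewrite inf0.
  by apply: lb_le_inf => // t [].
set I := (\int[lebesgue_measure]_(u in `]0%R, 1%R[) phi_star phi (beta_inv beta u))%E.
have I0 : (0 <= I)%E by apply: integral_ge0 => u _; exact: phi_star_ge0.
have C0 : 0 <= Cb by rewrite -lee_fin -hC poweR_ge0.
have IC : (1 + I = (Cb ^+ 2)%:E)%E.
  have := congr1 (fun z => z `^ 2)%E hC; rewrite -poweRrM mulVf// poweRe1; last exact: adde_ge0.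
  by rewrite poweR_EFin powR_mulrn.
have : ((s k%:R * beta k)%:E <= I)%E.
  have -> : (s k%:R * beta k)%:E =
      (\int[lebesgue_measure]_(u in `]0%R, (beta k)[) (cst (s k%:R)%:E u))%E.
    rewrite integral_cst//= lebesgue_measure_itv/= lte_fin bk0 oppr0 adde0.
    by rewrite EFinM.
  apply: ge0_le_integral_sub.
  - by move=> u /=; rewrite !in_itv/= => /andP[-> /lt_le_trans ->].
  - by move=> u _; exact: (fine_phi_star_ge0 (ler0n _ k)).
  - by move=> u _; exact: phi_star_ge0.
  - move=> u /=; rewrite in_itv/= => /andP[u0 uk].
    rewrite fineK ?phi_star_fin//; apply: phi_star_homo.
    by apply: beta_inv_ge => //; exact: lt_le_trans b1.
move=> h; rewrite -lee_fin -IC; apply: (le_trans h).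
by rewrite leeDr.
Qed.

(* [psi q >= 1 / x] reads [1 / phi_star q <= q x], whence the bound on [beta q]. *)
Lemma Lambda_mixP Cb x : C_beta beta phi = Cb%:E -> (forall k, beta k <= 1) ->
  0 < x -> exists q : nat, [/\ (0 < q)%N, Lambda_mix phi x = q%:R * x &
    beta q <= Cb ^+ 2 * (q%:R * x)].
Proof.
move=> hC b1 x0.
have xV0 : 0 < x^-1 by rewrite invr_gt0.
have [] := psi_invP xV0; set y := psi_inv phi x^-1 => y0 yx.
have {}y0 : 0 < y.
  rewrite lt_neqAle y0 andbT; apply/eqP => y00; move: xV0.
  by rewrite -yx -y00 mulr0 ltxx.
pose q := `|Num.ceil y|%N.
have qE : (Num.ceil y)%:~R = q%:R :> R.
  by rewrite /q natr_absz ger0_norm// ltW// ceil_gt0.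
have q0 : (0 < q)%N by rewrite /q absz_gt0 gt_eqF// ceil_gt0.
have yq : y <= q%:R by rewrite -qE ceil_ge.
exists q; split => //; first by rewrite /Lambda_mix gt_eqF// qE.
have sq : x^-1 <= s q%:R * q%:R.
  by rewrite -yx ler_pM ?(ltW y0) ?fine_phi_star_ge0 ?fine_phi_star_homo ?(ltW y0).
have xq : 1 <= s q%:R * (q%:R * x).
  by rewrite mulrA -ler_pdivrMr// div1r.
have := phi_star_beta hC q0 (b1 q).
have qx0 : 0 <= q%:R * x by rewrite mulr_ge0// ltW.
move=> /(ler_wpM2r qx0); apply: le_trans.
by rewrite mulrAC ler_peMl.
Qed.

End conjugate.

(** * Mixing coefficients and finite-valued processes *)

Section finite_valued.
Context {R : realType} {dT : measure_display} {T : measurableType dT}.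
Variable P : probability T R.
Local Notation p A := (fine (P A)).

Lemma fine_prob_ge0 A : 0 <= p A.
Proof. by rewrite fine_ge0. Qed.

Lemma prob_total (I : finType) (A : I -> set T) (B : set T) :
  \bigcup_i A i = setT -> trivIset setT A -> (forall i, measurable (A i)) ->
  measurable B -> \sum_i p (B `&` A i) = p B.
Proof.
move=> cA tA mA mB.
have mBA i : measurable (B `&` A i) by exact: measurableI.
apply: EFin_inj; rewrite -sumEFin.
under eq_bigr do rewrite fineK ?fin_num_measure//.
rewrite fineK ?fin_num_measure//.
rewrite -{2}[B]setIT -cA setI_bigcupr measure_fin_bigcup//=; last first.
  exact: trivIset_setIl.
rewrite -big_enum fsbig_seq ?enum_uniq//; apply: eq_fsbigl.
by apply/seteqP; split => i //= _; rewrite mem_enum.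
Qed.

(** Measurability for the discrete sigma-algebra on [I], phrased through fibers. It can be
    instantiated at [T] equipped with a sub-sigma-field, which is how events of the past and of the
    future are recognized. *)
Definition finite_valued (I : finType) (U : T -> I) :=
  forall i, measurable (U @^-1` [set i]).

Lemma bigcup_fibers (I : finType) (U : T -> I) : \bigcup_i (U @^-1` [set i]) = setT.
Proof. by apply/seteqP; split => // w _; exists (U w). Qed.

Lemma trivIset_fibers (I : finType) (U : T -> I) : trivIset setT (fun i => U @^-1` [set i]).
Proof. by apply/trivIsetP => i j _ _ ij; apply/seteqP; split => // w [/= -> /eqP]; rewrite (negbTE ij). Qed.

Lemma prob_fibers (I : finType) (U : T -> I) (B : set T) :
  finite_valued U -> measurable B -> \sum_i p (B `&` U @^-1` [set i]) = p B.
Proof.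
by move=> mU mB; apply: prob_total => //; [exact: bigcup_fibers|exact: trivIset_fibers].
Qed.

Lemma prob_fibers1 (I : finType) (U : T -> I) :
  finite_valued U -> \sum_i p (U @^-1` [set i]) = 1.
Proof.
move=> mU; have := prob_fibers mU measurableT; under eq_bigr do rewrite setTI.
by rewrite probability_setT.
Qed.

Lemma finite_valued_preimage (I : finType) (U : T -> I) (B : set I) :
  finite_valued U -> measurable (U @^-1` B).
Proof.
move=> mU; have -> : U @^-1` B = \bigcup_(i in B) (U @^-1` [set i]).
  by apply/seteqP; split => w /= => [Bw|[i Bi ->]//]; exists (U w).
exact: fin_bigcup_measurable.
Qed.

Lemma finite_valued_pair (I J : finType) (U : T -> I) (V : T -> J) :
  finite_valued U -> finite_valued V -> finite_valued (fun w => (U w, V w)).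
Proof.
move=> mU mV [i j].
have -> : (fun w => (U w, V w)) @^-1` [set (i, j)] =
    U @^-1` [set i] `&` V @^-1` [set j].
  by apply/seteqP; split => w /= => [/pair_equal_spec[-> ->]|[-> ->]].
exact: measurableI.
Qed.

Lemma finite_valued_ffun (K J : finType) (V : K -> T -> J) :
  (forall k, finite_valued (V k)) -> finite_valued (fun w => [ffun k => V k w]).
Proof.
move=> mV g.
have -> : (fun w => [ffun k => V k w]) @^-1` [set g] =
    \bigcap_(k in setT) (V k @^-1` [set g k]).
  apply/seteqP; split => w /= => [<- k _ /=|h]; first by rewrite ffunE.
  by apply/ffunP => k; rewrite ffunE; exact: h.
by apply: fin_bigcap_measurable => // k _; exact: mV.
Qed.

Lemma measurable_finite_valued (I : finType) (U : T -> I) (F : I -> R) :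
  finite_valued U -> measurable_fun setT (F \o U).
Proof. by move=> mU _ B mB; rewrite setTI; exact: (finite_valued_preimage (F @^-1` B)). Qed.

Lemma integral_finite_valued (I : finType) (U : T -> I) (F : I -> R) :
  finite_valued U -> (forall i, 0 <= F i) ->
  (\int[P]_w (F (U w))%:E = (\sum_i F i * p (U @^-1` [set i]))%:E)%E.
Proof.
move=> mU F0.
have E w : (F (U w))%:E = (\sum_i (F i * \1_(U @^-1` [set i]) w)%:E)%E.
  rewrite sumEFin (bigD1 (U w))//= big1 ?addr0 => [|i iU].
    by rewrite indicE mem_set// mulr1.
  by rewrite indicE memNset ?mulr0//= => /esym/eqP; rewrite (negbTE iU).
under eq_integral do rewrite E.
rewrite ge0_integral_sum//=; last 2 first.
- by move=> i; apply/measurable_EFinP/measurable_funM => //; exact: measurable_indic.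
- by move=> i w _; rewrite lee_fin mulr_ge0.
rewrite -sumEFin; apply: eq_bigr => i _.
under eq_integral do rewrite EFinM.
rewrite ge0_integralZl//=; last 2 first.
- by apply/measurable_EFinP; exact: measurable_indic.
- by rewrite lee_fin.
by rewrite integral_indic// setIT EFinM fineK// fin_num_measure.
Qed.

(** Each absolute difference is at most the sum of its two terms, and either family of terms sums to
    1. Boundedness is what makes the real [sup] in [beta_mix] a genuine supremum. *)
Lemma beta_mix_has_ubound (U V : set (set T)) :
  U `<=` measurable -> V `<=` measurable ->
  ubound [set z | exists (p q : nat) (A : 'I_p -> set T) (B : 'I_q -> set T),
    [/\ (forall i, U (A i)) /\ partition setT A setT,
        (forall j, V (B j)) /\ partition setT B setT &
        z = \sum_(i < p) \sum_(j < q)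
              `|fine (P (A i `&` B j)) - fine (P (A i)) * fine (P (B j))|]] 2.
Proof.
move=> mU mV z [m [q [A [B [[UA [cA tA _]] [VB [cB tB _]] ->]]]]].
have mA i : measurable (A i) by exact/mU.
have mB i : measurable (B i) by exact/mV.
have sA : \sum_i p (A i) = 1.
  have := prob_total cA tA mA measurableT; under eq_bigr do rewrite setTI.
  by rewrite probability_setT.
have sB : \sum_i p (B i) = 1.
  have := prob_total cB tB mB measurableT; under eq_bigr do rewrite setTI.
  by rewrite probability_setT.
have -> : 2 = \sum_(i < m) \sum_(j < q) (p (A i `&` B j) + p (A i) * p (B j)) :> R.
  under eq_bigr do rewrite big_split/= -mulr_sumr sB mulr1 prob_total//.
  by rewrite big_split/= sA; ring.
apply: ler_sum => i _; apply: ler_sum => j _.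
apply: (le_trans (ler_normB _ _)).
by rewrite !ger0_norm ?mulr_ge0 ?fine_prob_ge0.
Qed.

Let trivial_partition : partition setT (fun _ : 'I_1 => [set: T]) setT.
Proof.
have [w _] : [set: T] !=set0.
  apply/set0P/eqP => T0; have := probability_setT P; rewrite T0 measure0 => /eqP.
  by rewrite eqe eq_sym oner_eq0.
split; last by move=> *; exists w.
- by apply/seteqP; split => // x _; exists ord0.
- by apply/trivIsetP => i j _ _; rewrite !ord1 eqxx.
Qed.

Lemma beta_mix_le1 (U V : set (set T)) : U setT -> V setT ->
  U `<=` measurable -> V `<=` measurable -> 0 <= beta_mix P U V <= 1.
Proof.
move=> UT VT mU mV; have ub := beta_mix_has_ubound mU mV.
rewrite /beta_mix; set S := (X in sup X).
have S0 : S (\sum_(i < 1) \sum_(j < 1) `|p (setT `&` setT) - p setT * p setT|).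
  by exists 1%N, 1%N, (fun=> setT), (fun=> setT); split.
apply/andP; split.
  rewrite mulr_ge0//; apply: le_trans (ub_le_sup _ S0); last by exists 2.
  by apply: sumr_ge0 => i _; apply: sumr_ge0.
by rewrite ler_pdivrMl// mulr1; apply: ge_sup => //; eexists; exact: S0.
Qed.

Lemma beta_mix_subr (U V V' : set (set T)) : U setT -> V setT -> V' setT ->
  U `<=` measurable -> V `<=` measurable -> V' `<=` V ->
  beta_mix P U V' <= beta_mix P U V.
Proof.
move=> UT VT V'T mU mV V'V; rewrite /beta_mix ler_wpM2l ?invr_ge0//.
apply: ge_sup.
  by eexists; exists 1%N, 1%N, (fun=> setT), (fun=> setT); split.
move=> z [m [q [A [B [hA [V'B hB] ->]]]]].
apply: ub_le_sup; first by exists 2; exact: beta_mix_has_ubound.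
by exists m, q, A, B; split => //; split => // j; exact: V'V.
Qed.

(* Empty cells carry no mass; they are discarded because the partitions in
   [beta_mix] have nonempty cells. *)
Lemma beta_mix_finite_valued (UU VV : set (set T)) (I J : finType)
    (U : T -> I) (V : T -> J) :
  UU `<=` measurable -> VV `<=` measurable ->
  (forall i, UU (U @^-1` [set i])) -> (forall j, VV (V @^-1` [set j])) ->
  \sum_i \sum_j `|p (U @^-1` [set i] `&` V @^-1` [set j])
     - p (U @^-1` [set i]) * p (V @^-1` [set j])| <= 2 * beta_mix P UU VV.
Proof.
move=> mUU mVV hU hV; rewrite /beta_mix mulrA divff// mul1r.
pose ne (K : finType) (W : T -> K) := [seq i <- enum K | `[< W @^-1` [set i] !=set0 >]].
have cell (K : finType) (W : T -> K) :
    partition setT (fun k : 'I_(size (ne K W)) => W @^-1` [set tnth (in_tuple (ne K W)) k]) setT.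
  split.
  - apply/seteqP; split => // w _.
    have : W w \in ne K W by rewrite mem_filter mem_enum andbT; apply/asboolP; exists w.
    by move=> /(tnthP (in_tuple _))[k Wk]; exists k.
  - apply/trivIsetP => i j _ _ ij; apply/seteqP; split => // w [/= -> /eqP].
    by rewrite (inj_eq (tuple_uniqP _ _)) ?(negbTE ij)// filter_uniq// enum_uniq.
  - move=> k _; have := mem_tnth k (in_tuple (ne K W)).
    by rewrite mem_filter => /andP[/asboolP].
have sumne (K : finType) (W : T -> K) (F : K -> R) :
    (forall i, W @^-1` [set i] = set0 -> F i = 0) ->
    \sum_i F i = \sum_(k < size (ne K W)) F (tnth (in_tuple (ne K W)) k).
  move=> F0; rewrite -(big_tnth _ _ (ne K W) xpredT F) big_filter big_enum_cond/=.
  rewrite [RHS]big_mkcond; apply: eq_bigr => i _; case: ifPn => // /asboolPn h.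
  by apply: F0; apply/eqP; apply/negPn/negP => /set0P.
apply: ub_le_sup; first by exists 2; exact: beta_mix_has_ubound.
exists (size (ne I U)), (size (ne J V)),
  (fun k => U @^-1` [set tnth (in_tuple (ne I U)) k]),
  (fun k => V @^-1` [set tnth (in_tuple (ne J V)) k]).
split => //; rewrite (sumne _ U); last first.
  by move=> i ->; apply: big1 => j _; rewrite set0I measure0 mul0r subr0 normr0.
apply: eq_bigr => i _; apply: (sumne _ V) => j ->.
by rewrite setI0 measure0 mulr0 subr0 normr0.
Qed.

End finite_valued.

(** * Decoupling by exponential weights *)

Section decoupling.
Context {R : realType} {dT : measure_display} {T : measurableType dT}.
Variable P : probability T R.
Local Notation p A := (fine (P A)).

(** The joint law of [U] and [V] is exchanged for the product law. Under the product the mean of [D]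
    is nonpositive for every value of [U], and [|D| <= 1] turns the exchange into a total variation
    distance. *)
Lemma integral_decoupled (I J : finType) (U : T -> I) (V : T -> J) (D : I -> J -> R) :
  finite_valued U -> finite_valued V -> (forall i j, `|D i j| <= 1) ->
  (forall i, \sum_j D i j * p (V @^-1` [set j]) <= 0) ->
  (\int[P]_w (1 + D (U w) (V w))%:E <=
   (1 + \sum_i \sum_j `|p (U @^-1` [set i] `&` V @^-1` [set j])
      - p (U @^-1` [set i]) * p (V @^-1` [set j])|)%:E)%E.
Proof.
move=> mU mV D1 D0.
have mUi i : measurable (U @^-1` [set i]) by exact: mU.
have sub i : p (U @^-1` [set i]) = \sum_j p (U @^-1` [set i] `&` V @^-1` [set j]).
  by rewrite (prob_fibers _ mV).
rewrite (integral_finite_valued P (F := fun ij : I * J => 1 + D ij.1 ij.2)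
  (finite_valued_pair mU mV)); last first.
  by move=> [i j] /=; have := D1 i j; rewrite ler_norml => /andP[]; lra.
have -> : \sum_ij (1 + D ij.1 ij.2) * p ((fun w => (U w, V w)) @^-1` [set ij]) =
    \sum_i \sum_j (1 + D i j) * p (U @^-1` [set i] `&` V @^-1` [set j]).
  rewrite pair_bigA/=; apply: eq_bigr => -[i j] _ /=; congr (_ * p _).
  by apply/seteqP; split => w /= => [/pair_equal_spec[-> ->]|[-> ->]].
rewrite lee_fin.
rewrite -{2}(prob_fibers1 P mU) -big_split/=; apply: ler_sum => i _.
pose q j := p (U @^-1` [set i] `&` V @^-1` [set j]).
pose m j := p (U @^-1` [set i]) * p (V @^-1` [set j]).
have -> : \sum_j (1 + D i j) * q j =
    p (U @^-1` [set i]) + (\sum_j D i j * (q j - m j) + \sum_j D i j * m j).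
  rewrite sub -!big_split/=; apply: eq_bigr => j _; rewrite /q; ring.
rewrite lerD2l -[leRHS]addr0 lerD//.
  apply: ler_sum => j _; rewrite (le_trans (ler_norm _))// normrM.
  by rewrite ler_piMl.
rewrite (_ : \sum_j _ = p (U @^-1` [set i]) * \sum_j D i j * p (V @^-1` [set j])).
  by rewrite mulr_ge0_le0// fine_prob_ge0.
by rewrite mulr_sumr; apply: eq_bigr => j _; rewrite /m mulrCA.
Qed.

Variables (J K : finType) (Y : nat -> T -> J) (M L : nat).
Variables (alpha : K -> J -> R) (law : J -> R) (a lam b : R).
Hypothesis mY : forall i, finite_valued (Y i).
Hypothesis L0 : (0 < L)%N.
Hypothesis alpha_ge0 : forall k y, 0 <= alpha k y.
Hypothesis alpha_le : forall k y, lam * alpha k y <= a.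
Hypothesis a_ge0 : 0 <= a.
Hypothesis a_le : a <= 2^-1.
Hypothesis lam0 : 0 < lam.
Hypothesis M0 : (0 < M)%N.
Hypothesis lawY : forall i y, (i < M)%N -> p (Y i @^-1` [set y]) = law y.

(** The values at times up to [i - L]. For [i < L] the truncated subtraction leaves an empty
    history. *)
Definition history (i : nat) (w : T) : {ffun 'I_(i.+1 - L) -> J} :=
  [ffun j : 'I_(i.+1 - L) => Y j w].

Hypothesis history_mixing : forall i, (i < M)%N ->
  \sum_h \sum_y `|p (history i @^-1` [set h] `&` Y i @^-1` [set y])
     - p (history i @^-1` [set h]) * p (Y i @^-1` [set y])| <= b.

Definition law_mean k := \sum_y law y * alpha k y.

Definition deviation k y := (1 - a) * law_mean k - alpha k y.

Let law_ge0 y : 0 <= law y.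
Proof. by rewrite -(lawY y M0) fine_prob_ge0. Qed.

Let law1 : \sum_y law y = 1.
Proof. by under eq_bigr do rewrite -(lawY _ M0); exact: prob_fibers1. Qed.

Let mean_ge0 k : 0 <= law_mean k.
Proof. by apply: sumr_ge0 => y _; rewrite mulr_ge0. Qed.

Let mean_le k : lam * law_mean k <= a.
Proof.
rewrite -[leRHS]mulr1 -law1 !mulr_sumr; apply: ler_sum => y _.
by rewrite mulrCA mulrC ler_wpM2r.
Qed.

(** The exponent is at most [a <= 1 / 2], and [expR (1 / 2) <= 2]; below, [expR] is nonnegative. *)
Let expR_deviation_le k y : `|expR (lam * deviation k y) - 1| <= 1.
Proof.
have h1 := alpha_le k y; have h2 := mean_le k; have h3 := alpha_ge0 k y.
have h4 := mean_ge0 k.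
have h5 : lam * deviation k y <= 2^-1.
  rewrite /deviation; apply: (@le_trans _ _ (lam * law_mean k)); last exact: le_trans a_le.
  by rewrite ler_pM2l//; have := mulr_ge0 a_ge0 h4; lra.
rewrite ler_norml; apply/andP; split.
  by rewrite lerBrDr addrC subrr expR_ge0.
suff : expR (lam * deviation k y) <= 2 by lra.
apply: (@le_trans _ _ (expR 2^-1)); first by rewrite ler_expR.
have := expR_ge1Dx (- 2^-1 : R); rewrite expRN => h.
rewrite -[leLHS]invrK invf_ple ?posrE ?invr_gt0 ?expR_gt0//.
by apply: le_trans h; lra.
Qed.

(* [exp (- t) <= 1 - t + t^2 <= 1 - (1 - a) t] for [0 <= t <= a] *)
Let mean_expR_deviation_le k : \sum_y (expR (lam * deviation k y) - 1) * law y <= 0.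
Proof.
under eq_bigr do rewrite mulrBl mul1r.
rewrite sumrB law1 subr_le0 -(@ler_pM2l _ (expR (- (lam * ((1 - a) * law_mean k))))) ?expR_gt0//.
rewrite mulr1 mulr_sumr.
apply: (@le_trans _ _ (1 - lam * ((1 - a) * law_mean k))); last first.
  by have := expR_ge1Dx (- (lam * ((1 - a) * law_mean k))); lra.
apply: (@le_trans _ _ (\sum_y (law y - lam * (1 - a) * (law y * alpha k y)))).
  apply: ler_sum => y _; rewrite [leLHS]mulrA -expRD /deviation.
  rewrite (_ : _ + _ = - (lam * alpha k y)); last ring.
  have h1 := alpha_le k y; have h3 := alpha_ge0 k y.
  have h2 : 0 <= lam * alpha k y by rewrite mulr_ge0// ltW.
  have hE := expRN_le_quadratic h2.
  have h4 : 0 <= (lam * alpha k y) * (a - lam * alpha k y) by rewrite mulr_ge0// subr_ge0.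
  rewrite (_ : law y - lam * (1 - a) * (law y * alpha k y) =
    (1 - (1 - a) * (lam * alpha k y)) * law y); last ring.
  by rewrite ler_wpM2r//; apply: le_trans hE _; lra.
by rewrite sumrB -mulr_sumr law1 mulrA.
Qed.

Definition weight s i k w : R :=
  expR (lam * \sum_(0 <= j < i | (j %% L == s)%N) deviation k (Y j w)).

(** The added [1] keeps the logarithm nonnegative, so that its integral can be handled without
    integrability, and is positive even for an empty [K]. *)
Definition total_weight s i w : R := 1 + \sum_k weight s i k w.

Let total_weight_ge1 s i w : 1 <= total_weight s i w.
Proof. by rewrite lerDl sumr_ge0// => k _; exact: expR_ge0. Qed.

Let total_weight_gt0 s i w : 0 < total_weight s i w.
Proof. exact: lt_le_trans (total_weight_ge1 s i w). Qed.

Let measurable_total_weight s i : measurable_fun setT (fun w => ln (total_weight s i w)).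
Proof.
apply: (@measurableT_comp _ _ _ _ _ _ (@ln R)) => //.
apply: measurable_funD => //; apply: measurable_sum => k.
apply: (@measurableT_comp _ _ _ _ _ _ (@expR R)) => //.
apply: measurable_funM => //; under eq_fun do rewrite -big_filter.
apply: measurable_sum => j.
exact: (measurable_finite_valued (deviation k) (mY j)).
Qed.

(** An earlier index in the residue class of [i] differs from [i] by a positive multiple of [L], so
    it is at most [i - L]: the weights before time [i] are functions of [history i]. *)
Let sum_history i w (F : J -> R) :
  \sum_(0 <= j < i | (j %% L == i %% L)%N) F (Y j w) =
  \sum_(j < i.+1 - L | (j %% L == i %% L)%N) F (history i w j).
Proof.
rewrite (@big_cat_nat _ _ _ (i.+1 - L))//=; last by lia.
rewrite [X in _ + X]big_nat_cond [X in _ + X]big1 ?addr0; last first.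
  move=> j /andP[/andP[ij ji] /eqP jL]; exfalso.
  have : (L %| i - j)%N by rewrite -eqn_mod_dvd ?(ltnW ji)// jL.
  by move=> /dvdn_leq; lia.
by rewrite big_mkord; apply: eq_bigr => j _; rewrite /history ffunE.
Qed.

(** The weights [W k h / Z h] have total mass at most 1, so [D] inherits the bound of
    [expR_deviation_le] for each single [k]. Hence the cost [b] depends neither on the size of the
    weights nor on the number of functions. *)
Let total_weight_step i : (i < M)%N ->
  (\int[P]_w (ln (total_weight (i %% L)%N i.+1 w))%:E <=
   \int[P]_w (ln (total_weight (i %% L)%N i w))%:E + b%:E)%E.
Proof.
move=> iM.
pose W k (h : {ffun 'I_(i.+1 - L) -> J}) : R := expR (lam *
  \sum_(j < i.+1 - L | (j %% L == i %% L)%N) deviation k (h j)).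
pose Z h := 1 + \sum_k W k h.
pose D h y := \sum_k W k h / Z h * (expR (lam * deviation k y) - 1).
have W0 k h : 0 <= W k h by exact: expR_ge0.
have Z0 h : 0 < Z h by apply: ltr_wpDr => //; exact: sumr_ge0.
have WE k w : weight (i %% L)%N i k w = W k (history i w).
  by rewrite /weight sum_history.
have ZE w : total_weight (i %% L)%N i w = Z (history i w).
  by rewrite /total_weight; under eq_bigr do rewrite WE.
have D1 h y : `|D h y| <= 1.
  apply: (le_trans (ler_norm_sum _ _ _)).
  apply: (@le_trans _ _ (\sum_k W k h / Z h)).
    apply: ler_sum => k _; rewrite normrM ger0_norm ?divr_ge0 ?(ltW (Z0 h))//.
    by rewrite ler_piMr ?divr_ge0 ?(ltW (Z0 h)).
  by rewrite -mulr_suml ler_pdivrMr// mul1r lerDr.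
have mH : finite_valued (history i) by exact: finite_valued_ffun.
have D0 h : \sum_y D h y * p (Y i @^-1` [set y]) <= 0.
  under eq_bigr do rewrite lawY// /D mulr_suml.
  rewrite exchange_big/=; apply: sumr_le0 => k _.
  under eq_bigr do rewrite -mulrA.
  by rewrite -mulr_sumr mulr_ge0_le0 ?divr_ge0 ?(ltW (Z0 h)).
(* [ln (1 + D) <= D], the increment of the logarithm *)
have step w : ln (total_weight (i %% L)%N i.+1 w) + 1 <=
    ln (total_weight (i %% L)%N i w) + (1 + D (history i w) (Y i w)).
  have E : total_weight (i %% L)%N i.+1 w =
      total_weight (i %% L)%N i w * (1 + D (history i w) (Y i w)).
    rewrite ZE mulrDr mulr1 /D mulr_sumr {1}/Z -addrA -big_split/=; congr (1 + _).
    apply: eq_bigr => k _; rewrite [LHS]/weight big_mkcond big_nat_recr//= -big_mkcond/= eqxx.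
    rewrite mulrDr expRD -/(weight _ _ _ _) WE mulrA mulrCA divff ?mulr1 ?lt0r_neq0//.
    by ring.
  have D0' : 0 < 1 + D (history i w) (Y i w).
    by rewrite -(pmulr_rgt0 _ (total_weight_gt0 (i %% L)%N i w)) -E.
  rewrite E lnM ?posrE// -addrA lerD2l.
  by rewrite addrC lerD2l; apply: le_ln1Dx; lra.
have m1 := measurable_total_weight.
have mD : measurable_fun setT (fun w => 1 + D (history i w) (Y i w)).
  exact: (measurable_finite_valued (fun hy => 1 + D hy.1 hy.2)
    (finite_valued_pair mH (mY i))).
have D0' w : 0 <= 1 + D (history i w) (Y i w).
  by have := D1 (history i w) (Y i w); rewrite ler_norml => /andP[]; lra.
have ln0 s j w : 0 <= ln (total_weight s j w) by rewrite ln_ge0.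
have := integral_decoupled mH (mY i) D1 D0.
move=> /le_trans /(_ (_ : _ <= (1 + b)%:E)%E).
rewrite lee_fin lerD2l => /(_ (history_mixing iM)) hD.
(* With 1 added to both sides, the signed increment [D] enters as [1 + D >= 0], and integrals of
   nonnegative functions suffice. *)
rewrite -(@leeD2rE _ 1%:E)//.
have -> : (\int[P]_w (ln (total_weight (i %% L)%N i.+1 w))%:E + 1%:E =
    \int[P]_w (ln (total_weight (i %% L)%N i.+1 w) + 1)%:E)%E.
  under [RHS]eq_integral do rewrite EFinD.
  rewrite ge0_integralD//.
  - by rewrite integral_cst//= probability_setT mule1.
  - by move=> w _; rewrite lee_fin.
  - exact/measurable_EFinP.
apply: (@le_trans _ _ (\int[P]_w (ln (total_weight (i %% L)%N i w) +
    (1 + D (history i w) (Y i w)))%:E)%E).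
  by apply: ge0_le_integralT => w; rewrite lee_fin// addr_ge0.
under eq_integral do rewrite EFinD.
rewrite ge0_integralD//; last 4 first.
- by move=> w _; rewrite lee_fin.
- exact/measurable_EFinP.
- by move=> w _; rewrite lee_fin.
- exact/measurable_EFinP.
by rewrite -[leRHS]addeA; apply: leeD2l; rewrite addeC.
Qed.

Let integral_total_weight s i : (i <= M)%N ->
  (\int[P]_w (ln (total_weight s i w))%:E <=
   (ln (1 + #|K|%:R) + \sum_(0 <= j < i | (j %% L == s)%N) b)%:E)%E.
Proof.
elim: i => [_|i IHi iM].
  rewrite big_geq// addr0 (_ : (fun w => _) = cst (ln (1 + #|K|%:R))%:E).
    by rewrite integral_cst//= probability_setT mule1.
  apply/funext => w; rewrite /total_weight; congr (ln (1 + _))%:E.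
  under eq_bigr do rewrite /weight big_geq// mulr0 expR0.
  by rewrite sumr_const.
rewrite big_mkcond big_nat_recr//= -big_mkcond/=.
case: ifPn => [/eqP sE|iLs].
  move: IHi; rewrite -sE => IHi.
  apply: (le_trans (total_weight_step iM)); rewrite addrA EFinD; apply: leeD2r.
  exact: IHi (ltnW iM).
rewrite addr0; apply: le_trans (IHi (ltnW iM)).
rewrite le_eqVlt; apply/orP; left; apply/eqP; apply: eq_integral => w _.
congr (ln (1 + _))%:E; apply: eq_bigr => k _.
by rewrite /weight big_mkcond big_nat_recr//= -big_mkcond/= (negbTE iLs) addr0.
Qed.

Let sum_residues (F : nat -> R) :
  \sum_(0 <= j < M) F j = \sum_(s < L) \sum_(0 <= j < M | (j %% L == s)%N) F j.
Proof.
rewrite (partition_big (fun j => Ordinal (ltn_pmod j L0)) xpredT)//=.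
Qed.

(** In every residue class the maximum over [k] lies below the logarithm of the total weight. The
    entropy [ln (1 + #|K|)] is therefore paid once per class, [L] times in all, and [b] once per
    time index. *)
Lemma uniform_lower_deviation : exists G : T -> R,
  [/\ measurable_fun setT G, forall w, 0 <= G w,
      forall w k, \sum_(0 <= j < M) deviation k (Y j w) <= G w &
      (\int[P]_w (G w)%:E <=
       (lam^-1 * (L%:R * ln (1 + #|K|%:R) + M%:R * b))%:E)%E].
Proof.
have ln0 s j w : 0 <= ln (total_weight s j w) by rewrite ln_ge0.
exists (fun w => lam^-1 * \sum_(s < L) ln (total_weight s M w)); split.
- by apply: measurable_funM => //; apply: measurable_sum => s.
- by move=> w; rewrite mulr_ge0 ?sumr_ge0// invr_ge0 ltW.
- move=> w k; rewrite ler_pdivlMl//.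
  have -> : \sum_(0 <= j < M) deviation k (Y j w) =
      \sum_(s < L) \sum_(0 <= j < M | (j %% L == s)%N) deviation k (Y j w).
    exact: sum_residues.
  rewrite mulr_sumr; apply: ler_sum => s _.
  rewrite -[leLHS]expRK ler_ln ?posrE ?expR_gt0//.
  rewrite -/(weight s M k w) /total_weight (bigD1 k)//= addrCA lerDl.
  by rewrite addr_ge0// sumr_ge0// => l _; exact: expR_ge0.
- under eq_integral do rewrite EFinM.
  rewrite ge0_integralZl//=; last 3 first.
  + by apply/measurable_EFinP; apply: measurable_sum => s.
  + by move=> w _; rewrite lee_fin sumr_ge0.
  + by rewrite lee_fin invr_ge0 ltW.
  rewrite EFinM lee_wpmul2l ?lee_fin ?invr_ge0 ?(ltW lam0)//.
  under eq_integral do rewrite -sumEFin.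
  rewrite ge0_integral_sum//=; last 2 first.
  + by move=> s; apply/measurable_EFinP.
  + by move=> s w _; rewrite lee_fin.
  apply: (@le_trans _ _ (\sum_(s < L) (ln (1 + #|K|%:R) +
      \sum_(0 <= j < M | (j %% L == s)%N) b)%:E)%E).
    by apply: lee_sum => s _; exact: integral_total_weight.
  rewrite sumEFin lee_fin big_split/= sumr_const card_ord -[X in X + _]mulr_natl lerD2l.
  by rewrite -sum_residues sumr_const_nat subn0 mulr_natl.
Qed.

End decoupling.

(** * Lagged processes *)

Section matrix_measurability.
Context {R : realType} {dT : measure_display} {T : measurableType dT}.

Lemma measurable_coord (m n : nat) (i : 'I_m) (j : 'I_n) :
  measurable_fun setT (fun A : 'M[R]_(m, n) => A i j).
Proof.
move=> _ B mB; rewrite setTI; apply: sub_sigma_algebra.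
by exists (i, j) => //; exists B => //; rewrite setTI.
Qed.

Lemma measurable_fun_mx (m n : nat) (f : T -> 'M[R]_(m, n)) :
  (forall i j, measurable_fun setT (fun w => f w i j)) -> measurable_fun setT f.
Proof.
move=> mf; apply: (measurability mx_coord_sets) => //.
move=> _ [_ [[i j] _ [B mB <-]] <-]; rewrite !setTI -comp_preimage.
by rewrite -[X in measurable X]setTI; exact: mf.
Qed.

Lemma measurable_coord_comp (m n : nat) (f : T -> 'M[R]_(m, n)) i j :
  measurable_fun setT f -> measurable_fun setT (fun w => f w i j).
Proof.
by move=> mf; apply: (measurableT_comp (measurable_coord i j)).
Qed.

Lemma measurable_lag_mx (r d : nat) (X : int -> T -> 'rV[R]_d) (i : int) :
  (forall k : 'I_r, measurable_fun setT (X (i - k%:Z))) ->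
  measurable_fun setT (fun w => \matrix_(k < r, j < d) X (i - k%:Z) w 0 j).
Proof.
move=> mX; apply: measurable_fun_mx => k j; under eq_fun do rewrite mxE.
exact: measurable_coord_comp.
Qed.

End matrix_measurability.

Section sub_sigma_fields.
Context {R : realType} {dT : measure_display} {T : measurableType dT}.
Variable P : probability T R.
Context {dE : measure_display} {E : measurableType dE}.
Variable Y : int -> {RV P >-> E}.

Definition generators (I : set int) : set (set T) :=
  \bigcup_(i in I) preimage_set_system setT (Y i) measurable.

Lemma sigma_field_measurable (I : set int) : sigma_field Y I `<=` measurable.
Proof.
apply: smallest_sub; first exact: sigma_algebra_measurable.
by move=> _ [i _ [B mB <-]]; exact: measurable_funPT.
Qed.

Lemma sigma_fieldT (I : set int) : sigma_field Y I setT.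
Proof. by rewrite -setC0; apply: sigma_algebraC; exact: sigma_algebra0. Qed.

Lemma sigma_field_sub (I I' : set int) : I `<=` I' ->
  sigma_field Y I `<=` sigma_field Y I'.
Proof.
move=> II'; apply: sub_sigma_algebra2 => A [i Ii YA].
by exists i => //; exact: II'.
Qed.

Lemma measurable_sigma_field (I : set int) (i : int) : I i ->
  measurable_fun setT (Y i : g_sigma_algebraType (generators I) -> E).
Proof.
move=> Ii _ B mB; apply: sub_sigma_algebra; exists i => //.
by exists B.
Qed.

Lemma beta_coef_ge0 k : 0 <= beta_coef Y k.
Proof.
by have /andP[] := beta_mix_le1 P (@sigma_fieldT [set i | i <= 0])
  (@sigma_fieldT [set i | k%:Z <= i]) (@sigma_field_measurable _)
  (@sigma_field_measurable _).
Qed.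

Lemma beta_coef_le1 k : beta_coef Y k <= 1.
Proof.
by have /andP[] := beta_mix_le1 P (@sigma_fieldT [set i | i <= 0])
  (@sigma_fieldT [set i | k%:Z <= i]) (@sigma_field_measurable _)
  (@sigma_field_measurable _).
Qed.

Lemma beta_coef_nincr k l : (k <= l)%N -> beta_coef Y l <= beta_coef Y k.
Proof.
move=> kl; apply: beta_mix_subr; try exact: sigma_fieldT; try exact: sigma_field_measurable.
apply: sigma_field_sub => i /=; apply: le_trans.
by rewrite lez_nat.
Qed.

End sub_sigma_fields.

Section lags.
Context {R : realType} {dT : measure_display} {T : measurableType dT}.
Variables (P : probability T R) (d r : nat) (X : int -> {RV P >-> 'rV[R]_d}).
Local Notation p A := (fine (P A)).
Local Notation lagr := (lag r X).

Lemma measurable_lag i : measurable_fun setT (lagr i).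
Proof.
have mX (k : 'I_r) : measurable_fun setT (X (i - k%:Z)) by exact: measurable_funPT.
exact: (@measurable_lag_mx _ _ _ r d (fun i => X i) i mX).
Qed.

Lemma measurable_lag_sigma_field (I : set int) i :
  (forall k : 'I_r, I (i - k%:Z)) ->
  measurable_fun setT (lagr i : g_sigma_algebraType (generators X I) -> 'M[R]_(r, d)).
Proof.
move=> hI; apply: (@measurable_lag_mx _ _ (g_sigma_algebraType (generators X I)) r d (fun i => X i) i) => k.
exact: measurable_sigma_field.
Qed.

Hypothesis statX : stationary X.

(** Stationarity is stated for tuples of observations; events about finitely many lag vectors are
    reduced to it by listing all times that enter them. *)
Lemma stationary_lag (K : finType) (t : K -> int) (h : int)
    (A : K -> set 'M[R]_(r, d)) : (forall k, measurable (A k)) ->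
  P [set w | forall k, A k (lagr (t k + h) w)] =
  P [set w | forall k, A k (lagr (t k) w)].
Proof.
move=> mA.
(* One entry for every pair of a vector and a row; repeated times are harmless. [asm] reassembles
   the vectors. *)
pose s := [tuple t (enum_val z).1 - (enum_val z).2%:Z | z < #|{: K * 'I_r}|].
pose asm (v : #|{: K * 'I_r}|.-tuple 'rV[R]_d) k : 'M[R]_(r, d) :=
  \matrix_(a < r, j < d) tnth v (enum_rank (k, a)) 0 j.
pose B := [set v | forall k, A k (asm v k)].
have mB : measurable B.
  have -> : B = \bigcap_(k in setT) ((fun v => asm v k) @^-1` A k).
    by apply/seteqP; split => v /= h' k; [move=> _|]; exact: h'.
  apply: fin_bigcap_measurable => // k _.
  rewrite -[X in measurable X]setTI.
  have: measurable_fun setT (fun v => asm v k).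
    apply: measurable_fun_mx => a j; under eq_fun do rewrite mxE.
    by apply: measurable_coord_comp; exact: measurable_tnth.
  by apply.
have asmE (g : int) w k :
    asm [tuple X (tnth s z + g) w | z < #|{: K * 'I_r}|] k = lagr (t k + g) w.
  apply/matrixP => a j; rewrite !mxE !tnth_mktuple enum_rankK /=.
  by rewrite addrAC.
have := statX s h mB.
rewrite (_ : [set w | B _] = [set w | forall k, A k (lagr (t k + h) w)]); last first.
  by apply/seteqP; split => w /= hB k; move: (hB k); rewrite asmE.
move=> ->; congr (P _).
apply/seteqP; split => w /= hB k; move: (hB k).
  rewrite (_ : asm _ k = lagr (t k) w)// -[t k]addr0 -asmE; congr asm.
  by apply: eq_from_tnth => z; rewrite !tnth_mktuple addr0.
rewrite (_ : asm _ k = lagr (t k) w)// -[t k]addr0 -asmE; congr asm.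
by apply: eq_from_tnth => z; rewrite !tnth_mktuple addr0.
Qed.

Lemma stationary_lag1 (i i' : int) (A : set 'M[R]_(r, d)) : measurable A ->
  P (lagr i @^-1` A) = P (lagr i' @^-1` A).
Proof.
move=> mA; have := @stationary_lag unit (fun=> i') (i - i') (fun=> A) (fun=> mA).
rewrite (addrC i') subrK => h.
transitivity (P [set w | unit -> A (lagr i w)]).
  by congr (P _); apply/seteqP; split => w //= hA; exact: hA tt.
by rewrite h; congr (P _); apply/seteqP; split => w //= hA; exact: hA tt.
Qed.

Lemma integral_lag (i i' : int) (g : 'M[R]_(r, d) -> \bar R) :
  measurable_fun setT g -> (forall x, (0 <= g x)%E) ->
  (\int[P]_w g (lagr i w) = \int[P]_w g (lagr i' w))%E.
Proof.
move=> mg g0.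
transitivity (\int[pushforward P (lagr i)]_x g x)%E.
  by rewrite (ge0_integral_pushforward (measurable_lag i)).
transitivity (\int[pushforward P (lagr i')]_x g x)%E; last first.
  by rewrite (ge0_integral_pushforward (measurable_lag i')).
apply: eq_measure_integral; try exact: measurable_lag.
move=> mi mi' A mA _.
exact: (stationary_lag1 i i' mA).
Qed.

Variables (J : finType) (c : 'M[R]_(r, d) -> J).
Hypothesis mc : forall y, measurable (c @^-1` [set y]).

(** The shift by [r] makes index 0 the vector [(X_r, ..., X_1)], the one that occurs in
    [pred_error]. *)
Definition cell_process (i : nat) (w : T) : J := c (lagr (r%:Z + i%:Z) w).

Lemma finite_valued_cell_process i : finite_valued (cell_process i).
Proof.
move=> y; rewrite -[X in measurable X]setTI.
exact: (measurable_lag (r%:Z + i%:Z)) (mc y).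
Qed.

Lemma law_cell_process i y :
  p (cell_process i @^-1` [set y]) = p (cell_process 0 @^-1` [set y]).
Proof. by congr fine; exact: (stationary_lag1 _ _ (mc y)). Qed.

(* The history up to time [i - L] is shifted into the past [X_k, k <= 0], the
   [r] lags at time [i] then lie in the future [X_k, k >= q] for [L = q + r - 1]. *)
Lemma history_cell_mixing (q : nat) i : (0 < q)%N -> (0 < r)%N ->
  \sum_h \sum_y `|p (history cell_process (q + r.-1) i @^-1` [set h]
                     `&` cell_process i @^-1` [set y])
     - p (history cell_process (q + r.-1) i @^-1` [set h])
       * p (cell_process i @^-1` [set y])| <= 2 * beta_coef X q.
Proof.
move=> q0 r0; set L := (q + r.-1)%N.
pose U (w : T) : {ffun 'I_(i.+1 - L) -> J} :=
  [ffun j : 'I_(i.+1 - L) => c (lagr (j%:Z - (i%:Z - L%:Z)) w)].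
pose V (w : T) := c (lagr L%:Z w).
have sU h : sigma_field X [set k | k <= 0] (U @^-1` [set h]).
  apply: (@finite_valued_ffun _ (g_sigma_algebraType (generators X [set k | k <= 0]))
    _ _ (fun (j : 'I_(i.+1 - L)) (w : T) => c (lagr (j%:Z - (i%:Z - L%:Z)) w))) => j y.
  have := @measurable_lag_sigma_field [set k | k <= 0] (j%:Z - (i%:Z - L%:Z)).
  move=> /(_ _ measurableT _ (mc y)); rewrite setTI; apply.
  by move=> k /=; have := ltn_ord j; lia.
have sV y : sigma_field X [set k | q%:Z <= k] (V @^-1` [set y]).
  have := @measurable_lag_sigma_field [set k | q%:Z <= k] L%:Z.
  move=> /(_ _ measurableT _ (mc y)); rewrite setTI; apply.
  by move=> k /=; have := ltn_ord k; rewrite /L; lia.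
have eV y : p (cell_process i @^-1` [set y]) = p (V @^-1` [set y]).
  by congr fine; exact: (stationary_lag1 _ _ (mc y)).
pose s : int := r%:Z + (i%:Z - L%:Z).
have eU h : p (history cell_process L i @^-1` [set h]) = p (U @^-1` [set h]).
  have := @stationary_lag _ (fun j : 'I_(i.+1 - L) => j%:Z - (i%:Z - L%:Z)) s
    (fun j => c @^-1` [set h j]) (fun=> mc _).
  move=> e; congr fine; transitivity (P [set w | forall j : 'I_(i.+1 - L),
      (c @^-1` [set h j]) (lagr (j%:Z - (i%:Z - L%:Z) + s) w)]).
    congr (P _); apply/seteqP; split => w /= => [<- j|hw].
      by rewrite ffunE /cell_process; congr (c (lag _ _ _ _)); rewrite /s; ring.
    apply/ffunP => j; rewrite ffunE /cell_process -hw.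
    by congr (c (lag _ _ _ _)); rewrite /s; ring.
  rewrite e; congr (P _); apply/seteqP; split => w /= => [hw|<- j]; last by rewrite ffunE.
  by apply/ffunP => j; rewrite ffunE hw.
have eUV h y : p (history cell_process L i @^-1` [set h] `&` cell_process i @^-1` [set y])
    = p (U @^-1` [set h] `&` V @^-1` [set y]).
  (* The joint event is shifted in one application of [stationary_lag], with [None] as the index of
     the present cell. *)
  pose t (j : option 'I_(i.+1 - L)) : int :=
    if j is Some j then j%:Z - (i%:Z - L%:Z) else L%:Z.
  pose A (j : option 'I_(i.+1 - L)) : set 'M[R]_(r, d) :=
    if j is Some j then c @^-1` [set h j] else c @^-1` [set y].
  have mA j : measurable (A j) by case: j => [j|]; exact: mc.
  have e := stationary_lag t s mA.
  congr fine; transitivity (P [set w | forall j, A j (lagr (t j + s) w)]).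
    congr (P _); apply/seteqP; split => w /= => [[hU hV] [j|]|hw].
    - by rewrite /A /= -hU ffunE /cell_process; congr (c (lag _ _ _ _)); rewrite /t /s; ring.
    - by rewrite /A /= -hV /cell_process; congr (c (lag _ _ _ _)); rewrite /t /s; ring.
    - split; last first.
        by rewrite -(hw None) /cell_process; congr (c (lag _ _ _ _)); rewrite /t /s; ring.
      apply/ffunP => j; rewrite ffunE /cell_process -(hw (Some j)).
      by congr (c (lag _ _ _ _)); rewrite /t /s; ring.
  rewrite e; congr (P _); apply/seteqP; split => w /= => [hw|[hU hV] [j|//]].
    by split; [apply/ffunP => j; rewrite ffunE (hw (Some j))|exact: (hw None)].
  by rewrite /A /= -hU ffunE.
under eq_bigr do under eq_bigr do rewrite eU eV eUV.
apply: beta_mix_finite_valued => //; exact: sigma_field_measurable.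
Qed.

End lags.

(** * Uniform lower deviations of bounded functions of the lags *)

Section lower_deviation.
Context {R : realType} {dT : measure_display} {T : measurableType dT}.
Variables (P : probability T R) (d r : nat) (X : int -> {RV P >-> 'rV[R]_d}).
Hypothesis statX : stationary X.
Hypothesis r0 : (0 < r)%N.

(* The functions are rounded down to multiples of [delta] so that
   [uniform_lower_deviation] applies to a process with finitely many values. *)
Lemma lower_deviation_lag (N M q : nat) (rho : 'I_N -> 'M[R]_(r, d) -> R)
    (a B delta : R) :
  (0 < M)%N -> (0 < q)%N -> 0 < a -> a <= 2^-1 -> 0 < B -> 0 < delta ->
  (forall k, measurable_fun setT (rho k)) -> (forall k x, 0 <= rho k x <= B) ->
  exists G : T -> R,
    [/\ measurable_fun setT G, forall w, 0 <= G w,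
      forall w k (m : R), m%:E = (\int[P]_w (rho k (lag r X r%:Z w))%:E)%E ->
        \sum_(0 <= j < M) ((1 - a) * m - rho k (lag r X (r%:Z + j%:Z) w))
          <= G w + M%:R * delta &
      (\int[P]_w (G w)%:E <= (B / a * ((q + r.-1)%:R * ln (1 + N%:R) +
         M%:R * (2 * beta_coef X q)))%:E)%E].
Proof.
move=> M0 q0 a0 a2 B0 delta0 mrho rhoB.
pose n := Num.truncn (B / delta).
pose J := {ffun 'I_N -> 'I_n.+1}.
pose c0 k x : 'I_n.+1 := inord (Num.truncn (rho k x / delta)).
pose c x : J := [ffun k => c0 k x].
pose alpha k (y : J) : R := delta * (y k)%:R.
have rho0 k x : 0 <= rho k x / delta.
  by rewrite divr_ge0 ?(ltW delta0)//; have /andP[] := rhoB k x.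
have trn k x : (Num.truncn (rho k x / delta) < n.+1)%N.
  by rewrite ltnS le_truncn// ler_pM2r ?invr_gt0//; have /andP[] := rhoB k x.
have c0E k x : c0 k x = Num.truncn (rho k x / delta) :> nat by rewrite inordK.
have mc : forall y, measurable (c @^-1` [set y]).
  apply: finite_valued_ffun => k i.
  have -> : c0 k @^-1` [set i] = rho k @^-1` `[delta * i%:R, delta * i.+1%:R[.
    apply/seteqP; split => x /=; rewrite in_itv/=.
      move=> <-; rewrite c0E.
      have /andP[h1 h2] := truncn_itv (rho0 k x).
      by rewrite !(mulrC delta) -ler_pdivlMr// -ltr_pdivrMr// h1.
    rewrite !(mulrC delta) -ler_pdivlMr// -ltr_pdivrMr// => h.
    by apply: val_inj; rewrite /= c0E; apply/eqP; rewrite truncn_eq.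
  by rewrite -[X in measurable X]setTI; exact: mrho.
have alpha_ge0 k y : 0 <= alpha k y by rewrite mulr_ge0 ?(ltW delta0).
have alphaB k y : a / B * alpha k y <= a.
  rewrite mulrAC ler_pdivrMr// ler_wpM2l ?(ltW a0)// /alpha mulrC -ler_pdivlMr//.
  apply: (@le_trans _ _ n%:R); first by rewrite ler_nat -ltnS.
  by rewrite truncn_le divr_ge0// ltW.
have ac k x : alpha k (c x) <= rho k x <= alpha k (c x) + delta.
  rewrite /alpha ffunE c0E; have /andP[h1 h2] := truncn_itv (rho0 k x).
  apply/andP; split; first by rewrite mulrC -ler_pdivlMr.
  by have := ltW h2; rewrite ler_pdivrMr// -natr1; lra.
pose law (y : J) := fine (P (cell_process X c 0 @^-1` [set y])).
have mY i : finite_valued (cell_process X c i) by exact: finite_valued_cell_process.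
have aB0 : 0 < a / B by rewrite divr_gt0.
have L0 : (0 < q + r.-1)%N by lia.
have [G [mG G0 GY GI]] := uniform_lower_deviation mY L0 alpha_ge0 alphaB (ltW a0) a2
  aB0 M0 (fun i y _ => law_cell_process statX mc i y)
  (fun i _ => history_cell_mixing statX mc i q0 r0).
exists G; split => //.
  move=> w k m mE.
  have mle : m <= law_mean alpha law k + delta.
    rewrite -lee_fin mE EFinD.
    have -> : (law_mean alpha law k)%:E = (\int[P]_w (alpha k (cell_process X c 0 w))%:E)%E.
      rewrite (integral_finite_valued P (mY 0%N) (alpha_ge0 k)) /law_mean.
      by congr EFin; apply: eq_bigr => y _; rewrite mulrC.
    have -> : (delta%:E = \int[P]_w delta%:E)%E.
      by rewrite integral_cst//= probability_setT mule1.
    rewrite -ge0_integralD//=; last 3 first.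
    - by move=> *; rewrite lee_fin.
    - by apply/measurable_EFinP; exact: (measurable_finite_valued (alpha k) (mY 0%N)).
    - by move=> *; rewrite lee_fin ltW.
    apply: ge0_le_integralT => v; first by rewrite lee_fin; have /andP[] := rhoB k (lag r X r v).
    by rewrite -EFinD lee_fin /cell_process addr0; have /andP[] := ac k (lag r X r v).
  (* Rounding down only lowers the sampled values, which enter with a minus sign; thus the sole
     error comes from the mean, at most [delta] per index. *)
  apply: (@le_trans _ _ (\sum_(0 <= j < M)
      (deviation alpha law a k (cell_process X c j w) + delta))).
    apply: ler_sum => j _; rewrite /deviation /cell_process.
    have /andP[h1 _] := ac k (lag r X (r%:Z + j%:Z) w).
    have : (1 - a) * m <= (1 - a) * (law_mean alpha law k + delta) by rewrite ler_wpM2l//; lra.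
    have : 0 <= a * delta by rewrite mulr_ge0 ?ltW.
    lra.
  rewrite big_split/= sumr_const_nat subn0 mulr_natl lerD2r.
  exact: GY.
by move: GI; rewrite card_ord invf_div.
Qed.

End lower_deviation.

(** * Noise *)

Section independence.
Context {R : realType} {dT : measure_display} {T : measurableType dT}.
Variable P : probability T R.

(** Independence on rectangles identifies the joint law with the product measure, and Tonelli's
    theorem applies. This stands in for conditioning on [X1]. *)
Lemma integral_indep {d1 d2} {E1 : measurableType d1} {E2 : measurableType d2}
    (X1 : T -> E1) (X2 : T -> E2) (g : E1 * E2 -> \bar R) :
  measurable_fun setT X1 -> measurable_fun setT X2 ->
  (forall A B, measurable A -> measurable B ->
    P (X1 @^-1` A `&` X2 @^-1` B) = (P (X1 @^-1` A) * P (X2 @^-1` B))%E) ->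
  measurable_fun setT g -> (forall x, (0 <= g x)%E) ->
  (\int[P]_w g (X1 w, X2 w) = \int[P]_w \int[P]_v g (X1 w, X2 v))%E.
Proof.
move=> mX1 mX2 ind mg g0.
pose Y1 : {RV P >-> E1} := HB.pack X1 (isMeasurableFun.Build _ _ _ _ X1 mX1).
pose Y2 : {RV P >-> E2} := HB.pack X2 (isMeasurableFun.Build _ _ _ _ X2 mX2).
have mX : measurable_fun setT (fun w => (X1 w, X2 w)) by exact: measurable_fun_pair.
pose Y : {RV P >-> (E1 * E2)%type} :=
  HB.pack (fun w => (X1 w, X2 w)) (isMeasurableFun.Build _ _ _ _ _ mX).
rewrite -(ge0_integral_distribution Y mg g0).
have -> : (\int[distribution P Y]_y g y =
    \int[distribution P Y1 \x distribution P Y2]_y g y)%E.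
  apply: eq_measure_integral => A mA _; apply/esym.
  exact: product_measure_unique.
rewrite fubini_tonelli1//.
rewrite (ge0_integral_distribution Y1)//; last 2 first.
- exact: measurable_fun_fubini_tonelli_F.
- by move=> x; apply: integral_ge0.
apply: eq_integral => w _ /=; rewrite /fubini_F.
by rewrite (ge0_integral_distribution Y2 (f := fun y => g (X1 w, y)))//;
  exact: measurableT_comp.
Qed.

End independence.

(** * Exponential moments from moment growth *)

Section exponential_moment.
Context {R : realType} {dT : measure_display} {T : measurableType dT}.
Variable P : probability T R.

Lemma expR_nneseries (x : R) : 0 <= x ->
  ((expR x)%:E = \sum_(k <oo) (x ^+ k / k`!%:R)%:E)%E.
Proof.
move=> x0; rewrite /expR -EFin_lim; last exact: is_cvg_series_exp_coeff.
congr (limn _); apply/funext => n /=.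
by rewrite /series/= -sumEFin.
Qed.

(** [k ^ k / k!] is one term of the exponential series at [k]. *)
Lemma expn_le_factorial_expR (k : nat) : k%:R ^+ k <= k`!%:R * expR 1 ^+ k :> R.
Proof.
rewrite -expRM_natl mulr1.
case: k => [|k]; first by rewrite expr0 fact0 expR0 mulr1.
rewrite mulrC -ler_pdivrMr ?ltr0n ?fact_gt0//.
by have := expR_ge1Dxn k (ler0n R k.+1); lra.
Qed.

Variables (C : R) (e : T -> R).
Hypothesis C0 : 0 < C.
Hypothesis me : measurable_fun setT e.
Hypothesis moments : forall k : nat, (0 < k)%N ->
  (('E_P[fun w => (`|e w| ^+ k)%R] `^ (k%:R^-1)%R) <= (C * Num.sqrt k%:R)%:E)%E.

(** [sqrt k <= k] turns the assumption into the moment growth of an exponential tail, the form used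
    for the series in [exp_moment_le2]. *)
Lemma moment_le (k : nat) :
  (\int[P]_w (`|e w| ^+ k)%:E <= ((C * k%:R) ^+ k)%:E)%E.
Proof.
case: k => [|k].
  under eq_integral do rewrite expr0.
  by rewrite integral_cst//= probability_setT mule1 expr0.
have := moments (ltn0Sn k); rewrite unlock; set I := (\int[P]_w _)%E => h.
have I0 : (0 <= I)%E by apply: integral_ge0 => w _; rewrite lee_fin exprn_ge0.
have -> : I = ((I `^ (k.+1%:R^-1)) `^ k.+1%:R)%E.
  by rewrite -poweRrM mulVf ?pnatr_eq0// poweRe1.
apply: (@le_trans _ _ ((C * Num.sqrt k.+1%:R)%:E `^ k.+1%:R)%E).
  apply: gt0_ler_poweR => //; rewrite in_itv/= leey andbT ?poweR_ge0//.
  by rewrite lee_fin mulr_ge0 ?sqrtr_ge0 ?ltW.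
have c0 : 0 <= C * Num.sqrt k.+1%:R by rewrite mulr_ge0 ?sqrtr_ge0 ?ltW.
have c1 : 0 <= C * k.+1%:R by rewrite mulr_ge0 ?ltW.
rewrite poweR_EFin powR_mulrn// lee_fin lerXn2r ?nnegrE//. rewrite ler_pM2l//.
rewrite -[leRHS]ger0_norm// -sqrtr_sqr ler_wsqrtr// expr2 -natrM ler_nat.
by rewrite leq_pmulr.
Qed.

(* As [k ^ k <= k! e ^ k], at this radius the exponential series of the moment
   bounds is geometric with ratio [1 / 2]. *)
Definition exp_radius : R := (2 * expR 1 * C)^-1.

Lemma exp_radius_gt0 : 0 < exp_radius.
Proof. by rewrite invr_gt0 !mulr_gt0 ?expR_gt0. Qed.

Lemma exp_moment_le2 : (\int[P]_w (expR (exp_radius * `|e w|))%:E <= 2%:E)%E.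
Proof.
have s0 := exp_radius_gt0.
under eq_integral do rewrite expR_nneseries ?mulr_ge0 ?(ltW s0)//.
rewrite integral_nneseries//; last 2 first.
- move=> k; apply/measurable_EFinP; apply: measurable_funM => //.
  apply: measurable_funX; apply: measurable_funM => //.
  exact: measurableT_comp.
- by move=> k w _; rewrite lee_fin divr_ge0// exprn_ge0// mulr_ge0// ltW.
have -> : (2%:E = \sum_(k <oo) ((2^-1 ^+ k)%:E : \bar R))%E.
  have /cvg_lim := @cvg_geometric_eseries_half R 2 0.
  rewrite expr0 divr1 => <- //; congr (limn _); apply/funext => n.
  apply: eq_bigr => k _; congr EFin.
  by rewrite exprVn addn1 expnS natrM natrX invfM mulrA divff// mul1r.
apply: lee_nneseries => [k _ _|k _].
  by apply: integral_ge0 => w _; rewrite lee_fin divr_ge0// exprn_ge0// mulr_ge0// ltW.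
under eq_integral do rewrite exprMn mulrAC EFinM.
rewrite ge0_integralZl//=; last 2 first.
- apply/measurable_EFinP; apply: measurable_funX.
  exact: measurableT_comp.
- by rewrite lee_fin divr_ge0// exprn_ge0// ltW.
have f0 : 0 < k`!%:R :> R by rewrite ltr0n fact_gt0.
apply: (@le_trans _ _ ((exp_radius ^+ k / k`!%:R)%:E * ((C * k%:R) ^+ k)%:E)%E).
  by rewrite lee_wpmul2l ?moment_le// lee_fin divr_ge0 ?exprn_ge0 ?ltW.
rewrite -EFinM lee_fin mulrAC ler_pdivrMr// exprMn mulrA -exprMn.
have -> : 2^-1 = exp_radius * C * expR 1.
  rewrite /exp_radius; field.
  by rewrite (lt0r_neq0 C0)/= (lt0r_neq0 (expR_gt0 _)).
rewrite [(_ * _ * expR 1) ^+ k]exprMn -mulrA.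
have sC0 : 0 <= exp_radius * C by rewrite mulr_ge0 ?(ltW s0) ?(ltW C0).
rewrite ler_wpM2l ?exprn_ge0//.
by rewrite [leRHS]mulrC expn_le_factorial_expR.
Qed.

Hypothesis mean0 : ('E_P[e] = 0)%E.

(** Expand to second order; the linear term has mean 0. Half of the radius bounds [expR |t e|], the
    other half pays for the square through [z ^+ 2 / 2 <= expR z] at [z = s |e| / 2]. This gives the
    constant 8, and [exp_moment_le2] doubles it. *)
Lemma laplace_le (t : R) : `|t| <= exp_radius / 2 ->
  (\int[P]_w (expR (t * e w))%:E <= (1 + 16 / exp_radius ^+ 2 * t ^+ 2)%:E)%E.
Proof.
move=> ht; have s0 := exp_radius_gt0; set s := exp_radius in s0 ht *.
pose E w := expR (s * `|e w|).
have E0 w : 0 <= E w by exact: expR_ge0.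
have mE : measurable_fun setT E.
  apply: (@measurableT_comp _ _ _ _ _ _ (@expR R)) => //.
  by apply: measurable_funM => //; exact: measurableT_comp.
have iE : P.-integrable setT (EFin \o E).
  apply/integrableP; split; first exact/measurable_EFinP.
  under eq_integral do rewrite /= ger0_norm//.
  by apply: (le_lt_trans exp_moment_le2); rewrite ltry.
have sV0 : 0 <= s^-1 by rewrite ltW// invr_gt0.
have ie : P.-integrable setT (EFin \o e).
  apply: (@le_integrable _ _ _ P _ measurableT _ (EFin \o (fun w => s^-1 * E w))) => //.
  - exact/measurable_EFinP.
  - move=> w _ /=; rewrite lee_fin [leRHS]ger0_norm; last exact: (mulr_ge0 sV0 (E0 w)).
    rewrite mulrC ler_pdivlMr// mulrC.
    by have := expR_ge1Dx (s * `|e w|); rewrite -/(E w); lra.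
  - exact: (integrableZl measurableT s^-1 iE).
have pt w : expR (t * e w) <= 1 + t * e w + 8 / s ^+ 2 * t ^+ 2 * E w.
  apply: (le_trans (expR_le_quadratic _)); rewrite lerD2l.
  have h1 : expR `|t * e w| <= expR (s * `|e w| / 2).
    rewrite ler_expR normrM; have := ler_wpM2r (normr_ge0 (e w)) ht; lra.
  have h2 : (s * `|e w|) ^+ 2 <= 8 * expR (s * `|e w| / 2).
    have z0 : 0 <= s * `|e w| / 2 by rewrite divr_ge0 ?mulr_ge0 ?(ltW s0).
    by have := expR_ge1Dxn 1 z0; rewrite (_ : 2`!%:R = 2)//; lra.
  have h3 : E w = expR (s * `|e w| / 2) * expR (s * `|e w| / 2).
    by rewrite -expRD /E; congr expR; lra.
  have -> : (t * e w) ^+ 2 = t ^+ 2 / s ^+ 2 * (s * `|e w|) ^+ 2.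
    rewrite !exprMn real_normK ?num_real//; field; exact: lt0r_neq0.
  rewrite h3; set x := expR (s * `|e w| / 2) in h1 h2 *.
  have c0 : 0 <= t ^+ 2 / s ^+ 2 by rewrite divr_ge0 ?sqr_ge0.
  rewrite (_ : 8 / s ^+ 2 * t ^+ 2 * (x * x) = t ^+ 2 / s ^+ 2 * (8 * x) * x); last by field; exact: lt0r_neq0.
  apply: ler_pM => //; first exact: (mulr_ge0 c0 (sqr_ge0 _)).
  exact: ler_wpM2l.
apply: (@le_trans _ _ (\int[P]_w (1 + t * e w + 8 / s ^+ 2 * t ^+ 2 * E w)%:E)%E).
  by apply: ge0_le_integralT => w; rewrite lee_fin ?expR_ge0.
under eq_integral do rewrite EFinD EFinD.
have i1 := finite_measure_integrable_cst P 1 measurableT.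
have ite := integrableZl measurableT t ie.
have iE' := integrableZl measurableT (8 / s ^+ 2 * t ^+ 2) iE.
rewrite (integralD measurableT (integrableD measurableT i1 ite) iE').
rewrite (integralD measurableT i1 ite) (integralZl measurableT ie).
rewrite (integralZl measurableT iE).
have -> : (\int[P]_w (EFin \o cst (1%R : R)) w = 1)%E.
  transitivity (\int[P]_w 1%R%:E)%E; first by [].
  by rewrite integral_cst//= probability_setT mule1.
move: mean0; rewrite unlock => ->; rewrite mule0 adde0.
apply: (@le_trans _ _ (1 + (8 / s ^+ 2 * t ^+ 2)%:E * 2%:E)%E).
  rewrite leeD2l// lee_wpmul2l ?exp_moment_le2// lee_fin.
  exact: (mulr_ge0 (divr_ge0 (ler0n _ 8) (sqr_ge0 s)) (sqr_ge0 t)).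
by rewrite -EFinM -EFinD lee_fin; lra.
Qed.

Lemma expectation_abs_le : (\int[P]_w (`|e w|)%:E <= C%:E)%E.
Proof.
have := moment_le 1; under eq_integral do rewrite expr1.
by rewrite expr1 mulr1.
Qed.

End exponential_moment.

(** Jensen's inequality, from the tangent of [expR] at the mean. It reduces the noise to single
    coordinates at the same scale [lam]: dependence between the coordinates of the noise does no
    harm, and [d] drops out. *)
Lemma expR_mean_le {R : realType} (d : nat) (y : 'I_d -> R) : (0 < d)%N ->
  expR (d%:R^-1 * \sum_j y j) <= d%:R^-1 * \sum_j expR (y j).
Proof.
move=> d0; set m := d%:R^-1 * _.
have dR : 0 < d%:R :> R by rewrite ltr0n.
rewrite ler_pdivlMl//.
apply: (@le_trans _ _ (\sum_j expR m * (1 + (y j - m)))); last first.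
  apply: ler_sum => j _.
  have -> : expR (y j) = expR m * expR (y j - m) by rewrite -expRD subrKC.
  by rewrite ler_wpM2l ?expR_ge0// expR_ge1Dx.
rewrite -mulr_sumr big_split/= sumr_const card_ord sumrB sumr_const card_ord.
rewrite -[m *+ d]mulr_natl /m mulrA divff ?lt0r_neq0// mul1r subrr addr0.
by rewrite mulrC.
Qed.

Section noise.
Context {R : realType} {dT : measure_display} {T : measurableType dT}.
Variables (P : probability T R) (d r : nat).
Variables (X eps : int -> {RV P >-> 'rV[R]_d}) (f0 : 'M[R]_(r, d) -> 'rV[R]_d).
Variable C : R.
Hypothesis d0 : (0 < d)%N.
Hypothesis C0 : 0 < C.
Hypothesis ar : autoregressive X eps f0.
Hypothesis moments : forall (k : nat) (j : 'I_d), (0 < k)%N ->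
  ('E_P[fun w => (`|eps 1 w 0 j| ^+ k)%R] `^ (k%:R^-1)%R
     <= (C * Num.sqrt k%:R)%:E)%E.

Let measurable_eps i j : measurable_fun setT (fun w => eps i w 0 j).
Proof. by apply: measurable_coord_comp; exact: measurable_funPT. Qed.

Lemma integral_eps i j (g : R -> \bar R) : measurable_fun setT g ->
  (forall x, (0 <= g x)%E) ->
  (\int[P]_w g (eps i w 0%R j) = \int[P]_w g (eps 1%R w 0%R j))%E.
Proof.
move=> mg g0.
transitivity (\int[pushforward P (fun w => eps i w 0%R j)]_x g x)%E.
  by rewrite (ge0_integral_pushforward (measurable_eps i j)).
transitivity (\int[pushforward P (fun w => eps 1%R w 0%R j)]_x g x)%E; last first.
  by rewrite (ge0_integral_pushforward (measurable_eps 1 j)).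
apply: eq_measure_integral; try exact: measurable_eps.
move=> A mA _; rewrite /= /pushforward.
have mB : measurable ((fun v : 'rV[R]_d => v 0 j) @^-1` A).
  by rewrite -[X in measurable X]setTI; exact: (measurable_coord 0 j) mA.
exact: (ar_ident ar i 1 mB).
Qed.

Definition laplace_const : R := 16 / exp_radius C ^+ 2.

Lemma laplace_const_ge0 : 0 <= laplace_const.
Proof. by rewrite divr_ge0 ?sqr_ge0. Qed.

Lemma laplace_eps i j t : `|t| <= exp_radius C / 2 ->
  (\int[P]_w (expR (t * eps i w 0%R j))%:E <= (1 + laplace_const * t ^+ 2)%:E)%E.
Proof.
move=> ht.
rewrite (integral_eps i j (g := fun x => (expR (t * x))%:E)).
- by apply: (laplace_le C0 (measurable_eps 1 j)) => //; [move=> k; exact: moments|exact: (ar_mean ar)].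
- apply/measurable_EFinP; apply: (@measurableT_comp _ _ _ _ _ _ (@expR R)) => //.
- by move=> x; rewrite lee_fin expR_ge0.
Qed.

Lemma expectation_abs_eps i j : (\int[P]_w (`|eps i w 0%R j|%R)%:E <= C%:E)%E.
Proof.
rewrite (integral_eps i j (g := fun x => (`|x|)%:E)).
- by apply: (expectation_abs_le C0 (e := fun w => eps 1 w 0 j)) => k; exact: moments.
- by apply/measurable_EFinP.
- by move=> x; rewrite lee_fin.
Qed.

Variables (N M : nat) (u : 'I_N -> 'M[R]_(r, d) -> 'rV[R]_d) (U lam : R).
Hypothesis N0 : (0 < N)%N.
Hypothesis mu : forall k, measurable_fun setT (u k).
Hypothesis uU : forall k x j, `|u k x 0 j| <= U.
Hypothesis lam0 : 0 < lam.
Hypothesis lamU : lam * U <= exp_radius C / 2.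

(** Times are counted from 0 from here on: [innovation i] is the noise in [X_(r+1+i)], and
    [past_lag i] is the vector from which that observation is predicted. *)
Definition past_lag (i : nat) (w : T) : 'M[R]_(r, d) := lag r X (r%:Z + i%:Z) w.

Definition innovation (i : nat) : T -> 'rV[R]_d := eps (r.+1%:Z + i%:Z).

Definition mean_inner (v v' : 'rV[R]_d) : R := d%:R^-1 * \sum_j v 0 j * v' 0 j.

Definition tilt k i w : R :=
  \sum_(0 <= m < i) (mean_inner (innovation m w) (u k (past_lag m w))
    - laplace_const * lam * mean_inner (u k (past_lag m w)) (u k (past_lag m w))).

(** Generators of the sigma-field of the past of [X_(r+1+i)]. Equipping [T] with that sigma-field,
    as [T' i] does, turns adaptedness into plain measurability. *)
Let G i := generators X [set k | k < r.+1%:Z + i%:Z].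

Let T' i := g_sigma_algebraType (G i).

Let measurable_sub i d' (E : measurableType d') (f : T -> E) :
  measurable_fun setT (f : T' i -> E) -> measurable_fun setT f.
Proof.
move=> mf _ B mB; apply: (@sigma_field_measurable _ _ _ P _ _ X [set k | k < r.+1%:Z + i%:Z]).
exact: mf.
Qed.

(** Past noise is a function of past observations. Hence [tilt k i] belongs to the sigma-field of
    which [innovation i] is independent. *)
Let innovationE m w : innovation m w = X (r.+1%:Z + m%:Z) w - f0 (past_lag m w).
Proof.
rewrite [X _ w](ar_eq ar) /innovation /past_lag.
rewrite (_ : r.+1%:Z + m%:Z - 1 = r%:Z + m%:Z); last by lia.
by rewrite -/(past_lag m w) [RHS]addrC addKr.
Qed.

Let measurable_past_lag i m : (m <= i)%N ->
  measurable_fun setT (past_lag m : T' i -> 'M[R]_(r, d)).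
Proof. by move=> mi; apply: measurable_lag_sigma_field => k /=; lia. Qed.

Let measurable_u_past_lag i m k j : (m <= i)%N ->
  measurable_fun setT ((fun w => u k (past_lag m w) 0 j) : T' i -> R).
Proof.
move=> mi; apply: (@measurable_coord_comp _ _ (T' i)).
by apply: (@measurableT_comp _ _ _ (T' i)) => //; exact: measurable_past_lag.
Qed.

Let measurable_innovation i m j : (m < i)%N ->
  measurable_fun setT ((fun w => innovation m w 0 j) : T' i -> R).
Proof.
move=> mi; rewrite (_ : (fun w => _) = (fun w =>
    X (r.+1%:Z + m%:Z) w 0 j - f0 (past_lag m w) 0 j)); last first.
  by apply/funext => w; rewrite innovationE !mxE.
apply: (@measurable_funB _ (T' i)).
  apply: (@measurable_coord_comp _ _ (T' i)).
  by apply: measurable_sigma_field => /=; lia.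
apply: (@measurable_coord_comp _ _ (T' i)).
apply: (@measurableT_comp _ _ _ (T' i)); first exact: (ar_measurable ar).
by apply: measurable_past_lag; exact: ltnW.
Qed.

Let measurable_sq_mean_inner i m k : (m <= i)%N ->
  measurable_fun setT ((fun w => mean_inner (u k (past_lag m w)) (u k (past_lag m w))) : T' i -> R).
Proof.
move=> mi; apply: (@measurable_funM _ (T' i)) => //.
by apply: (@measurable_sum _ (T' i)) => j; apply: (@measurable_funM _ (T' i));
  exact: measurable_u_past_lag.
Qed.

Let measurable_tilt i k : measurable_fun setT (tilt k i : T' i -> R).
Proof.
rewrite /tilt.
rewrite (_ : (fun w => _) = (fun w => \sum_(m < i)
  (mean_inner (innovation m w) (u k (past_lag m w))
    - laplace_const * lam * mean_inner (u k (past_lag m w)) (u k (past_lag m w))))); last first.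
  by apply/funext => w; rewrite /tilt big_mkord.
apply: (@measurable_sum _ (T' i)) => m; have mi := ltn_ord m.
apply: (@measurable_funB _ (T' i)).
  apply: (@measurable_funM _ (T' i)) => //.
  apply: (@measurable_sum _ (T' i)) => j; apply: (@measurable_funM _ (T' i)).
    exact: measurable_innovation.
  by apply: measurable_u_past_lag; exact: ltnW.
apply: (@measurable_funM _ (T' i)) => //.
by apply: measurable_sq_mean_inner; exact: ltnW.
Qed.

Let indep i j (f : T -> R * R) : measurable_fun setT (f : T' i -> R * R) ->
  forall A B, measurable A -> measurable B ->
  P (f @^-1` A `&` (fun w => innovation i w 0 j) @^-1` B) =
  (P (f @^-1` A) * P ((fun w => innovation i w 0%R j) @^-1` B))%E.
Proof.
move=> mf A B mA mB; rewrite setIC muleC.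
have mB' : measurable ((fun v : 'rV[R]_d => v 0 j) @^-1` B).
  by rewrite -[X in measurable X]setTI; exact: (measurable_coord 0 j) mB.
apply: (ar_innov ar (i := r.+1%:Z + i%:Z)).
  apply: sub_sigma_algebra; exists (r.+1%:Z + i%:Z) => //.
  by exists ((fun v : 'rV[R]_d => v 0 j) @^-1` B) => //; rewrite setTI.
by have := mf measurableT _ mA; rewrite setTI.
Qed.

(** The conditional Laplace bound: [A] and [v] belong to the past and are frozen by [integral_indep]
    while the innovation is integrated out. *)
Let laplace_cond i j (A v : T -> R) :
  measurable_fun setT (A : T' i -> R) -> measurable_fun setT (v : T' i -> R) ->
  (forall w, 0 <= A w) -> (forall w, `|v w| <= U) ->
  (\int[P]_w (A w * expR (lam * (innovation i w 0%R j * v w)))%:E <=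
   \int[P]_w (A w * (1 + laplace_const * lam ^+ 2 * v w ^+ 2))%:E)%E.
Proof.
move=> mA mv A0 vU.
pose f w := (A w, v w).
have mf : measurable_fun setT (f : T' i -> (R * R)%type) by exact: measurable_fun_pair.
(* The absolute value makes [g] nonnegative on the whole product space; it changes nothing at the
   values of [A]. *)
pose g (z : R * R * R) : \bar R := (`|z.1.1| * expR (lam * (z.2 * z.1.2)))%:E.
have mg : measurable_fun setT g.
  apply/measurable_EFinP; apply: measurable_funM.
    by apply: (measurableT_comp (@normr_measurable R setT)); apply: measurableT_comp.
  apply: (measurableT_comp (@measurable_expR R)).
  apply: measurable_funM => //; apply: measurable_funM => //.
  exact: measurableT_comp.
have g0 z : (0 <= g z)%E by rewrite lee_fin mulr_ge0 ?expR_ge0.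
have := integral_indep (measurable_sub mf) (measurable_eps (r.+1%:Z + i%:Z) j) (indep j mf) mg g0.
rewrite (_ : (\int[P]_w g _ = \int[P]_w (A w * expR (lam * (innovation i w 0%R j * v w)))%:E)%E); last first.
  by apply: eq_integral => w _; rewrite /g /= ger0_norm.
move=> ->; apply: ge0_le_integralT => w; first by apply: integral_ge0.
rewrite /g /= ger0_norm//.
under eq_integral do rewrite EFinM.
rewrite ge0_integralZl//=; last 2 first.
- apply/measurable_EFinP; apply: (measurableT_comp (@measurable_expR R)).
  by apply: measurable_funM => //; apply: measurable_funM => //; exact: measurable_eps.
- by rewrite lee_fin.
rewrite EFinM lee_wpmul2l ?lee_fin//.
have lamv : `|lam * v w| <= exp_radius C / 2.
  by rewrite normrM (ger0_norm (ltW lam0)); apply: le_trans lamU; rewrite ler_pM2l.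
rewrite -mulrA -exprMn; apply: le_trans (laplace_eps (r.+1%:Z + i%:Z) j lamv).
rewrite le_eqVlt; apply/orP; left; apply/eqP; apply: eq_integral => w' _.
by rewrite -mulrA [v w * _]mulrC.
Qed.

(** [A] already contains the compensator of step [i]. After averaging over coordinates the new
    factor is at most [1 + laplace_const * lam ^+ 2 * V], and [1 + x <= expR x] cancels it against
    that compensator. *)
Lemma tilt_supermartingale i k :
  (\int[P]_w (expR (lam * tilt k i.+1 w))%:E <=
   \int[P]_w (expR (lam * tilt k i w))%:E)%E.
Proof.
pose V w := mean_inner (u k (past_lag i w)) (u k (past_lag i w)).
pose A w := expR (lam * tilt k i w - laplace_const * lam ^+ 2 * V w).
have mV : measurable_fun setT (V : T' i -> R) by exact: measurable_sq_mean_inner.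
have mA : measurable_fun setT (A : T' i -> R).
  apply: (@measurableT_comp _ _ _ (T' i) _ _ (@expR R)) => //.
  apply: (@measurable_funB _ (T' i)); apply: (@measurable_funM _ (T' i)) => //.
pose v j w := u k (past_lag i w) 0 j.
have mv j : measurable_fun setT (v j : T' i -> R) by exact: measurable_u_past_lag.
have A0 w : 0 <= A w by exact: expR_ge0.
have d1 : 0 <= d%:R^-1 :> R by rewrite invr_ge0.
have mA' := measurable_sub mA; have mv' j := measurable_sub (mv j).
have mE j : measurable_fun setT (fun w => expR (lam * (innovation i w 0 j * v j w))).
  apply: (measurableT_comp (@measurable_expR R)).
  by apply: measurable_funM => //; apply: measurable_funM => //; exact: measurable_eps.
have step w : expR (lam * tilt k i.+1 w) <=
    \sum_j d%:R^-1 * (A w * expR (lam * (innovation i w 0 j * v j w))).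
  rewrite /tilt big_nat_recr//= -/(tilt k i w) -/(V w).
  have -> : lam * (tilt k i w + (mean_inner (innovation i w) (u k (past_lag i w))
      - laplace_const * lam * V w)) =
      (lam * tilt k i w - laplace_const * lam ^+ 2 * V w) +
      d%:R^-1 * \sum_j lam * (innovation i w 0 j * v j w).
    by rewrite -mulr_sumr /mean_inner; ring.
  rewrite expRD -[leRHS]mulr_sumr -[X in _ <= _ * X]mulr_sumr [leRHS]mulrCA.
  rewrite ler_wpM2l ?expR_ge0//.
  exact: expR_mean_le.
apply: (@le_trans _ _ (\int[P]_w (\sum_j d%:R^-1 *
    (A w * expR (lam * (innovation i w 0%R j * v j w)))%R)%:E)%E).
  by apply: ge0_le_integralT => w; rewrite lee_fin// expR_ge0.
under eq_integral do rewrite -sumEFin.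
rewrite ge0_integral_sum//=; last 2 first.
- move=> j; apply/measurable_EFinP; apply: measurable_funM => //.
  exact: measurable_funM.
- by move=> j w _; rewrite lee_fin !mulr_ge0 ?expR_ge0.
apply: (@le_trans _ _ (\sum_j (d%:R^-1)%:E * \int[P]_w
    (A w * (1 + laplace_const * lam ^+ 2 * v j w ^+ 2))%:E)%E).
  apply: lee_sum => j _; under eq_integral do rewrite EFinM.
  rewrite ge0_integralZl//=; last 2 first.
  - by apply/measurable_EFinP; exact: measurable_funM.
  - by move=> w _; rewrite lee_fin mulr_ge0 ?expR_ge0.
  rewrite lee_wpmul2l ?lee_fin//.
  by apply: laplace_cond => //; rewrite /v.
have mB j : measurable_fun setT (fun w => A w * (1 + laplace_const * lam ^+ 2 * v j w ^+ 2)).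
  apply: measurable_funM => //; apply: measurable_funD => //.
  by apply: measurable_funM => //; exact: measurable_funX.
have B0 j w : 0 <= A w * (1 + laplace_const * lam ^+ 2 * v j w ^+ 2).
  rewrite mulr_ge0// addr_ge0// mulr_ge0 ?sqr_ge0//.
  by rewrite mulr_ge0 ?laplace_const_ge0 ?sqr_ge0.
have -> : (\sum_j (d%:R^-1)%:E * \int[P]_w
      (A w * (1 + laplace_const * lam ^+ 2 * v j w ^+ 2))%:E =
    \int[P]_w \sum_j (d%:R^-1 * (A w * (1 + laplace_const * lam ^+ 2 * v j w ^+ 2))%R)%:E)%E.
  rewrite ge0_integral_sum//=; last 2 first.
  - by move=> j; apply/measurable_EFinP; exact: measurable_funM.
  - by move=> j w _; rewrite lee_fin mulr_ge0.
  apply: eq_bigr => j _; under [RHS]eq_integral do rewrite EFinM.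
  have mB' : measurable_fun setT (fun w =>
      (A w * (1 + laplace_const * lam ^+ 2 * v j w ^+ 2))%:E) by exact/measurable_EFinP.
  by rewrite (ge0_integralZl P measurableT mB')// => w _; rewrite lee_fin.
apply: ge0_le_integralT => w.
  by apply: sume_ge0 => j _; rewrite lee_fin mulr_ge0.
rewrite sumEFin lee_fin -mulr_sumr -mulr_sumr mulrCA.
have -> : d%:R^-1 * \sum_j (1 + laplace_const * lam ^+ 2 * v j w ^+ 2) =
    1 + laplace_const * lam ^+ 2 * V w.
  rewrite big_split/= sumr_const card_ord mulrDr mulVf ?pnatr_eq0 -?lt0n//.
  by rewrite -mulr_sumr /V /mean_inner; under eq_bigr do rewrite expr2; ring.
have -> : expR (lam * tilt k i w) = A w * expR (laplace_const * lam ^+ 2 * V w).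
  by rewrite -expRD subrK.
by rewrite ler_wpM2l// expR_ge1Dx.
Qed.

Lemma integral_tilt_le1 k i : (\int[P]_w (expR (lam * tilt k i w))%:E <= 1)%E.
Proof.
elim: i => [|i IHi]; last exact: le_trans (tilt_supermartingale _ _) IHi.
under eq_integral do rewrite /tilt big_geq// mulr0 expR0.
by rewrite integral_cst//= probability_setT mule1.
Qed.

(** The maximum over [k] is bounded by the logarithm of the sum of exponentials and this by its
    tangent at [N]. The expectation then involves only the exponential moments, each at most 1,
    which leaves [ln N + 1]. *)
Lemma noise_bound : exists Q : T -> R,
  [/\ measurable_fun setT Q, forall w, 0 <= Q w,
      forall w k, \sum_(0 <= m < M) mean_inner (innovation m w) (u k (past_lag m w))
        <= Q w + laplace_const * lam *
           \sum_(0 <= m < M) mean_inner (u k (past_lag m w)) (u k (past_lag m w)) &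
      (\int[P]_w (Q w)%:E <= (lam^-1 * (ln N%:R + 1))%:E)%E].
Proof.
have NR : 0 < N%:R :> R by rewrite ltr0n.
have lnN : 0 <= ln N%:R :> R by rewrite ln_ge0// ler1n.
have mtilt k i : measurable_fun setT (fun w => expR (lam * tilt k i w)).
  apply: (measurableT_comp (@measurable_expR R)); apply: measurable_funM => //.
  exact: (measurable_sub (@measurable_tilt i k)).
have mS : measurable_fun setT (fun w => \sum_k expR (lam * tilt k M w)).
  by apply: measurable_sum => k.
exists (fun w => lam^-1 * (ln N%:R + N%:R^-1 * \sum_k expR (lam * tilt k M w))); split.
- apply: measurable_funM => //; apply: measurable_funD => //.
  exact: measurable_funM.
- move=> w; rewrite mulr_ge0 ?invr_ge0 ?(ltW lam0)// addr_ge0// mulr_ge0 ?invr_ge0//.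
  by apply: sumr_ge0 => k _; exact: expR_ge0.
- move=> w k; rewrite [X in _ <= _ + X]mulr_sumr -lerBlDr -sumrB -/(tilt k M w) ler_pdivlMl//.
  have S0 : 0 < \sum_k expR (lam * tilt k M w).
    by rewrite (bigD1 k)//= ltr_pwDl ?expR_gt0// sumr_ge0// => l _; exact: expR_ge0.
  rewrite [leRHS]addrC [X in X + _]mulrC; apply: le_trans (ln_le_affine S0 NR).
  rewrite -[leLHS]expRK ler_ln ?posrE ?expR_gt0//.
  by rewrite (bigD1 k)//= lerDl sumr_ge0// => l _; exact: expR_ge0.
- under eq_integral do rewrite EFinM EFinD EFinM.
  rewrite ge0_integralZl//=; last 3 first.
  + by apply: emeasurable_funD => //; apply/measurable_EFinP; exact: measurable_funM.
  + move=> w _; rewrite -EFinM -EFinD lee_fin addr_ge0// mulr_ge0 ?invr_ge0//.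
    by apply: sumr_ge0 => k _; exact: expR_ge0.
  + by rewrite lee_fin invr_ge0 ltW.
  rewrite EFinM lee_wpmul2l ?lee_fin ?invr_ge0 ?(ltW lam0)//.
  rewrite ge0_integralD//=; last 2 first.
  + by move=> w _; rewrite -EFinM lee_fin mulr_ge0 ?invr_ge0// sumr_ge0// => k _; exact: expR_ge0.
  + by apply/measurable_EFinP; exact: measurable_funM.
  rewrite integral_cst//= probability_setT mule1 EFinD leeD2l//.
  rewrite ge0_integralZl//=; last 2 first.
  + exact/measurable_EFinP.
  + by move=> w _; rewrite lee_fin sumr_ge0// => k _; exact: expR_ge0.
  under eq_integral do rewrite -sumEFin.
  rewrite ge0_integral_sum//=; last first.
    by move=> k; apply/measurable_EFinP.
  apply: (@le_trans _ _ ((N%:R^-1)%:E * \sum_(k < N) 1)%E).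
    rewrite lee_wpmul2l ?lee_fin ?invr_ge0//.
    by apply: lee_sum => k _; exact: integral_tilt_le1.
  by rewrite sumEFin sumr_const card_ord -EFinM mulVf ?lt0r_neq0.
Qed.

End noise.

(** * Oracle inequality *)

Section bracketing.
Context {R : realType} {E : Type} {d : nat}.
Implicit Types (f : E -> 'rV[R]_d) (F : set (E -> 'rV[R]_d)).

(** Two functions in one bracket differ by at most [delta]. The centers are chosen inside [F], so
    that they inherit measurability and the bound of the class; a bracket that misses [F] receives
    an arbitrary member. *)
Lemma bracket_number_cover (delta : R) F : F !=set0 ->
  bracket_number delta F = +oo%E \/
  exists N : nat, [/\ (0 < N)%N, bracket_number delta F = N%:R%:E &
    exists g : 'I_N -> E -> 'rV[R]_d, (forall k, F (g k)) /\
      forall f, F f -> exists k, forall x j, `|f x 0 j - g k x 0 j| <= delta].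
Proof.
move=> [f0 Ff0]; rewrite /bracket_number; set S := [set m : nat | _].
have [S0|/set0P[m0 Sm0]] := eqVneq S set0.
  by left; rewrite S0 image_set0 ereal_inf0.
right; have exS : exists m, `[< S m >] by exists m0; exact/asboolP.
case: (ex_minnP exS) => N /asboolP SN minN.
have [l [u [lu cover]]] := SN.
exists N; split.
- by case: N SN minN l u lu cover => // SN minN l u lu /(_ _ Ff0)[[]].
- apply/eqP; rewrite eq_le; apply/andP; split; first by apply: ereal_inf_lbound; exists N.
  apply: le_ereal_inf_tmp => _ [m Sm <-]; rewrite lee_fin ler_nat.
  by apply: minN; exact/asboolP.
- have [g hg] : {g : 'I_N -> E -> 'rV[R]_d & forall k, F (g k) /\
      ((exists2 f, F f & bracket (l k) (u k) f) -> bracket (l k) (u k) (g k))}.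
    apply: (@choice _ _ (fun k g => F g /\
      ((exists2 f, F f & bracket (l k) (u k) f) -> bracket (l k) (u k) g))) => k.
    have [[f Ff bf]|nf] := pselect (exists2 f, F f & bracket (l k) (u k) f).
      by exists f.
    by exists f0.
  exists g; split => [k|f Ff]; first by case: (hg k).
  have [k _ bf] := cover _ Ff; exists k => x j.
  have [_ /(_ (ex_intro2 _ _ f Ff bf)) bg] := hg k.
  have /andP[f1 f2] := bf j x; have /andP[g1 g2] := bg j x.
  have : ((`|(u k x - l k x) 0%R j|)%:E <= delta%:E)%E.
    by apply: le_trans (lu k); apply: ereal_sup_ubound; exists (x, j).
  by rewrite lee_fin !mxE ler_norml ler_distl => /andP[h1 h2]; lra.
Qed.

End bracketing.

(** * Pointwise comparison of truncated losses *)

Section truncated_loss.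
Context {R : realType} {V : Type} {d : nat}.
Variables (f0 : V -> 'rV[R]_d) (W : V -> R) (kappa : R).
Implicit Types (f g h : V -> 'rV[R]_d) (x : V).
Hypothesis W01 : forall x, 0 <= W x <= 1.

Definition loss h x : R := d%:R^-1 * (norm2 (h x - f0 x) ^+ 2 * W x).

(* [f0] need not be bounded: the loss is split according to the size of [f0]. *)
Definition small_loss h x : R := d%:R^-1 *
  \sum_j (`|f0 x 0 j| <= kappa)%R%:R * ((f0 x 0 j - h x 0 j) ^+ 2 * W x).

Definition large_loss h x : R := d%:R^-1 *
  \sum_j (kappa < `|f0 x 0 j|)%R%:R * ((f0 x 0 j - h x 0 j) ^+ 2 * W x).

Lemma norm2_sqr (v : 'rV[R]_d) : norm2 v ^+ 2 = \sum_j v 0 j ^+ 2.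
Proof. by rewrite sqr_sqrtr// sumr_ge0// => j _; rewrite sqr_ge0. Qed.

Let dV0 : 0 <= d%:R^-1 :> R. Proof. by rewrite invr_ge0. Qed.

Let W0 x : 0 <= W x. Proof. by case/andP: (W01 x). Qed.
Let W1 x : W x <= 1. Proof. by case/andP: (W01 x). Qed.

Lemma loss_split h x : loss h x = small_loss h x + large_loss h x.
Proof.
rewrite -mulrDr -big_split/= /loss norm2_sqr mulr_suml; congr (_ * _).
apply: eq_bigr => j _; rewrite !mxE -mulrDl ltNge.
by case: (_ <= _); rewrite /= ?addr0 ?add0r mul1r; ring.
Qed.

Lemma loss_ge0 h x : 0 <= loss h x.
Proof. exact: mulr_ge0 (mulr_ge0 (sqr_ge0 _) (W0 x)). Qed.

Lemma small_loss_ge0 h x : 0 <= small_loss h x.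
Proof. by rewrite mulr_ge0// sumr_ge0// => j _; exact: mulr_ge0 (mulr_ge0 (sqr_ge0 _) (W0 x)). Qed.

Lemma large_loss_ge0 h x : 0 <= large_loss h x.
Proof. by rewrite mulr_ge0// sumr_ge0// => j _; exact: mulr_ge0 (mulr_ge0 (sqr_ge0 _) (W0 x)). Qed.

Variables (F a : R).
Hypothesis F0 : 0 < F.
Hypothesis a0 : 0 < a.
Hypothesis a1 : a <= 1.
Hypothesis kappaE : kappa = (1 + 8 / a) * F.
Hypothesis d0 : (0 < d)%N.

Let ler_mean (s t : 'I_d -> R) : (forall j, s j <= t j) ->
  d%:R^-1 * \sum_j s j <= d%:R^-1 * \sum_j t j.
Proof. by move=> st; rewrite ler_wpM2l// ler_sum. Qed.

Let mean_cst (c : R) : d%:R^-1 * \sum_(j < d) c = c.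
Proof.
by rewrite sumr_const card_ord -[c *+ d]mulr_natl mulrA mulVf ?mul1r// pnatr_eq0 -lt0n.
Qed.

(** The bound is asked where [W] is nonzero, a subset of [supp W]. That is enough because every loss
    carries the factor [W x]. *)
Definition bounded_on_weight h := forall x j, W x != 0 -> `|h x 0 j| <= F.

Let kappa_gt : F <= kappa.
Proof. by rewrite kappaE ler_peMl ?(ltW F0)// lerDl divr_ge0 ?(ltW a0). Qed.

(* Where [f0] exceeds [kappa], the diameter [2 F] of the class is negligible. *)
Let far (b u : R) : kappa < `|b| -> `|u| <= F -> 2 * F <= a / 4 * `|b - u|.
Proof.
move=> kb uF; have : kappa - F <= `|b - u|.
  by have := lerB_dist b u; lra.
rewrite kappaE => h; rewrite mulrAC ler_pdivlMr//.
have : a * ((1 + 8 / a) * F - F) <= a * `|b - u| by rewrite ler_pM2l.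
have -> : a * ((1 + 8 / a) * F - F) = 8 * F by field; exact: lt0r_neq0.
lra.
Qed.

(** Replacing [f] by [g] moves the distance to [f0] by at most [2 * F], a fraction [a / 4] of it by
    [far], and [(1 + a / 4) ^+ 2 <= 1 + a]. No moment of [f0] enters. *)
Lemma large_loss_le g f x : bounded_on_weight g -> bounded_on_weight f ->
  large_loss g x <= (1 + a) * large_loss f x.
Proof.
move=> bg bf; rewrite mulrCA ler_wpM2l// mulr_sumr; apply: ler_sum => j _.
have [Wx|Wx] := eqVneq (W x) 0; first by rewrite Wx !mulr0.
case: ltP => [kb|_]; last by rewrite !mul0r mulr0.
rewrite !mul1r mulrA ler_wpM2r//.
have := far kb (bf x j Wx); have := bg x j Wx; have := bf x j Wx.
move: (f0 x 0 j) (g x 0 j) (f x 0 j) {kb} => b v u uF vF h.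
have : `|b - v| <= (1 + a / 4) * `|b - u|.
  have := ler_normD (b - u) (u - v); rewrite addrA subrK.
  by have := ler_normB u v; lra.
have h1 := normr_ge0 (b - u); have h2 := normr_ge0 (b - v).
rewrite -(real_normK (num_real (b - v))) -(real_normK (num_real (b - u))) => h3.
apply: (@le_trans _ _ (((1 + a / 4) * `|b - u|) ^+ 2)).
  by rewrite lerXn2r// nnegrE; lra.
rewrite exprMn ler_wpM2r ?sqr_ge0//.
have : a ^+ 2 <= a by rewrite expr2 ler_piMl// ltW.
by move: a0; lra.
Qed.

(** Brings the compensator of the noise back to losses, which the basic inequality can absorb. The
    square of [W x] is reduced to [W x] by [W x <= 1]; on the large part [far] makes the squared
    distance negligible. *)
Lemma sq_dist_le g f x : bounded_on_weight g -> bounded_on_weight f ->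
  d%:R^-1 * \sum_j (W x * (g x 0 j - f x 0 j)) * (W x * (g x 0 j - f x 0 j)) <=
  2 * small_loss g x + 2 * small_loss f x + a * large_loss f x.
Proof.
move=> bg bf.
have -> : 2 * small_loss g x + 2 * small_loss f x + a * large_loss f x =
    d%:R^-1 * \sum_j (
      2 * ((`|f0 x 0 j| <= kappa)%R%:R * ((f0 x 0 j - g x 0 j) ^+ 2 * W x)) +
      2 * ((`|f0 x 0 j| <= kappa)%R%:R * ((f0 x 0 j - f x 0 j) ^+ 2 * W x)) +
      a * ((kappa < `|f0 x 0 j|)%R%:R * ((f0 x 0 j - f x 0 j) ^+ 2 * W x))).
  by rewrite !big_split/= -!mulr_sumr /small_loss /large_loss; ring.
apply: ler_mean => j.
have [Wx|Wx] := eqVneq (W x) 0; first by rewrite Wx !mul0r !mulr0 !addr0.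
apply: (@le_trans _ _ ((g x 0 j - f x 0 j) ^+ 2 * W x)).
  rewrite (_ : _ * _ = W x * ((g x 0 j - f x 0 j) ^+ 2 * W x)); last by rewrite expr2; ring.
  by rewrite ler_piMl// mulr_ge0 ?sqr_ge0.
case: ltP => [kb|_]; rewrite /= ?(mul0r, mul1r, mulr0, add0r, addr0).
  rewrite [leRHS]mulrA ler_wpM2r//.
  have := far kb (bf x j Wx); have := bg x j Wx; have := bf x j Wx.
  move: (f0 x 0 j) (g x 0 j) (f x 0 j) {kb} => b v u uF vF h.
  have h1 := normr_ge0 (b - u).
  rewrite -(real_normK (num_real (b - u))) -(real_normK (num_real (v - u))).
  apply: (@le_trans _ _ ((a / 4 * `|b - u|) ^+ 2)).
    have vub : `|v - u| <= a / 4 * `|b - u| by have := ler_normB v u; lra.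
    by rewrite lerXn2r// ?nnegrE//; exact: le_trans vub.
  rewrite exprMn ler_wpM2r ?sqr_ge0//.
  have : a ^+ 2 <= a by rewrite expr2 ler_piMl// ltW.
  by move: a0; lra.
move: (f0 x 0 j) (g x 0 j) (f x 0 j) => b v u.
rewrite (_ : 2 * _ + _ = (2 * (b - v) ^+ 2 + 2 * (b - u) ^+ 2) * W x); last ring.
rewrite ler_wpM2r// -subr_ge0.
rewrite (_ : _ - _ = ((b - v) + (b - u)) ^+ 2); [exact: sqr_ge0|ring].
Qed.

Lemma small_loss_dist g h x (delta : R) : bounded_on_weight g -> bounded_on_weight h ->
  (forall j, `|g x 0 j - h x 0 j| <= delta) ->
  small_loss g x <= small_loss h x + 2 * (kappa + F) * delta.
Proof.
move=> bg bh gh.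
have delta0 : 0 <= delta.
  by apply: le_trans (gh (Ordinal d0)).
have kF : 0 <= kappa + F by rewrite addr_ge0 ?(le_trans (ltW F0) kappa_gt) ?(ltW F0).
have c0 : 0 <= 2 * (kappa + F) * delta by rewrite mulr_ge0// mulr_ge0.
rewrite -[X in _ <= _ + X]mean_cst -mulrDr -big_split/=; apply: ler_mean => j.
have [Wx|Wx] := eqVneq (W x) 0; first by rewrite Wx !mulr0 add0r.
case: (leP `|f0 x 0 j| kappa) => [kb|_]; last by rewrite !mul0r add0r.
rewrite !mul1r; have := gh j; have := bg x j Wx; have := bh x j Wx; move: kb.
move: (f0 x 0 j) (g x 0 j) (h x 0 j) => b v u kb uF vF vu.
rewrite -lerBlDl -mulrBl; apply: (@le_trans _ _ (`|(b - v) ^+ 2 - (b - u) ^+ 2| * W x)).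
  by rewrite ler_wpM2r// ler_norm.
apply: (@le_trans _ _ (`|(b - v) ^+ 2 - (b - u) ^+ 2|)); first by rewrite ler_piMr.
rewrite (_ : _ - _ = (2 * b - v - u) * - (v - u)); last by rewrite !expr2; ring.
rewrite normrM normrN ler_pM//.
have := ler_normB (2 * b - v) u; have := ler_normB (2 * b) v.
by rewrite normrM ger0_norm//; lra.
Qed.

Lemma small_loss_le h x : bounded_on_weight h -> small_loss h x <= (kappa + F) ^+ 2.
Proof.
move=> bh; rewrite -[leRHS]mean_cst; apply: ler_mean => j.
have [Wx|Wx] := eqVneq (W x) 0; first by rewrite Wx !mulr0 sqr_ge0.
case: (leP `|f0 x 0 j| kappa) => [kb|_]; last by rewrite mul0r sqr_ge0.
rewrite mul1r; apply: (@le_trans _ _ ((f0 x 0 j - h x 0 j) ^+ 2)).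
  by rewrite ler_piMr// sqr_ge0.
rewrite -(real_normK (num_real (_ - _))) lerXn2r// ?nnegrE//.
  by have := kappa_gt; move: F0; lra.
by have := ler_normB (f0 x 0 j) (h x 0 j); have := bh x j Wx; lra.
Qed.

(** Here the loss is not truncated and [f0] may be far away, so the cross term is weighted by [t]
    instead of being bounded; [delta <= 1] reduces [delta ^+ 2] to [delta]. *)
Lemma loss_dist g f x (t delta : R) : 0 < t -> delta <= 1 ->
  (forall j, `|g x 0 j - f x 0 j| <= delta) ->
  loss g x <= (1 + t) * loss f x + (1 + t^-1) * delta.
Proof.
move=> t0 delta1 gf.
have delta0 : 0 <= delta by apply: le_trans (gf (Ordinal d0)).
have tV0 : 0 < t^-1 by rewrite invr_gt0.
have -> : (1 + t) * loss f x + (1 + t^-1) * delta = d%:R^-1 *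
    \sum_j ((1 + t) * ((f x - f0 x) 0 j ^+ 2 * W x) + (1 + t^-1) * delta).
  rewrite big_split/= mulrDr mean_cst -mulr_sumr -mulr_suml /loss norm2_sqr.
  by rewrite (mulrCA (1 + t)).
rewrite /loss norm2_sqr mulr_suml; apply: ler_mean => j; rewrite !mxE.
have := gf j; move: (f0 x 0 j) (g x 0 j) (f x 0 j) => b v u vu.
have h1 : (v - u) ^+ 2 <= delta.
  rewrite -(real_normK (num_real (v - u))); apply: (@le_trans _ _ (delta ^+ 2)).
    by rewrite lerXn2r// nnegrE.
  by rewrite expr2 ler_piMl.
(* AM-GM: [2 x y <= t x^2 + y^2 / t] *)
have h2 : (v - b) ^+ 2 <= (1 + t) * (u - b) ^+ 2 + (1 + t^-1) * (v - u) ^+ 2.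
  have : 0 <= t^-1 * (t * (u - b) - (v - u)) ^+ 2 by rewrite mulr_ge0 ?sqr_ge0// ltW.
  have -> : t^-1 * (t * (u - b) - (v - u)) ^+ 2 =
    t * (u - b) ^+ 2 - 2 * (u - b) * (v - u) + t^-1 * (v - u) ^+ 2.
    by field; exact: lt0r_neq0.
  by rewrite (_ : v - b = (u - b) + (v - u)); [lra|ring].
rewrite mulrA; apply: (@le_trans _ _ (((1 + t) * (u - b) ^+ 2 + (1 + t^-1) * (v - u) ^+ 2) * W x)).
  by rewrite ler_wpM2r.
rewrite mulrDl lerD2l; apply: (@le_trans _ _ ((1 + t^-1) * (v - u) ^+ 2)).
  by rewrite ler_piMr// mulr_ge0 ?sqr_ge0//; lra.
by rewrite ler_wpM2l//; lra.
Qed.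

End truncated_loss.

Section integral_lemmas.
Context {R : realType} {dT : measure_display} {T : measurableType dT}.
Variable P : probability T R.

Lemma ge0_integral_scaleD (c : R) (g : T -> R) (h : T -> \bar R) : 0 <= c ->
  measurable_fun setT g -> (forall w, 0 <= g w) ->
  measurable_fun setT h -> (forall w, (0 <= h w)%E) ->
  (\int[P]_w ((c * g w)%:E + h w) = c%:E * \int[P]_w (g w)%:E + \int[P]_w h w)%E.
Proof.
move=> c0 mg g0 mh h0.
have mgE : measurable_fun setT (fun w => (g w)%:E) by exact/measurable_EFinP.
rewrite ge0_integralD//; last 2 first.
- by move=> w _; rewrite lee_fin mulr_ge0.
- by apply/measurable_EFinP; exact: measurable_funM.
congr (_ + _)%E; under eq_integral do rewrite EFinM.
by rewrite (ge0_integralZl P measurableT mgE)// => w _; rewrite lee_fin.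
Qed.

End integral_lemmas.

Section loss_measurability.
Context {R : realType} {d r : nat}.
Variables (f0 : 'M[R]_(r, d) -> 'rV[R]_d) (W : 'M[R]_(r, d) -> R) (kappa : R).
Hypothesis mf0 : measurable_fun setT f0.
Hypothesis mW : measurable_fun setT W.
Variable h : 'M[R]_(r, d) -> 'rV[R]_d.
Hypothesis mh : measurable_fun setT h.

Let mabs j : measurable_fun setT (fun x => `|f0 x 0 j|).
Proof.
by apply: (measurableT_comp (@normr_measurable R setT)); exact: measurable_coord_comp.
Qed.

Let msq j : measurable_fun setT (fun x => (f0 x 0 j - h x 0 j) ^+ 2 * W x).
Proof.
apply: measurable_funM => //; apply: measurable_funX.
by apply: measurable_funB; exact: measurable_coord_comp.
Qed.

Lemma measurable_small_loss : measurable_fun setT (small_loss f0 W kappa h).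
Proof.
apply: measurable_funM => //; apply: measurable_sum => j.
apply: measurable_funM => //.
rewrite (_ : (fun x => _) = \1_((fun x => `|f0 x 0 j|) @^-1` `]-oo, kappa])).
  by apply: measurable_indic; rewrite -[X in measurable X]setTI; exact: mabs.
apply/funext => x; rewrite indicE; congr ((nat_of_bool _)%:R).
by apply/idP/idP; rewrite inE/= in_itv.
Qed.

Lemma measurable_large_loss : measurable_fun setT (large_loss f0 W kappa h).
Proof.
apply: measurable_funM => //; apply: measurable_sum => j.
apply: measurable_funM => //.
rewrite (_ : (fun x => _) = \1_((fun x => `|f0 x 0 j|) @^-1` `]kappa, +oo[)).
  by apply: measurable_indic; rewrite -[X in measurable X]setTI; exact: mabs.
apply/funext => x; rewrite indicE; congr ((nat_of_bool _)%:R).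
by apply/idP/idP; rewrite inE/= in_itv/= andbT.
Qed.

Lemma measurable_loss : measurable_fun setT (loss f0 W h).
Proof.
rewrite (_ : loss f0 W h = (fun x => d%:R^-1 * \sum_j (f0 x 0 j - h x 0 j) ^+ 2 * W x)).
  by apply: measurable_funM => //; apply: measurable_sum => j.
apply/funext => x; rewrite /loss norm2_sqr mulr_suml; congr (_ * _).
by apply: eq_bigr => j _; rewrite !mxE; congr (_ * _); ring.
Qed.

End loss_measurability.

Section prediction_error.
Context {R : realType} {dT : measure_display} {T : measurableType dT}.
Variables (P : probability T R) (d r : nat) (X : int -> {RV P >-> 'rV[R]_d}).
Variables (f0 : 'M[R]_(r, d) -> 'rV[R]_d) (W : 'M[R]_(r, d) -> R).
Hypothesis mf0 : measurable_fun setT f0.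
Hypothesis mW : measurable_fun setT W.
Hypothesis W01 : forall x, 0 <= W x <= 1.
Hypothesis d0 : (0 < d)%N.

Lemma measurable_lag_comp i (phi : 'M[R]_(r, d) -> R) :
  measurable_fun setT phi -> measurable_fun setT (fun w => phi (lag r X i w)).
Proof. by move=> mphi; apply: (measurableT_comp mphi); exact: measurable_lag. Qed.

Lemma pred_errorE f : measurable_fun setT f ->
  pred_error X f0 W f = (\int[P]_w (loss f0 W f (lag r X r%:Z w))%:E)%E.
Proof.
move=> mf; rewrite /pred_error unlock.
have ml := measurable_lag_comp r%:Z (measurable_loss mf0 mW mf).
have dR : d%:R != 0 :> R by rewrite pnatr_eq0 -lt0n.
rewrite -ge0_integralZl//=.
- apply/measurable_EFinP; rewrite (_ : (fun w => _) = (fun w => d%:R * loss f0 W f (lag r X r%:Z w))).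
    exact: measurable_funM.
  by apply/funext => w; rewrite /loss mulrA divff// mul1r.
- by move=> w _; rewrite lee_fin mulr_ge0 ?sqr_ge0//; case/andP: (W01 (lag r X r%:Z w)).
Qed.

Lemma pred_error_split kappa f : measurable_fun setT f ->
  (pred_error X f0 W f =
   \int[P]_w (small_loss f0 W kappa f (lag r X r%:Z w))%:E +
   \int[P]_w (large_loss f0 W kappa f (lag r X r%:Z w))%:E)%E.
Proof.
move=> mf; rewrite pred_errorE//.
under eq_integral do rewrite (loss_split f0 W kappa) EFinD.
rewrite ge0_integralD//.
- by move=> w _; rewrite lee_fin small_loss_ge0.
- apply/measurable_EFinP; apply: measurable_lag_comp; exact: measurable_small_loss.
- by move=> w _; rewrite lee_fin large_loss_ge0.
- apply/measurable_EFinP; apply: measurable_lag_comp; exact: measurable_large_loss.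
Qed.

Lemma pred_error_ge0 f : (0 <= pred_error X f0 W f)%E.
Proof.
rewrite /pred_error mule_ge0 ?lee_fin ?invr_ge0// expectation_ge0// => w.
by rewrite mulr_ge0 ?sqr_ge0//; case/andP: (W01 (lag r X r%:Z w)).
Qed.

Hypothesis statX : stationary X.

Lemma integral_sum_lag M (phi : 'M[R]_(r, d) -> R) :
  measurable_fun setT phi -> (forall x, 0 <= phi x) ->
  (\int[P]_w (\sum_(0 <= m < M) phi (past_lag r X m w))%:E =
   M%:R%:E * \int[P]_w (phi (lag r X r%:Z w))%:E)%E.
Proof.
move=> mphi phi0.
under eq_integral do rewrite -sumEFin.
rewrite ge0_integral_sum//=; last 2 first.
- by move=> m; apply/measurable_EFinP; exact: measurable_lag_comp.
- by move=> m w _; rewrite lee_fin.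
rewrite (eq_bigr (fun=> \int[P]_w (phi (lag r X r%:Z w))%:E)%E); last first.
  move=> m _; apply: (integral_lag statX (r%:Z + m%:Z) r%:Z (g := EFin \o phi)).
    exact/measurable_EFinP.
  by move=> x; rewrite /= lee_fin.
elim: M => [|M IHM]; first by rewrite big_geq// mul0e.
rewrite big_nat_recr//= IHM -natr1 EFinD ge0_muleDl ?lee_fin// mul1e.
by [].
Qed.

End prediction_error.

(** * Basic inequality for a minimizer of the empirical risk *)

Section basic_inequality.
Context {R : realType} {dT : measure_display} {T : measurableType dT}.
Variables (P : probability T R) (d r n : nat).
Variables (X eps : int -> {RV P >-> 'rV[R]_d}).
Variables (f0 : 'M[R]_(r, d) -> 'rV[R]_d) (W : 'M[R]_(r, d) -> R).
Hypothesis ar : autoregressive X eps f0.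
Hypothesis rn : (r < n)%N.
Local Notation lagm m w := (past_lag r X m w).
Local Notation innov m w := (innovation r eps m w).

Let loss_response f m w :
  d%:R^-1 * norm2 (X (m + r.+1)%N%:Z w - f (lag r X ((m + r.+1)%N%:Z - 1) w)) ^+ 2
    * W (lag r X ((m + r.+1)%N%:Z - 1) w) =
  loss f0 W f (lagm m w)
  + 2 * mean_inner (innov m w) (W (lagm m w) *: (f0 (lagm m w) - f (lagm m w)))
  + d%:R^-1 * \sum_j innov m w 0 j ^+ 2 * W (lagm m w).
Proof.
have -> : lag r X ((m + r.+1)%N%:Z - 1) w = lagm m w.
  by rewrite /past_lag; congr (lag _ _ _ _); lia.
have -> : X (m + r.+1)%N%:Z w = f0 (lagm m w) + innov m w.
  rewrite (ar_eq ar) /past_lag /innovation.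
  by congr (f0 (lag _ _ _ _) + eps _ w); lia.
rewrite -mulrA /loss /mean_inner !norm2_sqr !mulr_suml.
rewrite (mulrCA 2) [2 * (\sum_j _)]mulr_sumr -!mulrDr -!big_split/=; congr (_ * _).
by apply: eq_bigr => j _; rewrite !mxE; ring.
Qed.

(** The squared noise is common to both risks and cancels. In the cross term [f0] cancels as well,
    so the noise only meets the bounded difference of [g] and [f]. *)
Lemma basic_inequality g f w :
  emp_risk X W n g w <= emp_risk X W n f w ->
  \sum_(0 <= m < n - r) loss f0 W g (lagm m w) <=
  \sum_(0 <= m < n - r) loss f0 W f (lagm m w) +
  2 * \sum_(0 <= m < n - r)
    mean_inner (innov m w) (W (lagm m w) *: (g (lagm m w) - f (lagm m w))).
Proof.
have n0 : 0 < n%:R^-1 :> R by rewrite invr_gt0 ltr0n; lia.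
rewrite /emp_risk ler_pM2l// -[r.+1]add0n !big_addn subSS.
under eq_bigr do rewrite loss_response.
under [X in _ <= X -> _]eq_bigr do rewrite loss_response.
rewrite -subr_ge0 -sumrB => h; rewrite -subr_ge0 mulr_sumr -big_split/= -sumrB.
suff <- : \sum_(0 <= m < n - r) (loss f0 W f (lagm m w)
  + 2 * mean_inner (innov m w) (W (lagm m w) *: (f0 (lagm m w) - f (lagm m w)))
  + d%:R^-1 * \sum_j innov m w 0 j ^+ 2 * W (lagm m w) -
  (loss f0 W g (lagm m w)
  + 2 * mean_inner (innov m w) (W (lagm m w) *: (f0 (lagm m w) - g (lagm m w)))
  + d%:R^-1 * \sum_j innov m w 0 j ^+ 2 * W (lagm m w))) =
  \sum_(0 <= m < n - r) (loss f0 W f (lagm m w) + 2 *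
   mean_inner (innov m w) (W (lagm m w) *: (g (lagm m w) - f (lagm m w))) -
   loss f0 W g (lagm m w)) by [].
apply: eq_bigr => m _.
have -> : mean_inner (innov m w) (W (lagm m w) *: (g (lagm m w) - f (lagm m w))) =
    mean_inner (innov m w) (W (lagm m w) *: (f0 (lagm m w) - f (lagm m w))) -
    mean_inner (innov m w) (W (lagm m w) *: (f0 (lagm m w) - g (lagm m w))).
  rewrite /mean_inner -mulrBr -sumrB; congr (_ * _); apply: eq_bigr => j _.
  by rewrite !mxE; ring.
ring.
Qed.

End basic_inequality.

(** * Oracle inequality for a fixed outcome *)

Section oracle_pointwise.
Context {R : realType} {d r : nat}.
Variables (f0 : 'M[R]_(r, d) -> 'rV[R]_d) (W : 'M[R]_(r, d) -> R).
Hypothesis W01 : forall x, 0 <= W x <= 1.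
Hypothesis d0 : (0 < d)%N.
Variables (kappa F a lam K delta Q G : R) (n M : nat).
Variables (x : nat -> 'M[R]_(r, d)) (e : nat -> 'rV[R]_d).
Variables (f g gk : 'M[R]_(r, d) -> 'rV[R]_d) (mk : R).
Hypothesis F0 : 0 < F.
Hypothesis a0 : 0 < a.
Hypothesis a8 : a <= 8^-1.
Hypothesis kappaE : kappa = (1 + 8 / a) * F.
Hypothesis bf : bounded_on_weight W F f.
Hypothesis bg : bounded_on_weight W F g.
Hypothesis bgk : bounded_on_weight W F gk.
Hypothesis delta0 : 0 < delta.
Hypothesis ggk : forall x j, `|g x 0 j - gk x 0 j| <= delta.
Hypothesis lam0 : 0 <= K * lam.
Hypothesis lamK : 4 * (K * lam) <= a.
Hypothesis n0 : (0 < n)%N.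
Hypothesis nE : n = (M + r)%N.
Hypothesis Q0 : 0 <= Q.
Hypothesis G0 : 0 <= G.
Hypothesis mk0 : 0 <= mk.
Hypothesis mkB : mk <= (kappa + F) ^+ 2.

Local Notation S h := (\sum_(0 <= m < M) small_loss f0 W kappa h (x m)).
Local Notation L h := (\sum_(0 <= m < M) large_loss f0 W kappa h (x m)).
Local Notation N v := (\sum_(0 <= m < M) mean_inner (e m) (W (x m) *: (v (x m) - f (x m)))).
Local Notation E := (\sum_(0 <= m < M) (d%:R^-1 * \sum_j `|e m 0 j|)).

Hypothesis basic : \sum_(0 <= m < M) loss f0 W g (x m) <=
  \sum_(0 <= m < M) loss f0 W f (x m) + 2 * N g.
Hypothesis noise : N gk <= Q + K * lam * \sum_(0 <= m < M)
  mean_inner (W (x m) *: (gk (x m) - f (x m))) (W (x m) *: (gk (x m) - f (x m))).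
Hypothesis deviation : \sum_(0 <= m < M) ((1 - a) * mk - small_loss f0 W kappa gk (x m))
  <= G + M%:R * delta.

Let a1 : a <= 1. Proof. by move: a8; lra. Qed.

(** Deterministic arithmetic. The basic inequality and the noise bound control the empirical small
    loss of [gk], up to a multiple of itself that moves to the left; the deviation bound then passes
    to its mean [mk]. The index of [gk] does not occur on the right. *)
Lemma small_mean_le :
  mk <= (1 + 5 * a) / n%:R * S f + (4 * a / n%:R * L f + (4 / n%:R * Q
    + (2 / n%:R * G + (4 * delta / n%:R * E
    + ((4 * (kappa + F) + 2) * delta + r%:R * (kappa + F) ^+ 2 / n%:R))))).
Proof.
have nR : 0 < n%:R :> R by rewrite ltr0n.
have dV0 : 0 <= d%:R^-1 :> R by rewrite invr_ge0.
have Sf0 : 0 <= S f by apply: sumr_ge0 => m _; exact: small_loss_ge0.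
have Lf0 : 0 <= L f by apply: sumr_ge0 => m _; exact: large_loss_ge0.
have Sk0 : 0 <= S gk by apply: sumr_ge0 => m _; exact: small_loss_ge0.
have E0 : 0 <= E.
  by apply: sumr_ge0 => m _; rewrite mulr_ge0// sumr_ge0.
have sp h : \sum_(0 <= m < M) loss f0 W h (x m) = S h + L h.
  by rewrite -big_split/=; apply: eq_bigr => m _; exact: loss_split.
have LfLg : L f <= (1 + a) * L g.
  by rewrite mulr_sumr; apply: ler_sum => m _; exact: (large_loss_le _ W01 a0 a1 kappaE).
(* [g] itself is random, so its noise term is moved to the cover at the price of [delta] times the
   mean absolute noise. *)
have NgNgk : N g <= N gk + delta * E.
  rewrite mulr_sumr -big_split/=; apply: ler_sum => m _.
  rewrite [X in _ <= _ + X]mulrCA -mulrDr ler_wpM2l// mulr_sumr -big_split/=.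
  apply: ler_sum => j _; rewrite !mxE -lerBlDl -mulrBr -mulrBr.
  apply: (le_trans (ler_norm _)); rewrite normrM mulrC ler_wpM2r//.
  rewrite (_ : _ - _ = g (x m) 0 j - gk (x m) 0 j); last ring.
  have /andP[w0 w1] := W01 (x m).
  by rewrite normrM (ger0_norm w0) -[leRHS]mul1r ler_pM.
have SkSg : S gk <= S g + M%:R * (2 * (kappa + F) * delta).
  rewrite mulr_natl -[M in _ *+ M]subn0 -sumr_const_nat -big_split/=.
  apply: ler_sum => m _; apply: (small_loss_dist f0 W01 F0 a0 kappaE d0) => // j.
  by rewrite distrC.
have sqk : \sum_(0 <= m < M)
    mean_inner (W (x m) *: (gk (x m) - f (x m))) (W (x m) *: (gk (x m) - f (x m)))
    <= 2 * S gk + 2 * S f + a * L f.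
  rewrite !mulr_sumr -!big_split/=; apply: ler_sum => m _.
  apply: le_trans (sq_dist_le f0 W01 a0 a1 kappaE (x m) bgk bf).
  by rewrite /mean_inner; under eq_bigr do rewrite !mxE.
move: basic noise deviation; rewrite !sp sumrB sumr_const_nat subn0 -[X in X - _]mulr_natl.
set s := S f in Sf0 sqk *; set l := L f in Lf0 LfLg sqk *; set sk := S gk in Sk0 SkSg sqk *.
set sg := S g in SkSg *; set lg := L g in LfLg *; set ng := N g in NgNgk *.
set nk := N gk in NgNgk *; set E1 := E in E0 NgNgk *.
set V := (\sum_(0 <= m < M) _) in sqk *.
have k0 := lam0; have k4 := lamK; set k := K * lam in k0 k4 *; set C1 := 2 * (kappa + F) in SkSg *.
move=> h1 h2 h3.
have kV : k * V <= k * (2 * sk + 2 * s + a * l) by rewrite ler_wpM2l.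
have ksk : 4 * k * sk <= a * sk by rewrite ler_wpM2r.
have ks : 4 * k * s <= a * s by rewrite ler_wpM2r.
have kl : 4 * k * (a * l) <= a * l.
  by apply: le_trans (ler_wpM2r _ k4) _; rewrite ?mulr_ge0 ?(ltW a0)// ler_piMl ?mulr_ge0// ltW.
(* The large losses of [g] cancel those of [f] up to [a * l]; they are never estimated by
   themselves. *)
have lg1 : (1 - a) * l <= lg.
  have : (1 - a) * l <= (1 - a) * ((1 + a) * lg) by rewrite ler_wpM2l//; move: a1; lra.
  have : 0 <= a ^+ 2 * lg by rewrite mulr_ge0 ?sqr_ge0// sumr_ge0// => m _; exact: large_loss_ge0.
  lra.
have C10 : 0 <= C1 * delta.
  rewrite mulr_ge0 ?(ltW delta0)// /C1 mulr_ge0// kappaE addr_ge0 ?(ltW F0)//.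
  by rewrite mulr_ge0 ?(ltW F0)// addr_ge0// divr_ge0// ltW.
have al0 : 0 <= a * l by rewrite mulr_ge0// ltW.
have step1 : (1 - a) * sk <= (1 + a) * s + 2 * a * l + 2 * Q + 2 * delta * E1
    + M%:R * (C1 * delta) by lra.
have Mn : M%:R <= n%:R :> R by rewrite ler_nat nE leq_addr.
have Md : M%:R * delta <= n%:R * delta by rewrite ler_wpM2r// ltW.
have MC : M%:R * (C1 * delta) <= n%:R * (C1 * delta) by rewrite ler_wpM2r.
have Md0 : 0 <= M%:R * delta by rewrite mulr_ge0// ltW.
have step2 : (1 - a) * ((1 - a) * (M%:R * mk)) <= (1 + a) * s + 2 * a * l + 2 * Q + G
    + 2 * delta * E1 + n%:R * (C1 * delta) + n%:R * delta.
  have : (1 - a) * ((1 - a) * (M%:R * mk)) <= (1 - a) * (sk + G + M%:R * delta).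
    apply: ler_wpM2l; first by move: a1; lra.
    by move: h3; lra.
  have : 0 <= a * (G + M%:R * delta) by rewrite mulr_ge0 ?addr_ge0// ltW.
  by move: step1; lra.
have mB := mkB; set B := (kappa + F) ^+ 2 in mB *.
set Z := n%:R * (C1 * delta) in step2 MC *.
(* [1 <= (1 + 3 a) (1 - a)^2] for [a <= 1 / 8] *)
have step3 : M%:R * mk <= (1 + 5 * a) * s + 4 * a * l + 4 * Q + 2 * G
    + 4 * delta * E1 + 2 * Z + 2 * (n%:R * delta).
  have Mmk0 : 0 <= M%:R * mk by rewrite mulr_ge0.
  have c1 : M%:R * mk <= (1 + 3 * a) * ((1 - a) * ((1 - a) * (M%:R * mk))).
    have : 0 <= a * (1 - 5 * a + 3 * a ^+ 2) * (M%:R * mk).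
      rewrite mulr_ge0// mulr_ge0 ?(ltW a0)//; have := sqr_ge0 a; move: a8; lra.
    lra.
  apply: (le_trans c1).
  have c2 : (1 + 3 * a) * ((1 - a) * ((1 - a) * (M%:R * mk))) <= (1 + 3 * a) *
      ((1 + a) * s + 2 * a * l + 2 * Q + G + 2 * delta * E1 + Z + n%:R * delta).
    by rewrite ler_wpM2l//; move: a0; lra.
  apply: (le_trans c2).
  have aa : 0 <= a * (8^-1 - a) by rewrite mulr_ge0 ?subr_ge0 ?(ltW a0).
  have g1 : 0 <= (a * (8^-1 - a)) * s by rewrite mulr_ge0.
  have g2 : 0 <= (a * (8^-1 - a)) * l by rewrite mulr_ge0.
  have b0 : 0 <= 1 - 3 * a by move: a8; lra.
  have g3 : 0 <= (1 - 3 * a) * Q by rewrite mulr_ge0.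
  have g4 : 0 <= (1 - 3 * a) * G by rewrite mulr_ge0.
  have g5 : 0 <= (1 - 3 * a) * (delta * E1) by rewrite !mulr_ge0// ltW.
  have Z0 : 0 <= Z by rewrite mulr_ge0.
  have g6 : 0 <= (1 - 3 * a) * Z by rewrite mulr_ge0.
  have g7 : 0 <= (1 - 3 * a) * (n%:R * delta) by rewrite !mulr_ge0// ltW.
  have g8 : 0 <= a * s by rewrite mulr_ge0// ltW.
  have g9 : 0 <= a * l by rewrite mulr_ge0// ltW.
  by lra.
(* Only [M = n - r] terms are observed; the missing [r * mk] is covered by the uniform bound on
   small losses. *)
have step4 : n%:R * mk <= (1 + 5 * a) * s + 4 * a * l + 4 * Q + 2 * G
    + 4 * delta * E1 + 2 * Z + 2 * (n%:R * delta) + r%:R * B.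
  have : r%:R * mk <= r%:R * B by rewrite ler_wpM2l.
  have -> : n%:R * mk = M%:R * mk + r%:R * mk by rewrite nE natrD mulrDl.
  by move: step3; lra.
rewrite -(ler_pM2l nR); apply: (le_trans step4).
rewrite le_eqVlt; apply/orP; left; apply/eqP; rewrite /Z /C1; field.
exact: lt0r_neq0.
Qed.

End oracle_pointwise.

(** * Integration and choice of the constants *)

Section oracle_inequality.
Context {R : realType} {dT : measure_display} {T : measurableType dT}.
Variable P : probability T R.

(** The premise on [h] and the conclusion have the same form, so a nested sum is integrated by
    iterating the lemma from its innermost term outwards. *)
Lemma ge0_integral_scaleD_le (c : R) (g : T -> R) (h : T -> \bar R) (I J : \bar R) :
  0 <= c -> measurable_fun setT g -> (forall w, 0 <= g w) ->
  (\int[P]_w (g w)%:E <= I)%E ->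
  [/\ measurable_fun setT h, forall w, (0 <= h w)%E & (\int[P]_w h w <= J)%E] ->
  [/\ measurable_fun setT (fun w => (c * g w)%:E + h w)%E,
      forall w, (0 <= (c * g w)%:E + h w)%E &
      (\int[P]_w ((c * g w)%:E + h w) <= c%:E * I + J)%E].
Proof.
move=> c0 mg g0 gI [mh h0 hJ]; split.
- apply: emeasurable_funD => //; apply/measurable_EFinP.
  exact: measurable_funM.
- by move=> w; rewrite adde_ge0// lee_fin mulr_ge0.
- by rewrite ge0_integral_scaleD// leeD// lee_wpmul2l// lee_fin.
Qed.

(** The value of [a]: at most [1 / 8], as [small_mean_le] requires, and at most [eta / 8], so that
    [1 + 5 * a <= (1 + eta) ^+ 2]. *)
Definition margin (eta : R) : R := Num.min eta 1 / 8.

Definition truncation (eta Fb : R) : R := (1 + 8 / margin eta) * Fb.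

Definition small_loss_bound (eta Fb : R) : R := (truncation eta Fb + Fb) ^+ 2.

(* The exponential moments exist up to [exp_radius]; the second bound makes the
   compensator of the noise at most [margin] times the empirical losses. *)
Definition noise_scale (eta Ceps Fb : R) : R :=
  Num.min (exp_radius Ceps / (4 * Fb)) (margin eta / (4 * (laplace_const Ceps + 1))).

(** The first three summands multiply [Lambda_mix] and stem from the noise, the lower deviations and
    the [r] missing terms; the last two multiply [delta] and pay for moving noise and losses to the
    cover. *)
Definition oracle_const (eta Cb Ceps Fb : R) (r : nat) : R :=
  12 / noise_scale eta Ceps Fb
  + small_loss_bound eta Fb / margin eta * (4 * r%:R + 4 * Cb ^+ 2)
  + 2 * r%:R * small_loss_bound eta Fb
  + 4 * Ceps + (6 * (truncation eta Fb + Fb) + 2).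

Lemma noise_scale_gt0 eta Ceps Fb : 0 < eta -> 0 < Ceps -> 0 < Fb ->
  0 < noise_scale eta Ceps Fb.
Proof.
move=> eta0 Ceps0 Fb0; have K0 := laplace_const_ge0 Ceps.
rewrite lt_min !divr_gt0 ?exp_radius_gt0 ?mulr_gt0 ?lt_min ?eta0 ?ltr01//; lra.
Qed.

Lemma margin_gt0 eta : 0 < eta -> 0 < margin eta.
Proof. by move=> eta0; rewrite divr_gt0// lt_min eta0 ltr01. Qed.

Lemma oracle_const_ge0 eta Cb Ceps Fb r : 0 < eta -> 0 < Ceps -> 0 < Fb ->
  0 <= oracle_const eta Cb Ceps Fb r.
Proof.
move=> eta0 Ceps0 Fb0.
have l0 := noise_scale_gt0 eta0 Ceps0 Fb0; have a0 := margin_gt0 eta0.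
have k0 : 0 <= truncation eta Fb.
  by rewrite mulr_ge0 ?(ltW Fb0)// addr_ge0// divr_ge0// ltW.
have c0 : 0 <= Cb ^+ 2 by exact: sqr_ge0.
have r0 : 0 <= r%:R :> R by [].
have B0 : 0 <= small_loss_bound eta Fb by exact: sqr_ge0.
have t1 : 0 <= 12 / noise_scale eta Ceps Fb by rewrite divr_ge0// ltW.
have t2 : 0 <= small_loss_bound eta Fb / margin eta * (4 * r%:R + 4 * Cb ^+ 2).
  exact: mulr_ge0 (divr_ge0 B0 (ltW a0))
    (addr_ge0 (mulr_ge0 (ler0n _ 4) r0) (mulr_ge0 (ler0n _ 4) c0)).
have t3 : 0 <= 2 * r%:R * small_loss_bound eta Fb.
  exact: mulr_ge0 (mulr_ge0 (ler0n _ 2) r0) B0.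
by rewrite /oracle_const; lra.
Qed.

Variables (d r n N q : nat) (X eps : int -> {RV P >-> 'rV[R]_d}).
Variables (f0 : 'M[R]_(r, d) -> 'rV[R]_d) (W : 'M[R]_(r, d) -> R).
Variables (eta Cb Ceps Fb delta : R).
Hypothesis eta0 : 0 < eta.
Hypothesis Ceps0 : 0 < Ceps.
Hypothesis Fb0 : 0 < Fb.
Hypothesis r0 : (0 < r)%N.
Hypothesis d0 : (0 < d)%N.
Hypothesis rn : (r < n)%N.
Hypothesis ar : autoregressive X eps f0.
Hypothesis mW : measurable_fun setT W.
Hypothesis W01 : forall x, 0 <= W x <= 1.
Hypothesis moments : forall (k : nat) (j : 'I_d), (0 < k)%N ->
  ('E_P[fun w => (`|eps 1 w 0 j| ^+ k)%R] `^ (k%:R^-1)%R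
     <= (Ceps * Num.sqrt k%:R)%:E)%E.
Hypothesis delta0 : 0 < delta.
Hypothesis N1 : (1 < N)%N.
Hypothesis q0 : (0 < q)%N.
Hypothesis betaq : beta_coef X q <= Cb ^+ 2 * (q%:R * (ln N%:R / n%:R)).

Let a := margin eta.
Let kappa := truncation eta Fb.
Let B := small_loss_bound eta Fb.
Let lam := noise_scale eta Ceps Fb.
Let K := laplace_const Ceps.
Let M := (n - r)%N.
Let mf0 : measurable_fun setT f0 := ar_measurable ar.

Let a0 : 0 < a. Proof. exact: margin_gt0. Qed.

Let a8 : a <= 8^-1.
Proof. by rewrite /a /margin -[leRHS]mul1r ler_pM2r// ge_min lexx orbT. Qed.

Let a_eta : a <= eta / 8.
Proof. by rewrite /a /margin ler_pM2r// ge_min lexx. Qed.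

Let kappaF : 0 < kappa + Fb.
Proof.
by rewrite ltr_wpDl// mulr_ge0 ?(ltW Fb0)// addr_ge0// divr_ge0// ltW.
Qed.

Let lam0 : 0 < lam. Proof. exact: noise_scale_gt0. Qed.

Let lam_radius : lam * (2 * Fb) <= exp_radius Ceps / 2.
Proof.
have : lam <= exp_radius Ceps / (4 * Fb) by rewrite ge_min lexx.
rewrite ler_pdivlMr ?mulr_gt0//; lra.
Qed.

Let lamK : 4 * (K * lam) <= a.
Proof.
have K0 : 0 <= K by exact: laplace_const_ge0.
have : lam <= a / (4 * (K + 1)) by rewrite ge_min lexx orbT.
rewrite ler_pdivlMr ?mulr_gt0//; last by lra.
by have := lam0; lra.
Qed.

Variables (g : 'I_N -> 'M[R]_(r, d) -> 'rV[R]_d) (f : 'M[R]_(r, d) -> 'rV[R]_d).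
Variable fhat : T -> 'M[R]_(r, d) -> 'rV[R]_d.
Hypothesis mg : forall k, measurable_fun setT (g k).
Hypothesis bg : forall k, bounded_on_weight W Fb (g k).
Hypothesis mf : measurable_fun setT f.
Hypothesis bf : bounded_on_weight W Fb f.
Hypothesis mfhat : forall w, measurable_fun setT (fhat w).
Hypothesis bfhat : forall w, bounded_on_weight W Fb (fhat w).
Hypothesis fhat_min : forall w, emp_risk X W n (fhat w) w <= emp_risk X W n f w.
Hypothesis cover : forall w, exists k, forall x j, `|fhat w x 0 j - g k x 0 j| <= delta.

Local Notation small h := (small_loss f0 W kappa h).
Local Notation large h := (large_loss f0 W kappa h).
Local Notation ESmall h := (\int[P]_w (small h (lag r X r%:Z w))%:E)%E.
Local Notation ELarge h := (\int[P]_w (large h (lag r X r%:Z w))%:E)%E.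

Let n0 : (0 < n)%N. Proof. exact: leq_ltn_trans rn. Qed.

Let statX : stationary X := ar_stationary ar.

Let ESmall_fin h : bounded_on_weight W Fb h -> ESmall h \is a fin_num.
Proof.
move=> bh; rewrite ge0_fin_numE; last first.
  by apply: integral_ge0 => w _; rewrite lee_fin small_loss_ge0.
apply: (@le_lt_trans _ _ (\int[P]_w B%:E)%E); last first.
  by rewrite integral_cst//= probability_setT mule1 ltry.
apply: ge0_le_integralT => w; rewrite lee_fin ?small_loss_ge0//.
exact: (small_loss_le f0 W01 Fb0 a0).
Qed.

Let ESmall_le h : bounded_on_weight W Fb h -> fine (ESmall h) <= B.
Proof.
move=> bh; rewrite -lee_fin fineK ?ESmall_fin//.
have -> : (B%:E = \int[P]_w B%:E)%E by rewrite integral_cst//= probability_setT mule1.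
apply: ge0_le_integralT => w; rewrite lee_fin ?small_loss_ge0//.
exact: (small_loss_le f0 W01 Fb0 a0).
Qed.

Let ESmall_dist w k : (forall x j, `|fhat w x 0 j - g k x 0 j| <= delta) ->
  (ESmall (fhat w) <= (fine (ESmall (g k)) + 2 * (kappa + Fb) * delta)%:E)%E.
Proof.
move=> hk; rewrite EFinD fineK ?ESmall_fin//.
have c0 : 0 <= 2 * (kappa + Fb) * delta by rewrite !mulr_ge0 ?(ltW delta0) ?(ltW kappaF).
have -> : ((2 * (kappa + Fb) * delta)%:E = \int[P]_w (2 * (kappa + Fb) * delta)%:E)%E.
  by rewrite integral_cst//= probability_setT mule1.
rewrite -ge0_integralD//=; last 2 first.
- by move=> v _; rewrite lee_fin small_loss_ge0.
- apply/measurable_EFinP; apply: measurable_lag_comp.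
  exact: measurable_small_loss.
apply: ge0_le_integralT => v; first by rewrite lee_fin small_loss_ge0.
by rewrite -EFinD lee_fin; exact: (small_loss_dist f0 W01 Fb0 a0).
Qed.

Let ELarge_le w : (ELarge (fhat w) <= (1 + a)%:E * ELarge f)%E.
Proof.
have a1 : 0 <= 1 + a by have := a0; lra.
rewrite -ge0_integralZl//=; last 2 first.
- apply/measurable_EFinP; apply: measurable_lag_comp.
  exact: measurable_large_loss.
- by move=> v _; rewrite lee_fin large_loss_ge0.
apply: ge0_le_integralT => v; first by rewrite lee_fin large_loss_ge0.
rewrite -EFinM lee_fin; apply: (large_loss_le f0 W01 a0) => //.
by have := a8; lra.
Qed.

Let abs_noise w : R :=
  \sum_(0 <= m < M) (d%:R^-1 * \sum_j `|innovation r eps m w 0 j|).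

Let measurable_innov m j : measurable_fun setT (fun w => `|innovation r eps m w 0 j|).
Proof.
apply: (measurableT_comp (@normr_measurable R setT)).
by apply: measurable_coord_comp; exact: measurable_funPT.
Qed.

Let measurable_mean_abs m :
  measurable_fun setT (fun w => d%:R^-1 * \sum_j `|innovation r eps m w 0 j|).
Proof. by apply: measurable_funM => //; apply: measurable_sum => j. Qed.

Let mean_abs_ge0 m w : 0 <= d%:R^-1 * \sum_j `|innovation r eps m w 0 j|.
Proof. by rewrite mulr_ge0 ?invr_ge0// sumr_ge0. Qed.

Let integral_abs_noise : (\int[P]_w (abs_noise w)%:E <= (M%:R * Ceps)%:E)%E.
Proof.
under eq_integral do rewrite /abs_noise -sumEFin.
rewrite ge0_integral_sum//=; last 2 first.
- by move=> m; exact/measurable_EFinP.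
- by move=> m w _; rewrite lee_fin.
apply: (@le_trans _ _ (\sum_(0 <= m < M) Ceps%:E)%E); last first.
  by rewrite sumEFin sumr_const_nat subn0 mulr_natl.
apply: lee_sum => m _.
under eq_integral do rewrite EFinM.
have mS : measurable_fun setT (fun w => (\sum_j `|innovation r eps m w 0 j|)%:E).
  by apply/measurable_EFinP; apply: measurable_sum => j.
rewrite (ge0_integralZl P measurableT mS); last 2 first.
- by move=> w _; rewrite lee_fin sumr_ge0.
- by rewrite lee_fin invr_ge0.
apply: (@le_trans _ _ ((d%:R^-1)%:E * \sum_(j < d) Ceps%:E)%E).
  rewrite lee_wpmul2l ?lee_fin ?invr_ge0//.
  under eq_integral do rewrite -sumEFin.
  rewrite ge0_integral_sum//=; last first.
    by move=> j; exact/measurable_EFinP.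
  by apply: lee_sum => j _; exact: (expectation_abs_eps Ceps0 ar moments).
rewrite sumEFin sumr_const card_ord -EFinM lee_fin -[Ceps *+ d]mulr_natl mulrA.
by rewrite mulVf ?mul1r// pnatr_eq0 -lt0n.
Qed.

Lemma oracle_inequality :
  (\int[P]_w pred_error X f0 W (fhat w) <=
   ((1 + eta) ^+ 2)%:E * pred_error X f0 W f +
   (oracle_const eta Cb Ceps Fb r * (q%:R * (ln N%:R / n%:R) + delta))%:E)%E.
Proof.
pose u k x := W x *: (g k x - f x).
have mu k : measurable_fun setT (u k).
  apply: measurable_fun_mx => i j; rewrite (_ : (fun x => _) =
      (fun x => W x * (g k x i j - f x i j))).
    by apply: measurable_funM => //; apply: measurable_funB; exact: measurable_coord_comp.
  by apply/funext => x; rewrite !mxE.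
have uU k x j : `|u k x 0 j| <= 2 * Fb.
  rewrite !mxE normrM; have /andP[w0 w1] := W01 x; rewrite (ger0_norm w0).
  have [->|Wx] := eqVneq (W x) 0; first by rewrite mul0r; move: Fb0; lra.
  have := ler_normB (g k x 0 j) (f x 0 j); have := bg k j Wx; have := bf j Wx.
  have := normr_ge0 (g k x 0 j - f x 0 j); nra.
have N0 : (0 < N)%N by exact: ltnW.
have M0 : (0 < M)%N by rewrite subn_gt0.
have [Q [mQ Q0 QN IQ]] := noise_bound d0 Ceps0 ar moments M N0 mu uU lam0 lam_radius.
have B0 : 0 < B by rewrite exprn_gt0.
have a2 : a <= 2^-1 by have := a8; lra.
have rhoB k x : 0 <= small (g k) x <= B.
  by rewrite small_loss_ge0//=; exact: (small_loss_le f0 W01 Fb0 a0).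
have [G [mG G0 GN IG]] := lower_deviation_lag statX r0 M0 q0 a0 a2 B0 delta0
  (fun k => measurable_small_loss kappa mf0 mW (mg k)) rhoB.
(* The coefficient 6 is 4 from [small_mean_le] plus 2 from [ESmall_dist]. *)
pose c0 : R := (6 * (kappa + Fb) + 2) * delta + r%:R * B / n%:R.
have nR : 0 < n%:R :> R by rewrite ltr0n.
have lag_sum (h : 'M[R]_(r, d) -> R) : measurable_fun setT h ->
    measurable_fun setT (fun w => \sum_(0 <= m < M) h (past_lag r X m w)).
  by move=> mh; apply: measurable_sum => m; exact: (measurable_lag_comp X (r%:Z + m%:Z) mh).
(* The mean large loss of [f] may be infinite, so it stays in the extended reals. *)
pose tail (w : T) : \bar R := (c0%:E + (1 + a)%:E * ELarge f)%E.
have ELarge0 : (0 <= ELarge f)%E.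
  by apply: integral_ge0 => w _; rewrite lee_fin large_loss_ge0.
have a1 : 0 <= 1 + a by have := a0; lra.
have tail0 : [/\ measurable_fun setT tail, forall w, (0 <= tail w)%E &
    (\int[P]_w tail w <= c0%:E + (1 + a)%:E * ELarge f)%E].
  have c00 : 0 <= c0.
    exact: addr_ge0 (mulr_ge0 (addr_ge0 (mulr_ge0 (ler0n _ 6) (ltW kappaF)) (ler0n _ 2))
      (ltW delta0)) (divr_ge0 (mulr_ge0 (ler0n _ r) (ltW B0)) (ltW nR)).
  split; rewrite /tail.
  - exact: measurable_cst.
  - move=> w; apply: adde_ge0; first by rewrite lee_fin.
    by apply: mule_ge0; rewrite ?lee_fin.
  - by rewrite integral_cst//= probability_setT mule1.
have bE : 0 <= 4 * delta / n%:R := divr_ge0 (mulr_ge0 (ler0n _ 4) (ltW delta0)) (ltW nR).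
have mE : measurable_fun setT abs_noise by apply: measurable_sum => m.
have E0 w : 0 <= abs_noise w by apply: sumr_ge0.
have s1 := ge0_integral_scaleD_le bE mE E0 integral_abs_noise tail0.
have bG : 0 <= 2 / n%:R :> R by rewrite divr_ge0// ltW.
have s2 := ge0_integral_scaleD_le bG mG G0 IG s1.
have bQ : 0 <= 4 / n%:R :> R by rewrite divr_ge0// ltW.
have s3 := ge0_integral_scaleD_le bQ mQ Q0 IQ s2.
have bL : 0 <= 4 * a / n%:R := divr_ge0 (mulr_ge0 (ler0n _ 4) (ltW a0)) (ltW nR).
have ml := measurable_large_loss kappa mf0 mW mf.
have large0 := large_loss_ge0 f0 kappa W01 f.
have IL : (\int[P]_w (\sum_(0 <= m < M) large f (past_lag r X m w))%:E
    <= M%:R%:E * ELarge f)%E by rewrite integral_sum_lag.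
have s4 := ge0_integral_scaleD_le bL (lag_sum _ ml)
  (fun w => sumr_ge0 _ (fun m _ => large0 (past_lag r X m w))) IL s3.
have a5 : 0 <= 1 + 5 * a by have := a0; lra.
have bS : 0 <= (1 + 5 * a) / n%:R := divr_ge0 a5 (ltW nR).
have ms := measurable_small_loss kappa mf0 mW mf.
have small0 := small_loss_ge0 f0 kappa W01 f.
have IS : (\int[P]_w (\sum_(0 <= m < M) small f (past_lag r X m w))%:E
    <= M%:R%:E * ESmall f)%E by rewrite integral_sum_lag.
have [_ _ s5] := ge0_integral_scaleD_le bS (lag_sum _ ms)
  (fun w => sumr_ge0 _ (fun m _ => small0 (past_lag r X m w))) IS s4.
have main : (\int[P]_w pred_error X f0 W (fhat w) <= \int[P]_w
    (((1 + 5 * a) / n%:R * \sum_(0 <= m < M) small f (past_lag r X m w))%:E +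
     ((4 * a / n%:R * \sum_(0 <= m < M) large f (past_lag r X m w))%:E +
     ((4 / n%:R * Q w)%:E + ((2 / n%:R * G w)%:E +
     ((4 * delta / n%:R * abs_noise w)%:E + tail w))))))%E.
  apply: ge0_le_integralT => w; first exact: pred_error_ge0.
  have [k hk] := cover w.
  rewrite (pred_error_split X mf0 mW W01 d0 kappa (mfhat w)).
  apply: (le_trans (leeD (ESmall_dist hk) (ELarge_le w))).
  have fk : ((fine (ESmall (g k)))%:E = ESmall (g k))%E by rewrite fineK// ESmall_fin.
  have mk0 : 0 <= fine (ESmall (g k)).
    by rewrite fine_ge0// integral_ge0// => v _; rewrite lee_fin small_loss_ge0.
  have nE : n = (M + r)%N by rewrite /M subnK// ltnW.
  have h : fine (ESmall (g k)) <=
      (1 + 5 * a) / n%:R * (\sum_(0 <= m < M) small f (past_lag r X m w)) +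
      (4 * a / n%:R * (\sum_(0 <= m < M) large f (past_lag r X m w)) +
      (4 / n%:R * Q w + (2 / n%:R * G w + (4 * delta / n%:R * abs_noise w +
      ((4 * (kappa + Fb) + 2) * delta + r%:R * B / n%:R))))) :=
    @small_mean_le R d r f0 W W01 d0 kappa Fb a lam K delta (Q w) (G w) n M
    (fun m => past_lag r X m w) (fun m => innovation r eps m w) f (fhat w) (g k)
    (fine (ESmall (g k))) Fb0 a0 a8 erefl bf (bfhat w) (bg k) delta0 hk
    (mulr_ge0 (laplace_const_ge0 Ceps) (ltW lam0)) lamK n0 nE (Q0 w) (G0 w) mk0
    (ESmall_le (bg k)) (basic_inequality ar rn (fhat_min w)) (QN w k) (GN w k _ fk).
  rewrite /tail !addeA -!EFinD; apply: leeD2r; rewrite lee_fin /c0.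
  by move: h; lra.
apply: (le_trans main); apply: (le_trans s5).
rewrite (pred_error_split X mf0 mW W01 d0 kappa mf).
have := ESmall_fin bf.
have : (0 <= ESmall f)%E by apply: integral_ge0 => w _; rewrite lee_fin small_loss_ge0.
case: (ESmall f) => // s; rewrite lee_fin => s0 _.
have eta2 : 0 < (1 + eta) ^+ 2 by rewrite exprn_gt0// addr_gt0.
(* If the large loss of [f] has infinite mean, so does its full loss, and the right-hand side is
   infinite. *)
move: ELarge0; case: (ELarge f) => // [l|_]; last first.
  by rewrite (_ : s%:E + +oo = +oo)%E// [(((1 + eta) ^+ 2)%:E * _)%E]gt0_muley ?lte_fin// addye// leey.
rewrite lee_fin => l0.
rewrite -!EFinM -!EFinD -?EFinM -?EFinD lee_fin.
clear main s1 s2 s3 s4 s5 tail0 IL IS IQ IG QN GN lag_sum rhoB ms ml mE.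
have H0 := @half_le_ln R N N1; have H1 := @lnS_le R N N1.
have hb := betaq; set H := ln N%:R in H0 H1 hb *.
have nV0 : 0 < n%:R^-1 :> R by rewrite invr_gt0.
have Mn : M%:R / n%:R <= 1 :> R by rewrite ler_pdivrMr// mul1r ler_nat leq_subr.
have t0 : 0 <= M%:R / n%:R :> R by rewrite divr_ge0// ltW.
set t := M%:R / n%:R in Mn t0.
set La := q%:R * (H / n%:R) in hb *.
have HLa : H / n%:R <= La.
  by rewrite ler_peMl ?divr_ge0 ?(ltW nR) ?ler1n//; move: H0; lra.
have nLa : n%:R^-1 <= 2 * La.
  by apply: (@le_trans _ _ (2 * (H / n%:R))); [rewrite mulrA ler_peMl ?(ltW nV0)//; move: H0; lra|rewrite ler_pM2l].
have La0 : 0 <= La by apply: le_trans HLa; rewrite divr_ge0 ?(ltW nR)//; move: H0; lra.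
have p1 : (1 + 5 * a) / n%:R * (M%:R * s) <= (1 + 5 * a) * s.
  rewrite (_ : _ * _ = (1 + 5 * a) * s * t); last by rewrite /t; ring.
  by rewrite ler_piMr//; exact: mulr_ge0.
have p2 : 4 * a / n%:R * (M%:R * l) <= 4 * a * l.
  rewrite (_ : _ * _ = 4 * a * l * t); last by rewrite /t; ring.
  by rewrite ler_piMr//; exact: mulr_ge0 (mulr_ge0 (ler0n _ 4) (ltW a0)) l0.
have lamV : 0 < lam^-1 by rewrite invr_gt0.
(* [H >= 1 / 2] gives [H + 1 <= 3 * H], hence [12 = 4 * 3]. *)
have p3 : 4 / n%:R * (lam^-1 * (H + 1)) <= 12 / lam * La.
  rewrite (_ : _ * _ = 4 / lam * ((H + 1) / n%:R)); last by ring.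
  rewrite (_ : 12 / lam * La = 4 / lam * (3 * La)); last by ring.
  rewrite ler_pM2l ?mulr_gt0//.
  apply: (@le_trans _ _ (3 * (H / n%:R))); last by rewrite ler_pM2l.
  by rewrite mulrA ler_pM2r//; move: H0; lra.
have Ba : 0 <= B / a := divr_ge0 (ltW B0) (ltW a0).
have p4 : 2 / n%:R * (B / a * ((q + r.-1)%:R * ln (1 + N%:R) + M%:R * (2 * beta_coef X q)))
    <= B / a * (4 * r%:R + 4 * Cb ^+ 2) * La.
  rewrite (_ : 2 / n%:R * _ = B / a * (2 * ((q + r.-1)%:R * (ln (1 + N%:R) / n%:R)) +
    4 * (t * beta_coef X q))); last by rewrite /t; ring.
  rewrite -[leRHS]mulrA ler_wpM2l// [leRHS]mulrDl; apply: lerD.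
    rewrite (_ : 4 * r%:R * La = 2 * (r%:R * q%:R * (2 * H / n%:R))); last by rewrite /La; ring.
    rewrite ler_pM2l// ler_pM ?mulr_ge0 ?(ltW nV0)//.
    - by rewrite ln_ge0// lerDl.
    (* [q + r - 1 <= r * q], because [(r - 1) * (q - 1) >= 0]. *)
    - by rewrite -natrM ler_nat; move: r0 q0; clear; nia.
    - by rewrite ler_pM2r.
  rewrite -mulrA ler_pM2l//; apply: le_trans hb.
  by rewrite ler_piMl// beta_coef_ge0.
have p5 : 4 * delta / n%:R * (M%:R * Ceps) <= 4 * Ceps * delta.
  rewrite (_ : _ * _ = 4 * Ceps * delta * t); last by rewrite /t; ring.
  rewrite ler_piMr//.
  exact: mulr_ge0 (mulr_ge0 (ler0n _ 4) (ltW Ceps0)) (ltW delta0).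
have p6 : r%:R * B / n%:R <= 2 * r%:R * B * La.
  rewrite (_ : 2 * r%:R * B * La = r%:R * B * (2 * La)); last by ring.
  by rewrite ler_wpM2l//; exact: mulr_ge0 (ler0n _ r) (ltW B0).
(* Both parts of the error of [f] carry [1 + 5 * a]: for the large part this is [4 * a] from the
   empirical terms plus [1 + a] from [ELarge_le]. *)
have p7 : (1 + 5 * a) * (s + l) <= (1 + eta) ^+ 2 * (s + l).
  rewrite ler_wpM2r ?addr_ge0//; have := a_eta; have := eta0; have := sqr_ge0 eta.
  by rewrite expr2 => ???; nra.
have d1 : 0 <= delta by exact: ltW.
have cL : 0 <= (4 * Ceps + (6 * (kappa + Fb) + 2)) * La.
  apply: mulr_ge0 La0; move: Ceps0 kappaF; lra.
have cB : 0 <= 4 * r%:R + 4 * Cb ^+ 2 :> R.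
  exact: addr_ge0 (mulr_ge0 (ler0n _ 4) (ler0n _ r)) (mulr_ge0 (ler0n _ 4) (sqr_ge0 Cb)).
have cd : 0 <= (12 / lam + B / a * (4 * r%:R + 4 * Cb ^+ 2) + 2 * r%:R * B) * delta.
  exact: mulr_ge0 (addr_ge0 (addr_ge0 (divr_ge0 (ler0n _ 12) (ltW lam0))
    (mulr_ge0 Ba cB)) (mulr_ge0 (mulr_ge0 (ler0n _ 2) (ler0n _ r)) (ltW B0))) d1.
rewrite /oracle_const -/lam -/a -/B -/kappa /c0.
move: p1 p2 p3 p4 p5 p6 p7 cL cd; lra.
Qed.

End oracle_inequality.

Lemma pred_error_dist {R : realType} {dT : measure_display} {T : measurableType dT}
    (P : probability T R) (d r : nat) (X : int -> {RV P >-> 'rV[R]_d})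
    (f0 : 'M[R]_(r, d) -> 'rV[R]_d) (W : 'M[R]_(r, d) -> R)
    (g f : 'M[R]_(r, d) -> 'rV[R]_d) (t delta : R) :
  measurable_fun setT f0 -> measurable_fun setT W -> (forall x, 0 <= W x <= 1) ->
  (0 < d)%N -> measurable_fun setT g -> measurable_fun setT f ->
  0 < t -> delta <= 1 -> (forall x j, `|g x 0 j - f x 0 j| <= delta) ->
  (pred_error X f0 W g <=
   (1 + t)%:E * pred_error X f0 W f + ((1 + t^-1) * delta)%:E)%E.
Proof.
move=> mf0 mW W01 d0 mg mf t0 delta1 gf.
have ml h : measurable_fun setT h ->
    measurable_fun setT (fun w => (loss f0 W h (lag r X r%:Z w))%:E).
  by move=> mh; apply/measurable_EFinP; apply: measurable_lag_comp; exact: measurable_loss.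
have l0 h w : (0 <= (loss f0 W h (lag r X r%:Z w))%:E)%E by rewrite lee_fin loss_ge0.
have t1 : (0 <= (1 + t)%:E)%E by rewrite lee_fin addr_ge0// ltW.
have delta0 : 0 <= delta by apply: le_trans (gf 0 (Ordinal d0)).
have tV : 0 <= (1 + t^-1) * delta by rewrite mulr_ge0// addr_ge0// invr_ge0 ltW.
rewrite !pred_errorE// -ge0_integralZl//; last exact: ml.
have -> : (((1 + t^-1) * delta)%:E = \int[P]_w ((1 + t^-1) * delta)%:E)%E.
  by rewrite integral_cst//= probability_setT mule1.
rewrite -ge0_integralD//; last 2 first.
- by move=> w _; exact: mule_ge0.
- by apply: measurable_funeM; exact: ml.
apply: ge0_le_integralT => w //; rewrite -EFinM -EFinD lee_fin.
exact: loss_dist.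
Qed.

Lemma le_mule_ereal_inf {R : realType} (x : \bar R) (c k : R) (A : set (\bar R)) : 0 < c ->
  (forall y, A y -> (x <= c%:E * y + k%:E)%E) -> (x <= c%:E * ereal_inf A + k%:E)%E.
Proof.
move=> c0 h; rewrite -leeBlDr// -lee_pdivrMl//.
by apply: le_ereal_inf_tmp => y Ay; rewrite lee_pdivrMl// leeBlDr// h.
Qed.

Theorem theorem4p1 (R : realType) (eta c0 Cbsub Cb Ceps Fb : R) (r : nat) :
  0 < eta -> 0 < Cbsub -> 0 < Ceps -> 0 < Fb -> (0 < r)%N ->
  exists C : R,
  forall (d n : nat) (dT : measure_display) (T : measurableType dT)
    (P : probability T R) (X eps : int -> {RV P >-> 'rV[R]_d})
    (f0 : 'M[R]_(r, d) -> 'rV[R]_d) (W : 'M[R]_(r, d) -> R)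
    (F : set ('M[R]_(r, d) -> 'rV[R]_d)) (phi : R -> R)
    (fhat : T -> 'M[R]_(r, d) -> 'rV[R]_d) (delta : R),
  (0 < d)%N -> (r < n)%N ->
  autoregressive X eps f0 ->
  measurable_fun setT W -> (forall x, 0 <= W x <= 1) ->
  (forall f, F f -> measurable_fun setT f) ->
  (forall f, F f -> forall j x, supp W x -> `|f x 0 j| <= Fb) ->
  (forall (k : nat) (j : 'I_d), (0 < k)%N ->
    ('E_P[fun w => (`|eps 1 w 0 j| ^+ k)%R] `^ (k%:R^-1)%R
       <= (Ceps * Num.sqrt k%:R)%:E)%E) ->
  compatible (beta_coef X) phi c0 Cbsub ->
  C_beta (beta_coef X) phi = Cb%:E ->
  empirical_minimizer X f0 W n F fhat ->
  0 < delta -> delta < 1 ->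
  (\int[P]_w pred_error X f0 W (fhat w)
     <= ((1 + eta) ^+ 2)%:E * ereal_inf [set pred_error X f0 W f | f in F]
        + C%:E * (er_map (Lambda_mix phi) (entropy delta F * (n%:R^-1)%:E)
                  + delta%:E))%E.

Proof.
move=> eta0 _ Ceps0 Fb0 r0.
(* For a single bracket [pred_error_dist] is applied twice with [t = eta], and the remainders add up
   to [((1 + eta) + 1) * (1 + eta^-1) * delta]. *)
pose C1 : R := (2 + eta) * (1 + eta^-1).
have C10 : 0 < C1 by rewrite mulr_gt0 ?addr_gt0 ?invr_gt0.
have Cm0 := oracle_const_ge0 Cb r eta0 Ceps0 Fb0.
exists (oracle_const eta Cb Ceps Fb r + C1).
move=> d n dT T P X eps f0 W F phi fhat delta d0 rn ar mW W01 mF bF moments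
  cphi hC [fhatF _ fhat_min] delta0 delta1.
have Cpos : 0 < oracle_const eta Cb Ceps Fb r + C1 by lra.
have mf0 := ar_measurable ar.
have bW f : F f -> bounded_on_weight W Fb f.
  by move=> Ff x j Wx; apply: bF => //; exact: subset_closure.
have eta2 : 0 < (1 + eta) ^+ 2 by rewrite exprn_gt0// addr_gt0.
have inf0 : (0 <= ((1 + eta) ^+ 2)%:E * ereal_inf [set pred_error X f0 W f | f in F])%E.
  rewrite mule_ge0 ?lee_fin ?(ltW eta2)//.
  by apply: le_ereal_inf_tmp => _ [f Ff <-]; exact: pred_error_ge0.
have nR : 0 < n%:R :> R by rewrite ltr0n; exact: leq_ltn_trans rn.
have Fne : F !=set0 by exists (fhat point); exact: fhatF.
rewrite /entropy; have [->|[N [N0 -> [g [Fg cover]]]]] := bracket_number_cover delta Fne.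
  (* Without a finite cover the entropy is infinite, and so is the right-hand side; nonnegativity of
     the first summand excludes a sum of opposite infinities. *)
  rewrite /= gt0_mulye ?lte_fin ?invr_gt0//= addye// gt0_muley ?lte_fin// addey ?leey//.
  by rewrite gt_eqF// (lt_le_trans _ inf0).
have NR : 0 < N%:R :> R by rewrite ltr0n.
have -> : lne N%:R%:E = (ln N%:R)%:E :> \bar R by rewrite /= leNgt NR.
rewrite -!EFinM -?EFinD -?EFinM /=.
apply: le_mule_ereal_inf => // _ [f Ff <-].
have mfhat w : measurable_fun setT (fhat w) by exact: (mF _ (fhatF w)).
have [N1|N1] := leqP N 1.
  (* Here [H = 0] and [Lambda_mix phi 0 = 0]. Every member of the class is within [delta] of
     [g ord0], so [fhat w] is compared with [g ord0] and [g ord0] with [f]. *)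
  have {N0 N1}NE : N = 1%N by apply/eqP; rewrite eqn_leq N1.
  move: g Fg cover NR; rewrite NE => g Fg cover _; rewrite ln1 mul0r /Lambda_mix eqxx add0r.
  have near h : F h -> forall x j, `|h x 0 j - g ord0 x 0 j| <= delta.
    by move=> Fh; have [k] := cover _ Fh; rewrite ord1.
  have mg := mF _ (Fg ord0).
  have hg : (pred_error X f0 W (g ord0) <=
      (1 + eta)%:E * pred_error X f0 W f + ((1 + eta^-1) * delta)%:E)%E.
    apply: pred_error_dist => //; [exact: mF|exact: ltW|move=> x j].
    by rewrite distrC; exact: near.
  apply: (@le_trans _ _ (\int[P]_w ((1 + eta)%:E * pred_error X f0 W (g ord0) +
      ((1 + eta^-1) * delta)%:E))%E).
    apply: ge0_le_integralT => w; first exact: pred_error_ge0.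
    by apply: pred_error_dist => //; [exact: ltW|exact/near/fhatF].
  rewrite integral_cst//= probability_setT mule1.
  have e1 : (0 <= (1 + eta)%:E)%E by rewrite lee_fin addr_ge0// ltW.
  apply: (@le_trans _ _ ((1 + eta)%:E * ((1 + eta)%:E * pred_error X f0 W f +
      ((1 + eta^-1) * delta)%:E) + ((1 + eta^-1) * delta)%:E)%E).
    by rewrite leeD2r// lee_wpmul2l.
  have tV : 0 <= (1 + eta^-1) * delta by rewrite mulr_ge0 ?(ltW delta0)// addr_ge0// invr_ge0 ltW.
  have e2 : (0 <= (1 + eta)%:E * pred_error X f0 W f)%E.
    by apply: mule_ge0 => //; exact: pred_error_ge0.
  have e3 : (0 <= ((1 + eta^-1) * delta)%:E)%E by rewrite lee_fin.
  rewrite (ge0_muleDr _ e2 e3) muleA -EFinM -expr2.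
  rewrite -addeA leeD2l// -EFinM -EFinD lee_fin /C1.
  have : 0 <= oracle_const eta Cb Ceps Fb r * delta by rewrite mulr_ge0// ltW.
  lra.
have H0 : 0 < ln N%:R / n%:R :> R.
  by rewrite divr_gt0// (lt_le_trans _ (@half_le_ln R N N1)).
have [q [q0 -> bq]] := Lambda_mixP cphi (beta_coef_ge0 X) (@beta_coef_nincr _ _ _ _ _ _ X)
  hC (beta_coef_le1 X) H0.
apply: (le_trans (oracle_inequality eta0 Ceps0 Fb0 r0 d0 rn ar mW W01 moments delta0 N1
  q0 bq (fun k => mF _ (Fg k)) (fun k => bW _ (Fg k)) (mF _ Ff) (bW _ Ff) mfhat
  (fun w => bW _ (fhatF w)) (fun w => fhat_min w _ Ff) (fun w => cover _ (fhatF w)))).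
rewrite leeD2l// lee_fin ler_wpM2r//; last by lra.
by rewrite addr_ge0 ?(ltW delta0)// mulr_ge0// ltW.
Qed.
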